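(* Let $K$ be a $\mathrm{CM}$-field which is a quadratic extension of the totally real number field $F$, let $\mathcal S=\{v_1,\dots,v_r\}$ be the set of all archimedean places of $K$, and suppose that $r>2$. Let $\alpha\in F^*$, $\beta\in K\setminus F$ and $$g=\left(\begin{pmatrix}1&0\\ \beta&1\end{pmatrix}\begin{pmatrix}1&\alpha\\0&1\end{pmatrix},e,\dots,e\right)\in G=\prod_{i=1}^r\mathrm{SL}_2(K_{v_i}).$$ Then: (a) each of the orbits $T\pi(g)$ and $T_{\mathbb R}\pi(g)$ is not dense in $G/\Gamma$; (b) each of the sets $\overline{T\pi(g)}\setminus T\pi(g)$ and $\overline{T_{\mathbb R}\pi(g)}\setminus T_{\mathbb R}\pi(g)$ is not contained in a union of countably many closed orbits of proper closed subgroups of $G$. In particular, each of the closures $\overline{T\pi(g)}$ and $\overline{T_{\mathbb R}\pi(g)}$ is not homogeneous.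
   Context: $K$ is a $\mathrm{CM}$-field: $K=F(\sqrt{-d})$ with $F$ a totally real number field, $d\in F$ positive in every archimedean completion of $F$; thus $K_v=\mathbb C$ and $F_v=\mathbb R$ for each $v\in\mathcal S$, where archimedean places of $F$ are identified with their unique extensions to $K$. $\mathcal O_K$ is the ring of integers of $K$, $G=\mathrm{SL}_2(K_{\mathcal S})=\prod_{v\in\mathcal S}\mathrm{SL}_2(K_v)$, $\Gamma=\mathrm{SL}_2(\mathcal O_K)$ diagonally embedded in $G$, $\pi:G\to G/\Gamma$ the quotient map, and $G$ acts on $G/\Gamma$ by $h\pi(g)=\pi(hg)$. $T=\prod_{v\in\mathcal S}T_v$ where $T_v$ is the group of complex diagonal matrices in $\mathrm{SL}_2(K_v)=\mathrm{SL}_2(\mathbb C)$, and $T_{\mathbb R}\subset T$ is the product over $v\in\mathcal S$ of the groups of real diagonal matrices in $T_v$. The closure of an orbit $M\pi(g)$ is homogeneous if it equals $L\pi(g)$ for a closed subgroup $L$ of $G$. *)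

(* Defs.v *)
From HB Require Import structures.
From mathcomp Require Import all_boot all_order all_algebra all_field.
From mathcomp Require Import generic_quotient complex.
From mathcomp Require Import all_classical all_reals all_analysis.

Set Implicit Arguments.
Unset Strict Implicit.
Unset Printing Implicit Defensive.

Import Order.TTheory GRing.Theory Num.Theory.
Import numFieldNormedType.Exports.

Local Open Scope classical_set_scope.
Local Open Scope quotient_scope.
Local Open Scope ring_scope.

(* The usual topology of the complex numbers R[i], given by the modulus. *)
HB.instance Definition _ (R : realType) := NormedModule.copy R[i] R[i]^o.

Section SL2.
Variable A : comUnitRingType.

Record SL2 := MkSL2 { SL2_val :> 'M[A]_2; _ : \det SL2_val == 1 }.

HB.instance Definition _ := [isSub for SL2_val].
HB.instance Definition _ := [Choice of SL2 by <:].

Lemma SL2_det (g : SL2) : \det g = 1.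
Proof. by case: g => g /= /eqP. Qed.

Lemma SL2_unit (g : SL2) : (g : 'M[A]_2) \in unitmx.
Proof. by rewrite unitmxE SL2_det unitr1. Qed.

Fact SL2_one_subproof : \det (1%:M : 'M[A]_2) == 1.
Proof. by rewrite det1. Qed.
Fact SL2_mul_subproof (g h : SL2) : \det (g *m h) == 1.
Proof. by rewrite det_mulmx !SL2_det mulr1. Qed.
Fact SL2_inv_subproof (g : SL2) : \det (invmx g) == 1.
Proof. by rewrite det_inv SL2_det invr1. Qed.

Definition SL2_one := MkSL2 SL2_one_subproof.
Definition SL2_mul g h := MkSL2 (SL2_mul_subproof g h).
Definition SL2_inv g := MkSL2 (SL2_inv_subproof g).

Fact SL2_mulA : associative SL2_mul.
Proof. by move=> f g h; apply: val_inj; rewrite /= mulmxA. Qed.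
Fact SL2_mul1 : left_id SL2_one SL2_mul.
Proof. by move=> g; apply: val_inj; rewrite /= mul1mx. Qed.
Fact SL2_mulr1 : right_id SL2_one SL2_mul.
Proof. by move=> g; apply: val_inj; rewrite /= mulmx1. Qed.
Fact SL2_mulV : left_inverse SL2_one SL2_inv SL2_mul.
Proof. by move=> g; apply: val_inj; rewrite /= mulVmx ?SL2_unit. Qed.
Fact SL2_mulrV : right_inverse SL2_one SL2_inv SL2_mul.
Proof. by move=> g; apply: val_inj; rewrite /= mulmxV ?SL2_unit. Qed.

HB.instance Definition _ :=
  isGroup.Build SL2 SL2_mulA SL2_mul1 SL2_mulr1 SL2_mulV SL2_mulrV.

Definition mx2 (a b c d : A) : 'M[A]_2 :=
  \matrix_(i < 2, j < 2) (nth [::] [:: [:: a; b]; [:: c; d]] i)`_j.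

Lemma det_mx2 a b c d : \det (mx2 a b c d) = a * d - b * c.
Proof.
rewrite (expand_det_row _ ord0) !big_ord_recl big_ord0 addr0 /cofactor.
rewrite !det_mx11 !mxE /=.
by rewrite expr0 expr1 mul1r mulN1r mulrN.
Qed.

Fact upper_subproof x : \det (mx2 1 x 0 1) == 1.
Proof. by rewrite det_mx2 mulr0 subr0 mulr1. Qed.
Fact lower_subproof x : \det (mx2 1 0 x 1) == 1.
Proof. by rewrite det_mx2 mul0r subr0 mulr1. Qed.

Definition upper x : SL2 := MkSL2 (upper_subproof x).
Definition lower x : SL2 := MkSL2 (lower_subproof x).

End SL2.

Section SL2_map.
Variables (A B : comUnitRingType) (f : {rmorphism A -> B}).

Fact SL2_map_subproof (g : SL2 A) : \det (map_mx f g) == 1.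
Proof. by rewrite det_map_mx SL2_det rmorph1. Qed.

Definition SL2_map (g : SL2 A) : SL2 B := MkSL2 (SL2_map_subproof g).

Lemma SL2_map1 : SL2_map 1%g = 1%g.
Proof. by apply: val_inj; rewrite /= map_mx1. Qed.
Lemma SL2_mapM g h : SL2_map (g * h)%g = (SL2_map g * SL2_map h)%g.
Proof. by apply: val_inj; rewrite /= map_mxM. Qed.
Lemma SL2_mapV g : SL2_map (g^-1)%g = ((SL2_map g)^-1)%g.
Proof.
rewrite -[LHS]mulg1 -(mulgV (SL2_map g)) mulgA -SL2_mapM mulVg.
by rewrite SL2_map1 mul1g.
Qed.

End SL2_map.

(* The topology of SL2(C) is induced by that of the 2x2 matrices. *)
HB.instance Definition _ (R : realType) :=
  Topological.copy (SL2 R[i]) (initial_topology (@SL2_val R[i])).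

Section NumberFields.
Variables (R : realType) (K : fieldExtType rat).

(* Two complex embeddings define the same archimedean place of K when they are
   equal up to complex conjugation.  The family sigma then consists of one
   embedding for each archimedean place, each place occurring exactly once. *)
Definition same_place (tau tau' : {rmorphism K -> R[i]}) : Prop :=
  tau =1 tau' \/ forall x, tau x = Num.conj (tau' x).

Definition archimedean_places r (sigma : 'I_r -> {rmorphism K -> R[i]}) : Prop :=
  forall tau, exists! i, same_place tau (sigma i).

Definition totally_real (F : {subfield K}) : Prop :=
  forall (tau : {rmorphism subvs_of F -> R[i]}) x, tau x \is Num.real.

(* In R[i], 0 < z means that z is real and positive. *)
Definition CM_extension (F : {subfield K}) : Prop :=
  totally_real F /\
  exists (d : subvs_of F) (delta : K),
    [/\ forall tau : {rmorphism subvs_of F -> R[i]}, 0 < tau d,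
        delta ^+ 2 = - vsval d
      & <<F; delta>>%VS = fullv].

Definition SL2_OK : set (SL2 K) :=
  [set A | forall i j, integralOver (intr : int -> K) (A i j)].

Lemma SL2_OK1 : SL2_OK 1%g.
Proof.
by move=> i j; rewrite !mxE; case: eqP => _; [exact: integral1|exact: mxpoly.integral0].
Qed.

Lemma SL2_OKM A B : SL2_OK A -> SL2_OK B -> SL2_OK (A * B)%g.
Proof.
move=> hA hB i j; rewrite !mxE; elim/big_ind: _ => [|x y|k _].
- exact: mxpoly.integral0.
- exact: integral_add.
- exact: integral_mul.
Qed.

Lemma SL2_OKV A : SL2_OK A -> SL2_OK (A^-1)%g.
Proof.
move=> hA i j; rewrite /= /invmx SL2_unit SL2_det invr1 scale1r !mxE.
rewrite /cofactor; apply: integral_mul.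
  by rewrite -signr_odd; case: odd;
    rewrite ?expr1 ?expr0; [apply/integral_opp/integral1|exact: integral1].
by rewrite det_mx11 !mxE.
Qed.

End NumberFields.

Section Space.
Variables (R : realType) (r : nat).

(* The group SL2(K_S), each completion K_v being identified with the complex
   numbers by the embedding chosen for v. *)
Definition GS : Type := prod_topology (fun _ : 'I_r => SL2 R[i]).

HB.instance Definition _ :=
  Topological.copy GS (prod_topology (fun _ : 'I_r => SL2 R[i])).

Definition GS_one : GS := fun=> 1%g.
Definition GS_mul (g h : GS) : GS := fun i => (g i * h i)%g.
Definition GS_inv (g : GS) : GS := fun i => ((g i)^-1)%g.

Fact GS_mulA : associative GS_mul.
Proof. by move=> f g h; apply/funext => i; exact: mulgA. Qed.
Fact GS_mul1 : left_id GS_one GS_mul.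
Proof. by move=> g; apply/funext => i; exact: mul1g. Qed.
Fact GS_mulr1 : right_id GS_one GS_mul.
Proof. by move=> g; apply/funext => i; exact: mulg1. Qed.
Fact GS_mulV : left_inverse GS_one GS_inv GS_mul.
Proof. by move=> g; apply/funext => i; exact: mulVg. Qed.
Fact GS_mulrV : right_inverse GS_one GS_inv GS_mul.
Proof. by move=> g; apply/funext => i; exact: mulgV. Qed.

HB.instance Definition _ :=
  isGroup.Build GS GS_mulA GS_mul1 GS_mulr1 GS_mulV GS_mulrV.

Definition closed_subgroup (L : set GS) : Prop :=
  closed L /\ group_closed [in L].

Definition torus : set GS := [set h | forall i, is_diag_mx (h i)].

Definition real_torus : set GS :=
  [set h | torus h /\ forall i a b, h i a b \is Num.real].

Variables (K : fieldExtType rat) (sigma : 'I_r -> {rmorphism K -> R[i]}).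

Definition diagonal_embedding (A : SL2 K) : GS := fun i => SL2_map (sigma i) A.

Definition Gamma : set GS := diagonal_embedding @` @SL2_OK K.

Lemma Gamma1 : Gamma 1%g.
Proof.
exists 1%g; first exact: SL2_OK1.
by apply/funext => i; exact: SL2_map1.
Qed.

Lemma GammaM g h : Gamma g -> Gamma h -> Gamma (g * h)%g.
Proof.
move=> [A hA <-] [B hB <-]; exists (A * B)%g; first exact: SL2_OKM.
by apply/funext => i; exact: SL2_mapM.
Qed.

Lemma GammaV g : Gamma g -> Gamma (g^-1)%g.
Proof.
move=> [A hA <-]; exists (A^-1)%g; first exact: SL2_OKV.
by apply/funext => i; exact: SL2_mapV.
Qed.

Definition same_coset : rel GS := fun g h => `[< Gamma (g^-1 * h)%g >].

Fact same_coset_refl : reflexive same_coset.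
Proof. by move=> g; apply/asboolP; rewrite mulVg; exact: Gamma1. Qed.
Fact same_coset_sym : symmetric same_coset.
Proof.
by move=> g h; apply/asboolP/asboolP => /GammaV; rewrite invgM invgK.
Qed.
Fact same_coset_trans : transitive same_coset.
Proof.
move=> h g k /asboolP gh /asboolP hk; apply/asboolP.
by have := GammaM gh hk; rewrite mulgA mulgK.
Qed.

Canonical same_coset_equiv :=
  EquivRel same_coset same_coset_refl same_coset_sym same_coset_trans.

Definition GmodGamma : Type := quotient_topology {eq_quot same_coset_equiv}.

HB.instance Definition _ :=
  Topological.copy GmodGamma (quotient_topology {eq_quot same_coset_equiv}).

Definition pi_Gamma (g : GS) : GmodGamma :=
  \pi_{eq_quot same_coset_equiv} g.

Lemma pi_GammaP g h : pi_Gamma g = pi_Gamma h <-> Gamma (g^-1 * h)%g.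
Proof.
by rewrite /pi_Gamma; split=> [/eqmodP/asboolP//|gh]; apply/eqmodP/asboolP.
Qed.

Definition repr_Gamma (x : GmodGamma) : GS :=
  repr (x : {eq_quot same_coset_equiv}).

Lemma repr_GammaK x : pi_Gamma (repr_Gamma x) = x.
Proof. exact: reprK. Qed.

Definition act_Gamma (h : GS) (x : GmodGamma) : GmodGamma :=
  pi_Gamma (h * repr_Gamma x)%g.

Lemma act_Gamma_pi h g : act_Gamma h (pi_Gamma g) = pi_Gamma (h * g)%g.
Proof.
apply/pi_GammaP; rewrite invgM mulgA mulgVK.
by apply/pi_GammaP; rewrite repr_GammaK.
Qed.

Definition orbit_Gamma (M : set GS) (x : GmodGamma) : set GmodGamma :=
  [set act_Gamma h x | h in M].

Definition homogeneous_closure (M : set GS) (x : GmodGamma) : Prop :=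
  exists L : set GS, closed_subgroup L /\ closure (orbit_Gamma M x) = orbit_Gamma L x.

Definition closed_proper_orbit (Y : set GmodGamma) : Prop :=
  exists (L : set GS) (x : GmodGamma),
    [/\ closed_subgroup L, L <> setT, Y = orbit_Gamma L x & closed Y].

Definition in_countable_union_of_closed_proper_orbits (Z : set GmodGamma) : Prop :=
  exists C : set (set GmodGamma),
    [/\ countable C, C `<=` closed_proper_orbit & Z `<=` \bigcup_(Y in C) Y].

(* v_1 is the place of index 0. *)
Definition g_elt (alpha beta : K) : GS :=
  fun i => if i == 0%N :> nat then SL2_map (sigma i) (lower beta * upper alpha)%g
           else 1%g.

End Space.

(* Main.v *)
From HB Require Import structures.
Require Import Defs.
From mathcomp Require Import all_boot all_order all_algebra all_field.
From mathcomp Require Import complex.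
From mathcomp Require Import all_classical all_reals all_analysis.
From mathcomp Require Import ring lra.

Set Implicit Arguments.
Unset Strict Implicit.
Unset Printing Implicit Defensive.

Import Order.TTheory GRing.Theory Num.Theory.
Import numFieldNormedType.Exports.
Import ComplexField.Normc.

Local Open Scope classical_set_scope.
Local Open Scope ring_scope.
Local Open Scope complex_scope.

(** Write X for the matrix (lower b * upper a) standing at the first place: a is
    real and nonzero because alpha lies in F, and b is not real because beta
    does not.

    The orbit of T is not dense.  Let h = t g gamma with t in T and gamma in
    SL2 (O_K), and let p and q be the rows of gamma.  For kap in K of modulus one
    at every place, consider the numbers kap p_l q_k^* - q_l p_k^* of K, where
    ^* is the conjugation of K over F.  Away from the first place they are
    given by the entries of h, up to factors of modulus one.  At the first
    place they are bounded by a constant depending only on a and b, if kap = 1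
    when t is large there and kap = rho / rho^* with rho = b / (1 + a b) when t
    is small (form_bound_large, form_bound_small); this is where a must be
    real.  If h is near upper (eps + i eps^2) at the other places, then the
    number with k = l = 1 is small there; it is integral up to a fixed
    denominator, so its norm is less than one and it vanishes
    (integral_norm_ge1).  This forces the factors of modulus one to be nearly
    equal, which makes the sum of the two numbers with k <> l small, hence
    zero as well; and the two equations contradict the fact that eps + i eps^2
    is not real (no_small_form, torus_not_dense).

    The set of new limit points is not covered.  Since r > 2, the real units of
    K are dense in the positive numbers at the first place (real_units_dense).
    Hence the closure of either orbit contains the image of d X d' at the first
    place, for all positive diagonal d and d' (z_in_closure), while the orbit
    itself does so only for countably many d' (z_in_torus_orbit).  If countably
    many closed orbits L y cover the remaining points, the pigeonhole
    principle gives one L such that uncountably many d and d' occur, and as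
    an uncountable closed subgroup of the line is the whole line, L contains
    the positive diagonal group at the first place and its conjugate by X.  As
    b is not real these generate SL2 (C) in the topological sense
    (two_tori_generate), and since O_K is dense in the product of the other
    places (integers_dense) the closedness of L y spreads this to all
    places (spread_everywhere): L is the whole group.

    A homogeneous closure L x would be everything, so that the orbit is dense,
    or a single closed orbit of a proper subgroup covering the new points
    (not_homogeneous).

    The arithmetic of K rests on an integral generator th whose conjugates are
    the sigma i th and their complex conjugates (min_poly_factors).  The norm
    of f(th) is the determinant of the integral matrix f(M), M a companion
    matrix (norm_evZ); small elements come from the box principle
    (small_integers), units from infinitely many elements of bounded norm
    (unit_near_one), and density from rounding an interpolation polynomial. *)

(** * Modulus and boxes *)

(** A constant of its own, so that the ring morphism lemmas recognize the
    embedding whichever of its many instances the argument was elaborated with. *)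
Definition RtoC (R : realType) (x : R) : R[i] := x%:C.
HB.instance Definition _ (R : realType) :=
  GRing.RMorphism.copy (@RtoC R) (real_complex R).
Notation "x %:RC" := (RtoC x) (at level 1, left associativity, format "x %:RC") : ring_scope.

Section Modulus.
Variable R : realType.
Implicit Types z w : R[i].

Lemma normcE_norm z : `|z| = (normc z)%:C.
Proof. by []. Qed.

Lemma normc_ge0 z : 0 <= normc z.
Proof. by rewrite -(@ler0c R) -normcE_norm normr_ge0. Qed.

Lemma normcD z w : normc (z + w) <= normc z + normc w.
Proof. exact: le_normcD. Qed.

Lemma normcNE z : normc (- z) = normc z.
Proof. exact: normcN. Qed.

Lemma normcB z w : normc (z - w) <= normc z + normc w.
Proof. by rewrite -[normc w]normcNE normcD. Qed.

Lemma normc_distC z w : normc (z - w) = normc (w - z).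
Proof. by rewrite -normcNE opprB. Qed.

Lemma normc_conj z : normc z^* = normc z.
Proof. by case: z => x y /=; rewrite sqrrN. Qed.

Lemma normc_eq0 z : (normc z == 0) = (z == 0).
Proof. by apply/eqP/eqP => [/eq0_normc//|->]; exact: normc0. Qed.

Lemma normc_gt0 z : (0 < normc z) = (z != 0).
Proof. by rewrite lt_def normc_ge0 andbT normc_eq0. Qed.

Lemma normc_real (x : R) : normc x%:C = `|x|.
Proof. by rewrite /= expr0n addr0 sqrtr_sqr. Qed.

Lemma normc_RtoC (x : R) : normc x%:RC = `|x|.
Proof. exact: normc_real. Qed.

Lemma normcX z n : normc (z ^+ n) = normc z ^+ n.
Proof. by elim: n => [|n IH]; rewrite ?expr0 ?normc1// !exprS normcM IH. Qed.

Lemma normc_sum (I : Type) (s : seq I) (P : pred I) (F : I -> R[i]) :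
  normc (\sum_(i <- s | P i) F i) <= \sum_(i <- s | P i) normc (F i).
Proof.
elim/big_rec2: _ => [|i x z _ le_zx]; first by rewrite normc0.
by apply: le_trans (normcD _ _) _; rewrite lerD2l.
Qed.

Lemma normc_Re z : `|complex.Re z| <= normc z.
Proof. by case: z => x y /=; rewrite -sqrtr_sqr ler_wsqrtr// lerDl sqr_ge0. Qed.

Lemma normc_Im z : `|complex.Im z| <= normc z.
Proof. by case: z => x y /=; rewrite -sqrtr_sqr ler_wsqrtr// lerDr sqr_ge0. Qed.

Lemma normc_le_ReIm z : normc z <= `|complex.Re z| + `|complex.Im z|.
Proof.
rewrite {1}[z]complexE; apply: le_trans (normcD _ _) _.
rewrite normcM !normc_real (_ : normc 'i = 1) ?mul1r//.
by rewrite /= expr0n expr1n add0r sqrtr1.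
Qed.

Lemma mul_conjc z : z * z^* = (normc z ^+ 2)%:RC.
Proof. by rewrite -sqr_normc normcE_norm rmorphXn. Qed.

End Modulus.

Lemma ord2P (a : 'I_2) : a = 0 \/ a = 1.
Proof.
by case: (unliftP 0 a) => [a'|] ->; [right|left]; rewrite ?ord1//; apply: val_inj.
Qed.

Section Boxes.
Variables (R : realType) (r : nat).
Implicit Types (h : GS R r) (e : R).

(** The sup-norm boxes; they form a base of neighbourhoods in the group, so
    that all topological arguments below become estimates on matrix entries. *)
Definition box h e : set (GS R r) :=
  [set h' | forall i a b, normc (h' i a b - h i a b) < e].

Let min4 (x y z t : R) (m := Num.min (Num.min x y) (Num.min z t)) :
  [/\ m <= x, m <= y, m <= z & m <= t].
Proof. by rewrite /m !ge_min; split; rewrite lexx ?orbT. Qed.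

Lemma sub_box h e e' : e <= e' -> box h e `<=` box h e'.
Proof. by move=> le h' hh i a b; apply: lt_le_trans (hh i a b) le. Qed.

Lemma entry_continuous i a b : continuous (fun h => (h i : 'M[R[i]]_2) a b).
Proof.
move=> h.
have c1 : {for h, continuous (fun h : GS R r => h i)}.
  exact: (@proj_continuous _ (fun _ : 'I_r => SL2 R[i]) i h).
have c2 : {for h i, continuous (fun g : SL2 R[i] => (g : 'M[R[i]]_2))}.
  exact: (@initial_continuous _ _ (@SL2_val R[i]) (h i)).
have c3 := @coord_continuous _ 2 2 a b (h i : 'M[R[i]]_2).
exact: (continuous_comp c1 (continuous_comp c2 c3)).
Qed.

Lemma nbhs_box h e : 0 < e -> nbhs h (box h e).
Proof.
move=> e0.
have H i a b : nbhs h [set h' | normc (h' i a b - h i a b) < e].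
  have e0' : 0 < e%:C by rewrite ltcR.
  pose B := [set h' : GS R r | ball (h i a b : R[i]) e%:C (h' i a b)].
  have n1 : nbhs (h i a b : R[i]) (ball (h i a b : R[i]) e%:C).
    exact: nbhsx_ballx.
  have nB : nbhs h B.
    by have := @entry_continuous i a b h _ n1; rewrite nbhs_filterE.
  have sB : B `<=` [set h' | normc (h' i a b - h i a b) < e].
    by move=> h' hB; rewrite /= normc_distC -ltcR; exact: hB.
  exact: (@filterS _ (nbhs h) (nbhs_filter h) _ _ sB nB).
have H1 i a : nbhs h [set h' | forall b, normc (h' i a b - h i a b) < e].
  pose f b : set (GS R r) := [set h' | normc (h' i a b - h i a b) < e].
  exact: (@filter_forall (GS R r) 'I_2 f (nbhs h) (nbhs_filter h) (H i a)).
have H2 i : nbhs h [set h' | forall a b, normc (h' i a b - h i a b) < e].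
  pose f a : set (GS R r) := [set h' | forall b, normc (h' i a b - h i a b) < e].
  exact: (@filter_forall (GS R r) 'I_2 f (nbhs h) (nbhs_filter h) (H1 i)).
pose f i : set (GS R r) := [set h' | forall a b, normc (h' i a b - h i a b) < e].
exact: (@filter_forall (GS R r) 'I_r f (nbhs h) (nbhs_filter h) H2).
Qed.

Lemma nbhs_boxP h (U : set (GS R r)) :
  nbhs h U <-> exists2 e, 0 < e & box h e `<=` U.
Proof.
split; last by move=> [e e0 /filterS]; apply; exact: nbhs_box.
pose F := filter_from [set e : R | 0 < e] (box h).
suff : F --> h by move=> /(_ U).
have FF : Filter F.
  apply: filter_from_filter; first by exists 1 => /=.
  move=> e1 e2 /= e10 e20; exists (Num.min e1 e2); first by rewrite /= lt_min e10.
  by move=> h' hh'; split; apply: sub_box hh'; rewrite ge_min lexx ?orbT.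
apply/cvg_sup => i A [_ [[B Bo <-] Bh sB]].
have [C Co CB] : open (B : set (initial_topology (@SL2_val R[i]))) by [].
have : nbhs (SL2_val (h i)) C.
  by apply: open_nbhs_nbhs; split => //; move: Bh; rewrite -CB.
move=> [P Pn sP].
have Q a b : exists e, 0 < e /\ forall z, normc (z - h i a b) < e -> P a b z.
  have /nbhs_ballP[[x y] /= xy0 sb] := Pn a b.
  move: xy0; rewrite ltcE /= => /andP[/eqP y0 x0]; subst y.
  exists x; split=> // z zx; apply: sb.
  by rewrite -ball_normE /= distrC ltcR.
have [e eP] : {e | forall a b, 0 < e a b /\ forall z, normc (z - h i a b) < e a b -> P a b z}.
  pose e a b := sval (cid (Q a b)); exists e => a b.
  exact: (svalP (cid (Q a b))).
exists (Num.min (Num.min (e 0 0) (e 0 1)) (Num.min (e 1 0) (e 1 1))).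
  by rewrite /= !lt_min !(eP _ _).1.
move=> h' hh'; apply: sB => /=; rewrite -CB; apply: sP => a b.
apply: (eP a b).2; apply: lt_le_trans (hh' i a b) _.
have [m1 m2 m3 m4] := min4 (e 0 0) (e 0 1) (e 1 0) (e 1 1).
by case: (ord2P a) => ->; case: (ord2P b) => ->.
Qed.

End Boxes.

(** * Countable sets and closed subgroups of the line *)

Section Countability.

Lemma subset_countable (T : Type) (A B : set T) :
  A `<=` B -> countable B -> countable A.
Proof. by move=> /subset_card_le; exact: sub_countable. Qed.

Lemma countable_setU (T : Type) (A B : set T) :
  countable A -> countable B -> countable (A `|` B).
Proof.
move=> cA cB; rewrite (_ : A `|` B = \bigcup_(b in [set: bool]) if b then A else B).
  by apply: bigcup_countable => [|[]//]; exact: countableP.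
apply/seteqP; split=> [x [Ax|Bx]|x [[] _ ?]]; [exists true|exists false|left|right] => //.
Qed.

Lemma uncountable_piece (I T : Type) (D : set I) (F : I -> set T) (A : set T) :
    countable D -> A `<=` \bigcup_(i in D) F i -> ~ countable A ->
  exists2 i, D i & ~ countable (A `&` F i).
Proof.
move=> cD AF nA; apply: contrapT => H; apply: nA.
have : countable (\bigcup_(i in D) (A `&` F i)).
  apply: bigcup_countable => // i Di; apply: contrapT => nc; apply: H.
  by exists i.
apply: subset_countable => x Ax; have [i Di Fx] := AF x Ax.
by exists i.
Qed.

Lemma uncountable_real (R : realType) : ~ countable [set: R].
Proof.
move=> cR; have /countable_lebesgue_measure0 : countable (`[0, 1]%classic : set R).
  exact: subset_countable cR.
rewrite lebesgue_measure_itv /= lte_fin ltr01 oppr0 adde0 => /eqP.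
by rewrite eqe oner_eq0.
Qed.

(** A closed subgroup of the line is either everything or it avoids an interval
    next to the origin, in which case it is discrete and so countable. *)
Lemma uncountable_closed_subgroup (R : realType) (S : set R) :
    (forall x y, S x -> S y -> S (x - y)) ->
    (forall x, (forall e, 0 < e -> exists2 s, S s & `|s - x| < e) -> S x) ->
  ~ countable S -> forall x, S x.
Proof.
move=> SB Scl uS.
have [s0 Ss0] : exists s, S s.
  apply: contrapT => /forallNP S0; apply: uS.
  by rewrite (_ : S = set0)//; apply/seteqP; split=> // x /S0.
have S0 : S 0 by rewrite -(subrr s0); exact: SB.
have SN x : S x -> S (- x) by move=> Sx; rewrite -sub0r; exact: SB.
have SD x y : S x -> S y -> S (x + y).
  by move=> Sx /SN Sy; rewrite -[y]opprK; exact: SB.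
have [[e e0 He]|Hn] :=
    pselect (exists2 e, 0 < e & forall s, S s -> 0 < s -> e <= s).
  exfalso; apply: uS.
  have inj : {in S &, injective (fun s => Num.floor (s / e))}.
    have lt_inj s t : S s -> S t -> Num.floor (s / e) = Num.floor (t / e) -> ~ (s < t).
      move=> Ss St fst st.
      have := He _ (SB _ _ St Ss); rewrite subr_gt0 => /(_ st).
      apply/negP; rewrite -ltNge -(ltr_pM2r (x := e^-1)) ?invr_gt0//.
      rewrite divff ?gt_eqF// mulrBl.
      have := Num.Theory.floor_le (s / e); have := Num.Theory.floorD1_gt (t / e).
      rewrite -fst intrD => h1 h2.
      by rewrite ltrBlDl; apply: lt_le_trans h1 _; rewrite lerD2r.
    move=> s t /set_mem Ss /set_mem St fst.
    have [st|ts|//] := ltgtP s t; exfalso.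
      exact: lt_inj fst st.
    exact: (lt_inj t s) (esym fst) ts.
  have := inj_card_eq inj; rewrite card_eq_sym => /card_eqPle[+ _].
  move=> /sub_countable; apply.
  exact: (@countableP int).
move=> x; apply: Scl => e e0.
have [s [Ss s_gt0 se]] : exists s, [/\ S s, 0 < s & s < e].
  apply: contrapT => /forallNP H; apply: Hn; exists e => // t St t_gt0.
  by rewrite leNgt; apply/negP => te; apply: (H t).
have SM n : S (s *+ n) by elim: n => [|n IH]; rewrite ?mulr0n// mulrS; exact: SD.
exists (s *~ Num.floor (x / s)).
  by case: (Num.floor _) => n; rewrite ?NegzE ?mulrNz; [|apply: SN]; exact: SM.
rewrite -mulrzl.
have h1 := Num.Theory.floor_le (x / s); have := Num.Theory.floorD1_gt (x / s).
rewrite intrD => h2.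
rewrite distrC ger0_norm; last first.
  by rewrite subr_ge0 -ler_pdivlMr.
apply: lt_trans se; rewrite ltrBlDl -[X in _ + X]mul1r -mulrDl.
by rewrite -ltr_pdivrMr// addrC.
Qed.

End Countability.

(** * Two by two matrices *)

Section TwoByTwo.

Variable A : comUnitRingType.
Implicit Types g h : SL2 A.

Lemma SL2_eq g h :
  g 0 0 = h 0 0 -> g 0 1 = h 0 1 -> g 1 0 = h 1 0 -> g 1 1 = h 1 1 -> g = h.
Proof.
move=> e00 e01 e10 e11; apply: val_inj; apply/matrixP => a b.
by case: (ord2P a) => ->; case: (ord2P b) => ->.
Qed.

Lemma SL2_mulE g h a b : (g * h)%g a b = g a 0 * h 0 b + g a 1 * h 1 b.
Proof.
rewrite mxE !big_ord_recl big_ord0 addr0.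
by rewrite (_ : lift 0 0 = 1)//; apply: val_inj.
Qed.

Lemma SL2_oneE : ((1%g : SL2 A) 0 0 = 1) * ((1%g : SL2 A) 0 1 = 0) *
  ((1%g : SL2 A) 1 0 = 0) * ((1%g : SL2 A) 1 1 = 1).
Proof. by rewrite !mxE. Qed.

Lemma mx2E (a b c d : A) : (mx2 a b c d 0 0 = a) * (mx2 a b c d 0 1 = b) *
  (mx2 a b c d 1 0 = c) * (mx2 a b c d 1 1 = d).
Proof. by rewrite /mx2 !mxE. Qed.

Lemma SL2_det2 g : g 0 0 * g 1 1 - g 0 1 * g 1 0 = 1.
Proof.
rewrite -(SL2_det g) -det_mx2; congr (\det _); apply/matrixP => a b.
by case: (ord2P a) => ->; case: (ord2P b) => ->; rewrite mx2E.
Qed.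

Lemma SL2_invE g : ((g^-1)%g 0 0 = g 1 1) * ((g^-1)%g 0 1 = - g 0 1) *
  ((g^-1)%g 1 0 = - g 1 0) * ((g^-1)%g 1 1 = g 0 0).
Proof.
have adjP : \det (mx2 (g 1 1) (- g 0 1) (- g 1 0) (g 0 0)) == 1.
  by rewrite det_mx2 mulrNN [g 1 1 * _]mulrC SL2_det2.
suff -> : (g^-1)%g = MkSL2 adjP by rewrite !mx2E.
apply: (mulgI g); rewrite mulgV.
have D := SL2_det2 g.
by apply: SL2_eq; rewrite SL2_mulE SL2_oneE /= !mx2E -?D; ring.
Qed.

Lemma upperE (x : A) : (upper x 0 0 = 1) * (upper x 0 1 = x) *
  (upper x 1 0 = 0) * (upper x 1 1 = 1).
Proof. by rewrite !mx2E. Qed.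

Lemma lowerE (x : A) : (lower x 0 0 = 1) * (lower x 0 1 = 0) *
  (lower x 1 0 = x) * (lower x 1 1 = 1).
Proof. by rewrite !mx2E. Qed.

Lemma upperD (x y : A) : upper (x + y) = (upper x * upper y)%g.
Proof. by apply: SL2_eq; rewrite SL2_mulE !upperE; ring. Qed.

Lemma lowerD (x y : A) : lower (x + y) = (lower x * lower y)%g.
Proof. by apply: SL2_eq; rewrite SL2_mulE !lowerE; ring. Qed.

Lemma upper0 : upper (0 : A) = 1%g.
Proof. by apply: SL2_eq; rewrite !SL2_oneE !upperE. Qed.

Lemma lower0 : lower (0 : A) = 1%g.
Proof. by apply: SL2_eq; rewrite !SL2_oneE !lowerE. Qed.

Lemma upperN (x : A) : upper (- x) = ((upper x)^-1)%g.
Proof. by apply: (mulgI (upper x)); rewrite mulgV -upperD subrr upper0. Qed.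

End TwoByTwo.

Section Diagonal.
Variable A : comUnitRingType.
Implicit Types a b : A.

(** Only meaningful for an invertible argument; the junk value elsewhere is
    chosen so that no proof has to be carried around. *)
Definition diag2 a : SL2 A := locked (insubd (1%g : SL2 A) (mx2 a 0 0 a^-1)).

Lemma diag2E a : a \is a GRing.unit -> (diag2 a 0 0 = a) * (diag2 a 0 1 = 0) *
  (diag2 a 1 0 = 0) * (diag2 a 1 1 = a^-1).
Proof.
move=> a0; rewrite /diag2 -lock insubdK ?mx2E//.
by rewrite -topredE /= det_mx2 mulr0 subr0 mulrV.
Qed.

Lemma diag2M a b : a \is a GRing.unit -> b \is a GRing.unit ->
  diag2 (a * b) = (diag2 a * diag2 b)%g.
Proof.
move=> a0 b0; have ab0 : a * b \is a GRing.unit by rewrite unitrM a0.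
by apply: SL2_eq; rewrite SL2_mulE !diag2E// ?invrM//; ring.
Qed.

Lemma diag2V a : a \is a GRing.unit -> diag2 a^-1 = ((diag2 a)^-1)%g.
Proof.
move=> a0; have a0' : a^-1 \is a GRing.unit by rewrite unitrV.
by apply: SL2_eq; rewrite SL2_invE !diag2E// ?invrK ?oppr0.
Qed.

End Diagonal.

(** A matrix with nonzero lower left entry is
    upper * lower * upper, and any other becomes so after a row operation. *)
Lemma SL2_generated (F : fieldType) (S : set (SL2 F)) :
    (forall g h, S g -> S h -> S (g * h)%g) ->
    (forall x, S (upper x)) -> (forall x, S (lower x)) ->
  forall g, S g.
Proof.
move=> SM Su Sl.
have H (g : SL2 F) : g 1 0 != 0 -> S g.
  move=> c0; have D := SL2_det2 g.
  pose x := (g 0 0 - 1) / g 1 0; pose y := (g 1 1 - 1) / g 1 0; pose c := g 1 0.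
  have -> : g = (upper x * lower c * upper y)%g.
    have db : g 0 1 = (g 0 0 * g 1 1 - 1) / g 1 0.
      by rewrite -D; field.
    by apply: SL2_eq; rewrite !SL2_mulE !upperE !lowerE ?db /x /y /c; field.
  exact: (SM _ _ (SM _ _ (Su _) (Sl _)) (Su _)).
move=> g; have [c0|] := eqVneq (g 1 0) 0; last exact: H.
have -> : g = (lower (- 1%R) * (lower 1%R * g))%g.
  by rewrite mulgA -lowerD addNr lower0 mul1g.
apply: (SM _ _ (Sl _)); apply: H; rewrite SL2_mulE !lowerE c0 mul1r mulr0 addr0.
have := SL2_det2 g; rewrite c0 mulr0 subr0.
by apply: contra_eq_neq => ->; rewrite mul0r eq_sym oner_eq0.
Qed.

(** * Limits of conjugates under the diagonal group *)

Section ConjugationLimits.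
Variables (R : realType) (S : set (SL2 R[i])).
Hypothesis SM : forall g h, S g -> S h -> S (g * h)%g.
Hypothesis SV : forall g, S g -> S (g^-1)%g.
Hypothesis Scl : forall g : SL2 R[i],
  (forall e : R, 0 < e ->
    exists2 g' : SL2 R[i], S g' & forall a b, normc (g' a b - g a b) < e) -> S g.
Hypothesis Sd : forall s : R, 0 < s -> S (diag2 s%:RC).

Let realC_neq0 (s : R) : 0 < s -> s%:RC != 0.
Proof. by move=> s0; rewrite gt_eqF// ltcR. Qed.

Let realC_unit (s : R) : 0 < s -> s%:RC \is a GRing.unit.
Proof. by move=> s0; rewrite unitfE realC_neq0. Qed.

Let diag_conj (t : R) (g : SL2 R[i]) : 0 < t -> S g ->
  exists g' : SL2 R[i], [/\ S g', g' 0 0 = g 0 0, g' 1 1 = g 1 1,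
    g' 0 1 = t%:RC * g 0 1 & g' 1 0 = (t%:RC)^-1 * g 1 0].
Proof.
move=> t0 Sg; pose u : R := Num.sqrt t.
have u0 : 0 < u by rewrite sqrtr_gt0.
have uu : u%:RC * u%:RC = t%:RC :> R[i] by rewrite -rmorphM -expr2 sqr_sqrtr// ltW.
have un := realC_neq0 u0; have uu' := realC_unit u0.
exists (diag2 u%:RC * g * (diag2 u%:RC)^-1)%g; split.
- exact: (SM (SM (Sd u0) Sg) (SV (Sd u0))).
- by rewrite !SL2_mulE !SL2_invE !diag2E//; field.
- by rewrite !SL2_mulE !SL2_invE !diag2E//; field.
- by rewrite !SL2_mulE !SL2_invE !diag2E// -uu; ring.
- by rewrite !SL2_mulE !SL2_invE !diag2E// -uu; field.
Qed.

Lemma conj_limit_upper (z : R[i]) :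
    (forall e : R, 0 < e -> exists (g : SL2 R[i]) (t : R),
      [/\ S g, 0 < t, normc (g 0 0 - 1) < e, normc (g 1 1 - 1) < e &
          normc (t%:RC * g 0 1 - z) < e /\ normc ((t%:RC)^-1 * g 1 0) < e]) ->
  S (upper z).
Proof.
move=> H; apply: Scl => e /H [g [t [Sg t0 g00 g11 [g01 g10]]]].
have [g' [Sg' e00 e11 e01 e10]] := diag_conj t0 Sg.
exists g' => // a b; case: (ord2P a) => ->; case: (ord2P b) => ->;
  by rewrite ?(e00, e11, e01, e10) upperE ?subr0.
Qed.

Lemma conj_limit_lower (z : R[i]) :
    (forall e : R, 0 < e -> exists (g : SL2 R[i]) (t : R),
      [/\ S g, 0 < t, normc (g 0 0 - 1) < e, normc (g 1 1 - 1) < e &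
          normc (t%:RC * g 1 0 - z) < e /\ normc ((t%:RC)^-1 * g 0 1) < e]) ->
  S (lower z).
Proof.
move=> H; apply: Scl => e /H [g [t [Sg t0 g00 g11 [g10 g01]]]].
have t0' : 0 < t^-1 by rewrite invr_gt0.
have [g' [Sg' e00 e11 e01 e10]] := diag_conj t0' Sg.
rewrite (fmorphV (@RtoC R)) /= in e01 e10; rewrite invrK in e10.
exists g' => // a b; case: (ord2P a) => ->; case: (ord2P b) => ->;
  by rewrite ?(e00, e11, e01, e10) lowerE ?subr0.
Qed.

Let small_quotients (e : R) (x y : R[i]) : 0 < e ->
  exists t : R, [/\ 0 < t, normc ((t%:RC)^-1 * x) < e & normc ((t%:RC)^-1 * ((t%:RC)^-1 * y)) < e].
Proof.
move=> e0; pose M : R := normc x + normc y.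
have Mx : normc x <= M by rewrite lerDl normc_ge0.
have My : normc y <= M by rewrite lerDr normc_ge0.
pose t : R := 1 + M / e.
have M0 : 0 <= M by apply: le_trans Mx; exact: normc_ge0.
have t1 : 1 <= t by rewrite lerDl divr_ge0// ltW.
have t0 : 0 < t by apply: lt_le_trans t1.
have Mt : t^-1 * M < e.
  by rewrite mulrC ltr_pdivrMr// /t mulrDr mulr1 mulrCA divff ?gt_eqF// mulr1 ltrDr.
have ti0 : 0 <= t^-1 by rewrite invr_ge0 ltW.
exists t; split=> //; rewrite !normcM !normcV normc_RtoC gtr0_norm//.
  by apply: le_lt_trans Mt; rewrite ler_wpM2l.
apply: le_lt_trans Mt; apply: ler_pM => //.
  by rewrite mulr_ge0// normc_ge0.
apply: le_trans My; rewrite ler_piMl ?normc_ge0//.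
by rewrite invf_le1.
Qed.

(** Conjugating an infinitesimal unipotent by an element of the group and
    rescaling with the diagonal group leaves in the limit only the entry that
    the rescaling expands. *)
Lemma unipotent_limit (w : R[i]) (Y : SL2 R[i]) :
    (forall s : R, 0 < s -> S (upper (s%:RC * w))) -> S Y ->
  S (upper (Y 0 0 ^+ 2 * w)) /\ S (lower (- (Y 1 0 ^+ 2 * w))).
Proof.
move=> Sw SY.
pose g (t : R) := (Y * upper ((t%:RC)^-1 * w) * Y^-1)%g.
have Sg t : 0 < t -> S (g t).
  move=> t0; apply: (SM (SM SY _) (SV SY)).
  by rewrite -(fmorphV (@RtoC R)); apply: Sw; rewrite invr_gt0.
have D := SL2_det2 Y.
have g00 t : g t 0 0 - 1 = (t%:RC)^-1 * (- (Y 0 0 * Y 1 0 * w)).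
  by rewrite -D !SL2_mulE !SL2_invE !upperE; ring.
have g11 t : g t 1 1 - 1 = (t%:RC)^-1 * (Y 0 0 * Y 1 0 * w).
  by rewrite -D !SL2_mulE !SL2_invE !upperE; ring.
have g01 t : g t 0 1 = (t%:RC)^-1 * (Y 0 0 ^+ 2 * w).
  by rewrite !SL2_mulE !SL2_invE !upperE; ring.
have g10 t : g t 1 0 = (t%:RC)^-1 * - (Y 1 0 ^+ 2 * w).
  by rewrite !SL2_mulE !SL2_invE !upperE; ring.
have tK (t : R) (z : R[i]) : 0 < t -> t%:RC * ((t%:RC)^-1 * z) - z = 0.
  by move=> t0; rewrite mulVKf ?subrr// realC_neq0.
split; [apply: conj_limit_upper|apply: conj_limit_lower] => e e0.
- have [t [t0 tx ty]] := small_quotients (Y 0 0 * Y 1 0 * w) (- (Y 1 0 ^+ 2 * w)) e0.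
  exists (g t), t; rewrite g00 g11 g01 g10 tK// normc0; split=> //.
    exact: Sg.
  by rewrite mulrN normcNE.
- have [t [t0 tx ty]] := small_quotients (Y 0 0 * Y 1 0 * w) (Y 0 0 ^+ 2 * w) e0.
  exists (g t), t; rewrite g00 g11 g01 g10 tK// normc0; split=> //.
    exact: Sg.
  by rewrite mulrN normcNE.
Qed.

Variables (a : R) (b : R[i]).
Hypothesis a0 : a != 0.
Hypothesis b_nonreal : complex.Im b != 0.
Let X : SL2 R[i] := (lower b * upper a%:RC)%g.
Hypothesis SX : forall s : R, 0 < s -> S (X * diag2 s%:RC * X^-1)%g.

Let k := a%:RC * b.
Let Y s := (X * diag2 s%:RC * X^-1)%g.
Let sg (s : R) : R := s - s^-1.

Let Y_entries s : 0 < s ->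
  [/\ Y s 0 0 = s%:RC + (sg s)%:RC * k, Y s 1 1 = (s%:RC)^-1 - (sg s)%:RC * k,
      Y s 0 1 = (sg s)%:RC * - a%:RC & Y s 1 0 = (sg s)%:RC * (b * (1 + k))].
Proof.
move=> s0; have sn := realC_neq0 s0; have su := realC_unit s0.
by split; rewrite !SL2_mulE !SL2_invE !diag2E// !SL2_mulE !lowerE !upperE;
  rewrite (rmorphB (@RtoC R)) (fmorphV (@RtoC R)) /= /k; field.
Qed.

Let upper_real (x : R) : S (upper x%:RC).
Proof.
have pos (y : R) : 0 < y -> S (upper (y%:RC * - a%:RC)).
  move=> y0; apply: conj_limit_upper => e e0.
  pose M : R := 1 + normc k + normc (b * (1 + k)) / y.
  have M1 : 1 <= M.
    by rewrite /M -addrA lerDl addr_ge0 ?divr_ge0 ?normc_ge0// ltW.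
  have M0 : 0 < M by apply: lt_le_trans M1.
  pose d : R := Num.min (1 / 2) (e / (4 * M)).
  have d0 : 0 < d by rewrite lt_min !divr_gt0// mulr_gt0.
  have dM : 2 * d * M < e.
    have : d <= e / (4 * M) by rewrite ge_min lexx orbT.
    rewrite ler_pdivlMr ?mulr_gt0// => H.
    by nra.
  have d12 : d <= 1 / 2 by rewrite ge_min lexx.
  pose s : R := 1 + d.
  have s1 : 1 < s by rewrite ltrDl.
  have s0 : 0 < s by apply: lt_trans s1.
  have si1 : s^-1 < 1 by rewrite invf_lt1.
  have ssi : s * s^-1 = 1 by rewrite divff ?gt_eqF.
  have sgd : sg s <= 2 * d.
    rewrite /sg; move: ssi s1 si1; set u := s^-1 => ssi s1 si1.
    by rewrite /s in ssi s1 *; nra.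
  have sg0 : 0 < sg s by rewrite subr_gt0 (lt_trans si1).
  have sg1 : sg s <= 1 by lra.
  have bound z : normc z <= sg s * M -> normc z < e.
    by move=> zM; apply: le_lt_trans zM _; nra.
  have [e00 e11 e01 e10] := Y_entries s0.
  exists (Y s), (y / sg s); rewrite e00 e11 e01 e10; split.
  - exact: SX.
  - by rewrite divr_gt0.
  - apply: bound; rewrite addrAC -(rmorph1 (@RtoC R)) -rmorphB.
    apply: le_trans (normcD _ _) _; rewrite normcM !normc_RtoC.
    rewrite (gtr0_norm sg0) gtr0_norm ?subr_gt0//.
    have h1 : s - 1 <= sg s by rewrite lerD2l lerN2 ltW.
    have h2 : 0 <= normc (b * (1 + k)) / y by rewrite divr_ge0 ?normc_ge0// ltW.
    rewrite /M; have := mulr_ge0 (ltW sg0) h2; set v := normc (_ * _) / y; lra.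
  - apply: bound; rewrite -(fmorphV (@RtoC R)) addrAC -(rmorph1 (@RtoC R)) -rmorphB.
    apply: le_trans (normcB _ _) _; rewrite normcM !normc_RtoC.
    rewrite (gtr0_norm sg0) ltr0_norm ?subr_lt0// opprB.
    have h1 : 1 - s^-1 <= sg s by rewrite lerD2r ltW.
    have h2 : 0 <= normc (b * (1 + k)) / y by rewrite divr_ge0 ?normc_ge0// ltW.
    rewrite /M; have := mulr_ge0 (ltW sg0) h2; set v := normc (_ * _) / y; lra.
  - split.
      by rewrite mulrA -rmorphM divfK ?gt_eqF// subrr normc0.
    apply: bound; rewrite -(fmorphV (@RtoC R)) /= normcM [X in _ * X]normcM !normc_RtoC.
    rewrite invf_div !gtr0_norm ?divr_gt0//.
    have -> : sg s / y * (sg s * normc (b * (1 + k))) =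
      sg s * sg s * (normc (b * (1 + k)) / y) by ring.
    set v := normc (b * (1 + k)) / y.
    have h2 : 0 <= v by rewrite divr_ge0 ?normc_ge0// ltW.
    have h3 := normc_ge0 k.
    have h4 : sg s * v <= v by rewrite ler_piMl.
    rewrite /M -/v -mulrA ler_pM2l//; lra.
have S1 : S 1%g by rewrite -(mulgV (diag2 1)); apply: SM; [|apply: SV]; exact: (Sd ltr01).
have xE : x = - x / a * - a by field.
have [x0|x0|x0] := ltgtP 0 (- x / a).
- by rewrite xE rmorphM rmorphN; exact: pos.
- rewrite -[upper _]invgK -upperN; apply: SV.
  have -> : - x%:RC = (x / a)%:RC * - a%:RC.
    by rewrite -!(rmorphN (@RtoC R)) -(rmorphM (@RtoC R)); congr (_ %:RC); field.
  by apply: pos; move: x0; rewrite mulNr oppr_lt0.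
- by rewrite xE -x0 mul0r upper0.
Qed.

(** The two one-parameter groups have fixed points 0, oo and a/(1+ab), 1/b on
    the Riemann sphere; these four points lie on a common circle only for real
    b.  Concretely: limits of conjugates give the real unipotents, then those
    with parameter in the squares of the entries of the second group, and some
    such square is not real. *)
Lemma two_tori_generate (g : SL2 R[i]) : S g.
Proof.
have Imk : complex.Im k != 0.
  have -> : complex.Im k = a * complex.Im b.
    by rewrite /k; case: (b) => u v /=; rewrite mul0r addr0.
  exact: mulf_neq0.
have [s [s0 sg0 Res]] : exists s : R, [/\ 0 < s, sg s != 0 & s + sg s * complex.Re k != 0].
  have [h|h] := eqVneq (2 + sg 2 * complex.Re k) 0; last first.
    by exists 2; split=> //; rewrite /sg gt_eqF//; lra.
  have kE : complex.Re k = - (4 / 3) by move: h; rewrite /sg; lra.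
  by exists 3; rewrite kE /sg; split=> //; [rewrite gt_eqF//|rewrite lt_eqF//]; lra.
have [e00 _ _ e10] := Y_entries s0.
have real_scale (t : R) : 0 < t -> S (upper (t%:RC * 1)).
  by move=> _; rewrite mulr1.
have Un x : S (upper x) -> S (upper (- x)) by move=> Sx; rewrite upperN; exact: SV.
have [Su _] := unipotent_limit real_scale (SX s0).
rewrite -/(Y s) mulr1 in Su.
set z := Y s 0 0 in Su e00.
have Imz : complex.Im (z ^+ 2) != 0.
  have -> : complex.Im (z ^+ 2) = 2 * (s + sg s * complex.Re k) * (sg s * complex.Im k).
    rewrite e00 expr2; case: (k) => u v /=; ring.
  by rewrite !mulf_neq0.
have Sline (t : R) : S (upper (t%:RC * z ^+ 2)).
  have scale (t' : R) : 0 < t' -> S (upper (t'%:RC * t%:RC)).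
    by move=> _; rewrite -(rmorphM (@RtoC R)); exact: upper_real.
  by have [] := unipotent_limit scale (SX s0); rewrite -/(Y s) -/z mulrC.
have Sup (w : R[i]) : S (upper w).
  pose t : R := complex.Im w / complex.Im (z ^+ 2).
  pose x : R := complex.Re w - t * complex.Re (z ^+ 2).
  have -> : w = x%:RC + t%:RC * z ^+ 2.
    rewrite /x /t; case: (z ^+ 2) Imz => p q /= q0; case: {x t} w => u v /=.
    by apply/eqP; rewrite eq_complex /=; apply/andP; split; apply/eqP; field.
  rewrite upperD; exact: (SM (upper_real _) (Sline _)).
have Slo (w : R[i]) : S (lower w).
  have c0 : Y s 1 0 != 0.
    rewrite e10 !mulf_neq0//.
    - by apply: contra_neq sg0 => /(@complexI R).
    - by apply: contra_neq b_nonreal => ->.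
    - by apply: contra_neq Imk => /eqP; rewrite addrC addr_eq0 => /eqP ->; rewrite /= oppr0.
  have scale (t : R) : 0 < t -> S (upper (t%:RC * - (w / Y s 1 0 ^+ 2))).
    by move=> _; exact: Sup.
  have [_] := unipotent_limit scale (SX s0).
  by rewrite -/(Y s) mulrN opprK mulrCA divff ?mulr1// expf_neq0.
exact: SL2_generated.
Qed.

End ConjugationLimits.

(** * Places and the quotient *)

Section Places.
Variables (R : realType) (r : nat).
Implicit Types (g h : SL2 R[i]) (L : set (GS R r)) (i j : 'I_r).

Definition at_place i g : GS R r := fun j => if j == i then g else 1%g.

Lemma at_place_eq i g : at_place i g i = g.
Proof. by rewrite /at_place eqxx. Qed.

Lemma at_place_neq i j g : j != i -> at_place i g j = 1%g.
Proof. by rewrite /at_place => /negPf ->. Qed.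

Lemma at_placeM i g h : at_place i (g * h)%g = (at_place i g * at_place i h)%g.
Proof.
apply/funext => j; rewrite /at_place [RHS]/(GS_mul _ _ _) /GS_mul.
by case: eqP => // _; rewrite mul1g.
Qed.

Lemma at_placeV i g : at_place i (g^-1)%g = ((at_place i g)^-1)%g.
Proof.
apply/funext => j; rewrite /at_place [RHS]/(GS_inv _ _) /GS_inv.
by case: eqP => // _; rewrite invg1.
Qed.

Lemma closed_boxP L (h : GS R r) : closed L ->
  (forall e : R, 0 < e -> exists2 h', box h e h' & L h') -> L h.
Proof.
move=> cL H; apply: cL => B /nbhs_boxP[e e0 sB].
by have [h' bh' Lh'] := H e e0; exists h'; split=> //; exact: sB.
Qed.

Lemma csubM L (g h : GS R r) : closed_subgroup L -> L g -> L h -> L (g * h)%g.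
Proof.
move=> [_ [L1 LB]] Lg Lh; rewrite -[h]invgK; apply/set_mem/LB; apply/mem_set => //.
by rewrite -[(h^-1)%g]mul1g; apply/set_mem/LB => //; apply/mem_set.
Qed.

Lemma csubV L (g : GS R r) : closed_subgroup L -> L g -> L (g^-1)%g.
Proof.
move=> [_ [L1 LB]] Lg.
by rewrite -[(g^-1)%g]mul1g; apply/set_mem/LB => //; apply/mem_set.
Qed.

Lemma csub1 L : closed_subgroup L -> L 1%g.
Proof. by move=> [_ [L1 _]]; apply/set_mem. Qed.

(** A closed subgroup with all elementary matrices at every place contains every
    SL2 factor, and the factors are multiplied together one place at a time. *)
Lemma csub_generated L : closed_subgroup L ->
    (forall i x, L (at_place i (upper x))) ->
    (forall i x, L (at_place i (lower x))) -> L = setT.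
Proof.
move=> cL Lu Ll; apply/seteqP; split=> // h _.
have Lat i g : L (at_place i g).
  have SM g1 g2 : L (at_place i g1) -> L (at_place i g2) -> L (at_place i (g1 * g2)%g).
    by rewrite at_placeM; exact: csubM.
  exact: (SL2_generated SM (Lu i) (Ll i)).
pose f k : GS R r := fun j : 'I_r => if (j < k)%N then h j else 1%g.
suff H k : (k <= r)%N -> L (f k).
  have := H r (leqnn r).
  by rewrite (_ : f r = h)//; apply/funext => j; rewrite /f ltn_ord.
elim: k => [|k IH] kr.
  by rewrite (_ : f 0%N = 1%g :> GS R r)//; exact: csub1.
pose ik := Ordinal kr.
have -> : f k.+1 = (f k * at_place ik (h ik))%g.
  apply/funext => j; rewrite [RHS]/(GS_mul _ _ _) /GS_mul /at_place /f ltnS.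
  case: (ltngtP j k) => [jk|jk|jk].
  - by rewrite -val_eqE /= ltn_eqF// mulg1.
  - by rewrite -val_eqE /= gtn_eqF// mulg1.
  - by rewrite (_ : j = ik) ?eqxx ?mul1g//; apply: val_inj; rewrite /= jk.
by apply: (csubM cL) => //; apply: IH; exact: ltnW.
Qed.

End Places.

Section Quotient.
Variables (R : realType) (K : fieldExtType rat) (r : nat).
Variable sigma : 'I_r -> {rmorphism K -> R[i]}.
Local Notation pi := (pi_Gamma sigma).
Implicit Types (L M : set (GS R r)) (g h : GS R r).

Lemma pi_Gamma_eq g h : Gamma sigma h -> pi (g * h)%g = pi g.
Proof. by move=> Gh; apply/esym/pi_GammaP; rewrite mulgA mulVg mul1g. Qed.

Lemma orbit_pi M g : orbit_Gamma M (pi g) = [set pi (m * g)%g | m in M].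
Proof.
by apply/seteqP; split=> y [m Mm <-]; exists m => //; rewrite act_Gamma_pi.
Qed.

Lemma pi_Gamma_open (U : set (GmodGamma sigma)) : open U <-> open (pi @^-1` U).
Proof. by []. Qed.

Lemma closed_preimage (Y : set (GmodGamma sigma)) : closed Y -> closed (pi @^-1` Y).
Proof.
move=> cY; rewrite -openC preimage_setC.
exact: (iffLR (pi_Gamma_open _) (closed_openC cY)).
Qed.

Lemma closure_pi (A : set (GmodGamma sigma)) g :
  (forall e : R, 0 < e -> exists2 h, box g e h & A (pi h)) -> closure A (pi g).
Proof.
move=> H B; rewrite nbhsE => -[U [oU Ug] sU].
have /nbhs_boxP[e e0 se] : nbhs g (pi @^-1` U) by apply: open_nbhs_nbhs.
have [h gh Ah] := H e e0; exists (pi h); split=> //.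
by apply: sU; exact: se.
Qed.

Lemma box_mulr g h (e : R) : 0 < e ->
  exists2 d : R, 0 < d & forall g', box g d g' -> box (g * h)%g e (g' * h)%g.
Proof.
move=> e0.
pose M := 1 + \sum_i \sum_a \sum_b normc (h i a b).
have sum_ge (I : finType) (F : I -> R) k : (forall i, 0 <= F i) -> F k <= \sum_i F i.
  by move=> F0; rewrite (bigD1 k)//= lerDl sumr_ge0.
have n0 i a b : 0 <= normc (h i a b) by exact: normc_ge0.
have n1 i a : 0 <= \sum_b normc (h i a b) by exact: sumr_ge0.
have n2 i : 0 <= \sum_a \sum_b normc (h i a b) by exact: sumr_ge0.
have leM i a b : normc (h i a b) <= M.
  apply: le_trans (sum_ge _ (fun b => normc (h i a b)) b (n0 i a)) _.
  apply: le_trans (sum_ge _ (fun a => \sum_b normc (h i a b)) a (n1 i)) _.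
  apply: le_trans (sum_ge _ (fun i => \sum_a \sum_b normc (h i a b)) i n2) _.
  by rewrite /M lerDr.
have M0 : 0 < M by rewrite ltr_wpDr// sumr_ge0.
exists (e / (2 * M)); first by rewrite divr_gt0// mulr_gt0.
move=> g' gg' i a b.
rewrite (_ : (g * h)%g i = (g i * h i)%g)// (_ : (g' * h)%g i = (g' i * h i)%g)//.
rewrite !SL2_mulE opprD addrACA -!mulrBl.
apply: le_lt_trans (normcD _ _) _; rewrite !normcM.
have /(_ 0) H0 := gg' i a; have H1 := gg' i a 1.
have bd c : normc (g' i a c - g i a c) * normc (h i c b) < e / 2.
  apply: le_lt_trans (ler_wpM2l (normc_ge0 _) (leM i c b)) _.
  have -> : e / 2 = e / (2 * M) * M by field; rewrite gt_eqF.
  by rewrite ltr_pM2r.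
by rewrite [e]splitr ltrD.
Qed.

(** The image of an open set under pi is open, the lattice acting by
    homeomorphisms on the right; so a dense set of cosets can be met by
    representatives in any box. *)
Lemma dense_pi (A : set (GmodGamma sigma)) g (e : R) : dense A -> 0 < e ->
  exists2 h, box g e h & A (pi h).
Proof.
move=> dA e0.
pose O : set (GmodGamma sigma) := pi @` (box g e)°.
have gO : O (pi g) by exists g => //; exact: nbhs_box.
have oO : open O.
  apply: (iffRL (pi_Gamma_open _)); rewrite openE => h [h' ih' /pi_GammaP G].
  have /nbhs_boxP[d d0 sd] : nbhs h' (box g e)° by exact: nbhs_interior.
  have hE : h' = (h * (h'^-1 * h)^-1)%g by rewrite invgM invgK mulgA mulgV mul1g.
  rewrite hE in sd.
  have [d' d'0 sd'] := box_mulr h (h'^-1 * h)^-1%g d0.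
  apply/nbhs_boxP; exists d' => // k hk; exists (k * (h'^-1 * h)^-1)%g.
    by apply: sd; exact: sd'.
  by apply: pi_Gamma_eq; exact: GammaV.
have [_ [[h ih <-] Ah]] := dA O (ex_intro _ _ gO) oO.
by exists h => //; exact: interior_subset ih.
Qed.

End Quotient.

(** * One-parameter subgroups *)

Section OneParameter.
Variables (R : realType) (r : nat).
Implicit Types (L : set (GS R r)) (i : 'I_r) (psi : R -> SL2 R[i]).

(** A one-parameter subgroup, with continuity expressed on the matrix entries. *)
Definition one_parameter psi :=
  (forall x y, psi (x + y) = (psi x * psi y)%g) /\
  forall (x e : R), 0 < e -> exists2 d : R, 0 < d &
    forall s : R, `|s - x| < d -> forall a b, normc (psi s a b - psi x a b) < e.

Lemma box_at_place i (g h : SL2 R[i]) (e : R) : 0 < e ->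
  (forall a b, normc (h a b - g a b) < e) -> box (at_place i g) e (at_place i h).
Proof.
move=> e0 H j a b; have [->|ji] := eqVneq j i; first by rewrite !at_place_eq.
by rewrite !at_place_neq// subrr normc0.
Qed.

(** The parameters whose value lies in the closed subgroup form a closed
    subgroup of the line, which contains the differences of the given set. *)
Lemma one_parameter_in L i psi (w : GS R r) :
    closed_subgroup L -> one_parameter psi ->
    ~ countable [set x | L (at_place i (psi x) * w)%g] ->
  forall x, L (at_place i (psi x)).
Proof.
move=> cL [psiD psi_cont] uF.
have psi0 : psi 0 = 1%g by apply: (mulgI (psi 0)); rewrite mulg1 -psiD addr0.
have psiN x : psi (- x) = ((psi x)^-1)%g.
  by apply: (mulgI (psi x)); rewrite mulgV -psiD subrr.
have psiB x y : at_place i (psi (x - y)) = (at_place i (psi x) * (at_place i (psi y))^-1)%g.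
  by rewrite psiD psiN at_placeM at_placeV.
apply: uncountable_closed_subgroup.
- by move=> x y Lx Ly; rewrite psiB; apply: csubM => //; exact: csubV.
- move=> x H; apply: closed_boxP; first by case: cL.
  move=> e e0; have [d d0 dP] := psi_cont x e e0.
  have [s Ls sx] := H d d0; exists (at_place i (psi s)) => //.
  by apply: box_at_place => //; exact: dP.
- move=> cS; apply: uF.
  have [[x0 Fx0]|F0] := pselect (exists x, L (at_place i (psi x) * w)%g); last first.
    by rewrite (_ : mkset _ = set0)//; apply/seteqP; split=> // x Fx; apply: F0; exists x.
  apply: (@subset_countable _ _ [set s + x0 | s in [set s | L (at_place i (psi s))]]).
    move=> x Fx; exists (x - x0); rewrite ?subrK//=.
    rewrite psiB; have := csubM cL Fx (csubV cL Fx0).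
    by rewrite invgM !mulgA mulgK.
  exact: (sub_countable (card_image_le _ _) cS).
Qed.

Lemma SL2_bound (P : SL2 R[i]) : exists2 M : R, 0 < M & forall a b, normc (P a b) <= M.
Proof.
pose M := 1 + \sum_a \sum_b normc (P a b).
have n0 a b : 0 <= normc (P a b) by exact: normc_ge0.
have n1 a : 0 <= \sum_b normc (P a b) by exact: sumr_ge0.
have sum_ge (F : 'I_2 -> R) (k : 'I_2) : (forall c, 0 <= F c) -> F k <= \sum_c F c.
  by move=> F0; rewrite (bigD1 k)//= lerDl sumr_ge0.
exists M; first by rewrite ltr_wpDr// sumr_ge0.
move=> a b; apply: le_trans (sum_ge (fun b => normc (P a b)) b (n0 a)) _.
apply: le_trans (sum_ge (fun a => \sum_b normc (P a b)) a n1) _.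
by rewrite /M lerDr.
Qed.

Lemma one_parameter_conj psi (P : SL2 R[i]) :
  one_parameter psi -> one_parameter (fun x => P * psi x * P^-1)%g.
Proof.
move=> [psiD psi_cont]; split=> [x y|x e e0].
  by rewrite psiD !mulgA mulgVK.
have [M M0 leM] := SL2_bound P.
have leMV a b : normc ((P^-1)%g a b) <= M.
  by case: (ord2P a) => ->; case: (ord2P b) => ->; rewrite SL2_invE ?normcNE.
have [d d0 dP] := psi_cont x (e / (4 * M * M)) (divr_gt0 e0 (mulr_gt0 (mulr_gt0 (ltr0n _ 4) M0) M0)).
exists d => // s /dP H a b.
rewrite !SL2_mulE.
set Q := (P^-1)%g in leMV *.
have -> : (P a 0 * psi s 0 0 + P a 1 * psi s 1 0) * Q 0 b +
    (P a 0 * psi s 0 1 + P a 1 * psi s 1 1) * Q 1 b -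
    ((P a 0 * psi x 0 0 + P a 1 * psi x 1 0) * Q 0 b +
     (P a 0 * psi x 0 1 + P a 1 * psi x 1 1) * Q 1 b) =
  (P a 0 * (psi s 0 0 - psi x 0 0) * Q 0 b + P a 1 * (psi s 1 0 - psi x 1 0) * Q 0 b) +
  (P a 0 * (psi s 0 1 - psi x 0 1) * Q 1 b + P a 1 * (psi s 1 1 - psi x 1 1) * Q 1 b) by ring.
have bd c c' : normc (P a c * (psi s c c' - psi x c c') * Q c' b) < e / 4.
  rewrite !normcM; have h1 := leM a c; have h2 := leMV c' b.
  apply: (@le_lt_trans _ _ (M * normc (psi s c c' - psi x c c') * M)).
    apply: ler_pM => //; rewrite ?mulr_ge0 ?normc_ge0//.
    by rewrite ler_wpM2r ?normc_ge0.
  have -> : e / 4 = M * (e / (4 * M * M)) * M by field; rewrite gt_eqF.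
  by rewrite ltr_pM2r// ltr_pM2l.
have := bd 0 0; have := bd 0 1; have := bd 1 0; have := bd 1 1.
move=> b11 b10 b01 b00.
apply: le_lt_trans (normcD _ _) _.
apply: le_lt_trans (lerD (normcD _ _) (normcD _ _)) _.
by lra.
Qed.

Lemma diag2_dist (p q : R[i]) (e : R) : p \is a GRing.unit -> q \is a GRing.unit ->
    normc (p - q) < e -> normc (p^-1 - q^-1) < e ->
  forall a b, normc (diag2 p a b - diag2 q a b) < e.
Proof.
move=> pu qu pq pqV a b.
have e0 : normc (0 - 0 : R[i]) < e.
  by rewrite subr0 normc0; apply: le_lt_trans pq; exact: normc_ge0.
have H (x y z t : R[i]) : normc (z - t) < e -> x = z -> y = t -> normc (x - y) < e.
  by move=> zt -> ->.
have [[[p00 p01] p10] p11] := diag2E pu; have [[[q00 q01] q10] q11] := diag2E qu.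
case: (ord2P a) => ->; case: (ord2P b) => ->.
- exact: H pq p00 q00.
- exact: H e0 p01 q01.
- exact: H e0 p10 q10.
- exact: H pqV p11 q11.
Qed.

Lemma one_parameter_diag : one_parameter (fun x => diag2 (expR x)%:RC).
Proof.
have eu (x : R) : (expR x)%:RC \is a GRing.unit.
  by rewrite unitfE -normc_gt0 normc_RtoC normr_gt0 gt_eqF// expR_gt0.
have eV (x : R) : ((expR x)%:RC)^-1 = (expR (- x))%:RC.
  by rewrite expRN (fmorphV (@RtoC R)).
split=> [x y|x e e0].
  by rewrite expRD (rmorphM (@RtoC R)) diag2M//; exact: eu.
have ec (y : R) : exists2 d : R, 0 < d & forall s, `|s - y| < d -> `|expR s - expR y| < e.
  have /cvgrPdist_lt/(_ e e0)/nbhs_ballP[d d0 dP] := @continuous_expR R y.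
  by exists d => // s sy; rewrite distrC; apply: dP; rewrite -ball_normE /= distrC.
have [d1 d10 d1P] := ec x; have [d2 d20 d2P] := ec (- x).
exists (Num.min d1 d2); first by rewrite lt_min d10.
move=> s; rewrite lt_min => /andP[s1 s2] a b.
apply: diag2_dist => //; rewrite ?eV -(rmorphB (@RtoC R)) normc_RtoC.
  exact: d1P.
by apply: d2P; rewrite opprK addrC distrC.
Qed.

(** What the groups of upper and of lower unipotent matrices have in common. *)
Definition elementary (phi : R[i] -> SL2 R[i]) :=
  (forall x y, phi (x + y) = (phi x * phi y)%g) /\
  forall x y a b, normc (phi x a b - phi y a b) <= normc (x - y).

Lemma elementary_upper : elementary (@upper R[i]).
Proof.
split=> [|x y a b]; first exact: upperD.
by case: (ord2P a) => ->; case: (ord2P b) => ->; rewrite !upperE ?subrr ?normc0 ?normc_ge0.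
Qed.

Lemma elementary_lower : elementary (@lower R[i]).
Proof.
split=> [|x y a b]; first exact: lowerD.
by case: (ord2P a) => ->; case: (ord2P b) => ->; rewrite !lowerE ?subrr ?normc0 ?normc_ge0.
Qed.

Lemma one_parameter_line phi (z : R[i]) :
  elementary phi -> one_parameter (fun x => phi (x%:RC * z)).
Proof.
move=> [phiD phi_lip]; split=> [x y|x e e0].
  by rewrite (rmorphD (@RtoC R)) mulrDl phiD.
have z1 : 0 < normc z + 1 by rewrite ltr_wpDl// normc_ge0.
exists (e / (normc z + 1)); first by rewrite divr_gt0.
move=> s sx a b; apply: le_lt_trans (phi_lip _ _ _ _) _.
rewrite -mulrBl -(rmorphB (@RtoC R)) normcM normc_RtoC.
rewrite ltr_pdivlMr// in sx; apply: le_lt_trans sx.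
by rewrite ler_wpM2l// lerDl.
Qed.

End OneParameter.

(** * Countability of the lattice *)

Section Countable.
Variables (R : realType) (K : fieldExtType rat) (r : nat).
Variable sigma : 'I_r -> {rmorphism K -> R[i]}.

Lemma countable_field : countable [set: K].
Proof.
pose c (x : K) : 'rV[rat]_(\dim {:K}) := \row_j coord (vbasis {:K}) j x.
have inj : injective c.
  move=> x y /rowP cxy; rewrite (coord_vbasis (memvf x)) (coord_vbasis (memvf y)).
  by apply: eq_bigr => j _; have := cxy j; rewrite !mxE => ->.
have := inj_card_eq (in2W inj : {in [set: K] &, _}).
rewrite card_eq_sym => /card_eqPle[+ _] => /sub_countable; apply.
exact: (@countableP _ _).
Qed.

Lemma countable_Gamma : countable (Gamma sigma).
Proof.
apply: (sub_countable (card_image_le _ _)).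
have inj : injective (fun A : SL2 K => (A 0 0, A 0 1, A 1 0, A 1 1)).
  by move=> A B [e1 e2 e3 e4]; exact: SL2_eq.
have := inj_card_eq (in2W inj : {in @SL2_OK K &, _}).
rewrite card_eq_sym => /card_eqPle[+ _] => /sub_countable; apply.
have cK := countable_field.
have c4 : countable ([set: K] `*` [set: K] `*` [set: K] `*` [set: K]).
  by do 3!apply: countableX => //.
exact: subset_countable c4.
Qed.

End Countable.

(** * Spreading from one place to all *)

Section SpreadingOut.
Variables (R : realType) (K : fieldExtType rat) (r : nat).
Variable sigma : 'I_r -> {rmorphism K -> R[i]}.
Variable i0 : 'I_r.
Local Notation pi := (pi_Gamma sigma).
Local Notation integral x := (integralOver (intr : int -> K) x).

Hypothesis integers_dense : forall (v : 'I_r -> R[i]) (e : R), 0 < e ->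
  exists2 y : K, integral y & forall i, i != i0 -> normc (sigma i y - v i) < e.

Lemma SL2_OK_elementary (y : K) : integral y ->
  @SL2_OK K (upper y) /\ @SL2_OK K (lower y).
Proof.
move=> iy; have i1 : integral 1 by exact: integral1.
have i00 : integral 0 by exact: mxpoly.integral0.
by split=> a b; case: (ord2P a) => ->; case: (ord2P b) => ->;
  rewrite ?upperE ?lowerE.
Qed.

Lemma SL2_map_upper (A B : comUnitRingType) (f : {rmorphism A -> B}) (y : A) :
  SL2_map f (upper y) = upper (f y).
Proof. by apply: SL2_eq; rewrite mxE !upperE ?rmorph0 ?rmorph1. Qed.

Lemma SL2_map_lower (A B : comUnitRingType) (f : {rmorphism A -> B}) (y : A) :
  SL2_map f (lower y) = lower (f y).
Proof. by apply: SL2_eq; rewrite mxE !lowerE ?rmorph0 ?rmorph1. Qed.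

(** Strong approximation: modulo the lattice, an elementary matrix at any place
    is a limit of elements supported at the given one; and a closed orbit of L
    meets a one-parameter subgroup in countably many cosets of its trace on L. *)
Lemma spread_elementary (L : set (GS R r)) (h : GS R r)
    (phi : R[i] -> SL2 R[i]) (phiK : K -> SL2 K) :
    closed_subgroup L -> closed (orbit_Gamma L (pi h)) ->
    (forall g, L (at_place i0 g)) ->
    orbit_Gamma L (pi h) (pi 1%g) ->
    elementary phi -> (forall y, integral y -> SL2_OK (phiK y)) ->
    (forall i y, SL2_map (sigma i) (phiK y) = phi (sigma i y)) ->
  forall i z, L (at_place i (phi z)).
Proof.
move=> cL cY L0 Y1 el phiOK phiE i z.
have LG l g : L l -> Gamma sigma g -> orbit_Gamma L (pi h) (pi (l * g)%g).
  move=> Ll Gg; move: Y1; rewrite orbit_pi => -[m Lm mh].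
  exists (l * m)%g; first exact: csubM.
  rewrite (pi_Gamma_eq _ Gg); apply/pi_GammaP.
  have -> : (((l * m) * h)^-1 * l = (m * h)^-1 * 1)%g.
    by rewrite !invgM -!mulgA mulVg.
  exact/pi_GammaP.
have Yphi w : orbit_Gamma L (pi h) (pi (at_place i (phi w))).
  apply: (closed_boxP (closed_preimage cY)) => e e0.
  pose v j := if j == i then w else 0.
  have [y iy yv] := integers_dense v e0.
  exists (at_place i0 (phi (v i0 - sigma i0 y)) * diagonal_embedding sigma (phiK y))%g.
    move=> j a b; rewrite [X in normc (X - _)](_ : _ =
       (at_place i0 (phi (v i0 - sigma i0 y)) j * SL2_map (sigma j) (phiK y))%g a b)//.
    rewrite phiE; have [phiD phi_lip] := el.
    have -> : at_place i (phi w) j = phi (v j).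
      rewrite /v /at_place; case: eqP => // _.
      by apply: (mulgI (phi 0)); rewrite -phiD addr0 mulg1.
    have [->|ji0] := eqVneq j i0.
      by rewrite at_place_eq -phiD subrK subrr normc0.
    rewrite at_place_neq// mul1g; apply: le_lt_trans (phi_lip _ _ _ _) _.
    exact: yv.
  apply: LG; first exact: L0.
  by exists (phiK y) => //; exact: phiOK.
have := one_parameter_line z el.
set psi := (fun x => _) => psi1.
have cover : [set: R] `<=` \bigcup_(g in Gamma sigma)
    [set x | L (at_place i (psi x) * (g * h^-1))%g].
  move=> x _; have := Yphi (x%:RC * z); rewrite orbit_pi => -[l Ll lh].
  exists ((at_place i (psi x))^-1 * (l * h))%g; first exact/pi_GammaP.
  by rewrite /= !mulgA mulgV mul1g mulgK.
have [g Gg ug] := uncountable_piece (countable_Gamma sigma) cover (@uncountable_real R).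
rewrite setTI in ug.
have := one_parameter_in cL psi1 ug 1.
by rewrite /psi rmorph1 mul1r.
Qed.

(** Elementary matrices generate, so it suffices to have them at every place. *)
Lemma spread_everywhere (L : set (GS R r)) (h : GS R r) :
    closed_subgroup L -> closed (orbit_Gamma L (pi h)) ->
    (forall g, L (at_place i0 g)) ->
    orbit_Gamma L (pi h) (pi 1%g) -> L = setT.
Proof.
move=> cL cY L0 Y1; apply: csub_generated => // i x.
- apply: (spread_elementary cL cY L0 Y1 (@elementary_upper R) (phiK := @upper K)).
    by move=> y /SL2_OK_elementary[].
  by move=> j y; exact: SL2_map_upper.
- apply: (spread_elementary cL cY L0 Y1 (@elementary_lower R) (phiK := @lower K)).
    by move=> y /SL2_OK_elementary[].
  by move=> j y; exact: SL2_map_lower.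
Qed.

End SpreadingOut.

(** * The orbit closure is not covered *)

Section NotCovered.
Variables (R : realType) (K : fieldExtType rat) (r : nat).
Variable sigma : 'I_r -> {rmorphism K -> R[i]}.
Variables (i0 i1 : 'I_r).
Hypothesis i10 : i1 != i0.
Local Notation pi := (pi_Gamma sigma).
Local Notation integral x := (integralOver (intr : int -> K) x).

Hypothesis integers_dense : forall (v : 'I_r -> R[i]) (e : R), 0 < e ->
  exists2 y : K, integral y & forall i, i != i0 -> normc (sigma i y - v i) < e.
Hypothesis units_dense : forall (x e : R), 0 < x -> 0 < e ->
  exists u : K, [/\ integral u, integral u^-1, u != 0,
    forall i, sigma i u \is Num.real & exists2 y : R, sigma i0 u = y%:RC & `|y - x| < e].

Variables (a : R) (b : R[i]).
Hypothesis a0 : a != 0.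
Hypothesis b_nonreal : complex.Im b != 0.
Let X : SL2 R[i] := (lower b * upper a%:RC)%g.
Let d (x : R) : SL2 R[i] := diag2 (expR x)%:RC.
Let z (x v : R) : GS R r := at_place i0 (d x * X * d v)%g.

Let expu (x : R) : (expR x)%:RC \is a GRing.unit.
Proof. by rewrite unitfE -normc_gt0 normc_RtoC normr_gt0 gt_eqF// expR_gt0. Qed.

Let d_entries x : [/\ d x 0 0 = (expR x)%:RC, d x 0 1 = 0, d x 1 0 = 0 &
  d x 1 1 = (expR (- x))%:RC].
Proof.
have [[[h1 h2] h3] h4] := diag2E (expu x); split=> //.
by rewrite expRN (fmorphV (@RtoC R)).
Qed.

Lemma mulr_dist (P g h : SL2 R[i]) (M e : R) : 0 < M ->
    (forall k l, normc (P k l) <= M) ->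
    (forall k l, normc (g k l - h k l) < e / (2 * M)) ->
  forall k l, normc ((P * g)%g k l - (P * h)%g k l) < e.
Proof.
move=> M0 PM gh k l; rewrite !SL2_mulE opprD addrACA -!mulrBr.
have bd c : normc (P k c * (g c l - h c l)) < e / 2.
  rewrite normcM; apply: le_lt_trans (ler_wpM2r (normc_ge0 _) (PM k c)) _.
  have -> : e / 2 = M * (e / (2 * M)) by field; rewrite gt_eqF.
  by rewrite ltr_pM2l.
by apply: le_lt_trans (normcD _ _) _; rewrite [e]splitr ltrD// bd.
Qed.

(** Comparing the upper rows of T Y A and D1 Y D2: a diagonal matrix on the right
    is determined up to sign by the two entries of the upper row of Y. *)
Lemma diag_conj_ratio (T Y A D1 D2 : SL2 R[i]) (s c p p' y y' : R[i]) :
    T 0 1 = 0 -> Y 0 0 = 1 -> Y 0 1 = c ->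
    [/\ A 0 0 = y, A 0 1 = 0, A 1 0 = 0 & A 1 1 = y'] ->
    D1 0 0 = s -> D1 0 1 = 0 ->
    [/\ D2 0 0 = p, D2 0 1 = 0, D2 1 0 = 0 & D2 1 1 = p'] ->
    s != 0 -> c != 0 -> p * p' = 1 -> y * y' = 1 ->
    (T * Y * A = D1 * Y * D2)%g -> p = y \/ p = - y.
Proof.
move=> T01 Y00 Y01 [A00 A01 A10 A11] D100 D101 [D200 D201 D210 D211] s0 c0 pp' yy' E.
have := congr1 (fun g : SL2 R[i] => g 0 1) E; rewrite !SL2_mulE T01 A01 D101 D201.
have := congr1 (fun g : SL2 R[i] => g 0 0) E; rewrite !SL2_mulE T01 A10 D101 D210.
rewrite A00 A11 D100 D200 D211 Y00 Y01 !mulr0 !mul0r !add0r !addr0 !mulr1.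
move: (T 0 0) => t e1 e2.
have e3 : t * y' = s * p'.
  by apply: (mulfI c0); rewrite mulrA [c * t]mulrC e2; ring.
have e4 : s * (p * y') = s * (y * p').
  by rewrite mulrA -e1 [in RHS]mulrCA -e3; ring.
have /eqP : (p - y) * (p + y) = 0.
  have e5 := mulfI s0 e4.
  have -> : (p - y) * (p + y) = p * p * (y * y') - y * y * (p * p').
    by rewrite pp' yy'; ring.
  have -> : p * p * (y * y') - y * y * (p * p') = p * y * (p * y' - y * p') by ring.
  by rewrite e5 subrr mulr0.
by rewrite mulf_eq0 subr_eq0 addr_eq0 => /orP[] /eqP ->; [left|right].
Qed.

Lemma diag2_is_diag (A : comUnitRingType) (p : A) : p \is a GRing.unit ->
  is_diag_mx (diag2 p).
Proof.
move=> pu; apply/is_diag_mxP => i j; have [[[h1 h2] h3] h4] := diag2E pu.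
by case: (ord2P i) => ->; case: (ord2P j) => ->.
Qed.

(** Units moved to the other side of the quotient act, at all other places, by
    elements of the real torus; as their values at the given place are dense,
    arbitrary positive diagonal matrices may be inserted on the right of X. *)
Lemma z_in_closure x v :
  closure (orbit_Gamma (@real_torus R r) (pi (at_place i0 X))) (pi (z x v)).
Proof.
apply: closure_pi => e e0.
have [_ psi_cont] := @one_parameter_diag R.
have [M M0 XM] := SL2_bound (d x * X)%g.
have [dl dl0 dlP] := psi_cont v (e / (2 * M)) (divr_gt0 e0 (mulr_gt0 (ltr0n _ 2) M0)).
have [dl' dl'0 dl'P] : exists2 dl' : R, 0 < dl' &
    forall y, `|y - expR v| < dl' -> 0 < y /\ `|ln y - v| < dl.
  have ev0 := expR_gt0 v.
  have /cvgrPdist_lt/(_ dl dl0)/nbhs_ballP[d1 d10 d1P] := continuous_ln ev0.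
  exists (Num.min d1 (expR v)); first by rewrite lt_min d10.
  move=> y; rewrite lt_min => /andP[y1 y2]; split.
    by move: y2; rewrite ltr_norml => /andP[+ _]; rewrite ltrBDr addrC subrr.
  rewrite distrC -[v in v - _]expRK; apply: d1P.
  by rewrite -ball_normE /= distrC.
have [u [iu iuV u0 ur [y uy yv]]] := units_dense (expR_gt0 v) dl'0.
have [y0 lny] := dl'P y yv.
have uU : u \is a GRing.unit by rewrite unitfE.
have suU i : sigma i u \is a GRing.unit by rewrite rmorph_unit.
have suV i : (sigma i u)^-1 \is a GRing.unit by rewrite unitrV.
have Gu : Gamma sigma (diagonal_embedding sigma (diag2 u)).
  exists (diag2 u) => //; move=> i j; have [[[h1 h2] h3] h4] := diag2E uU.
  case: (ord2P i) => ->; case: (ord2P j) => ->; rewrite ?h1 ?h2 ?h3 ?h4//;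
    exact: mxpoly.integral0.
have mapd i : SL2_map (sigma i) (diag2 u) = diag2 (sigma i u).
  have [[[h1 h2] h3] h4] := diag2E uU; have [[[k1 k2] k3] k4] := diag2E (suU i).
  by apply: SL2_eq; rewrite mxE ?h1 ?h2 ?h3 ?h4 ?k1 ?k2 ?k3 ?k4 ?rmorph0 ?fmorphV.
pose t : GS R r := fun i => if i == i0 then d x else diag2 (sigma i u)^-1.
have tT : real_torus t.
  split=> [i|i k l]; rewrite /t; case: eqP => _.
  - by apply: diag2_is_diag; exact: expu.
  - exact: diag2_is_diag.
  - have [h1 h2 h3 h4] := d_entries x.
    by case: (ord2P k) => ->; case: (ord2P l) => ->; rewrite ?h1 ?h2 ?h3 ?h4 ?rpred0//;
      apply/complex_realP; eexists.
  - have [[[h1 h2] h3] h4] := diag2E (suV i).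
    by case: (ord2P k) => ->; case: (ord2P l) => ->;
      rewrite ?h1 ?h2 ?h3 ?h4 ?rpred0 ?invrK ?rpredV.
exists (t * at_place i0 X * diagonal_embedding sigma (diag2 u))%g; last first.
  by rewrite pi_Gamma_eq// orbit_pi; exists t.
move=> i k l.
rewrite [X in normc (X - _)](_ : _ = ((t i * at_place i0 X i) * SL2_map (sigma i) (diag2 u))%g k l)//.
rewrite mapd /t /z; have [->|ii0] := eqVneq i i0; last first.
  by rewrite !at_place_neq// mulg1 diag2V// mulVg subrr normc0.
rewrite !at_place_eq.
have -> : diag2 (sigma i0 u) = d (ln y) by rewrite uy /d lnK.
by apply: (mulr_dist M0 XM); exact: dlP.
Qed.

(** At a second place the lattice element must be diagonal, and a diagonal
    lattice element only moves v by the logarithm of a number of the field. *)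
Lemma z_in_torus_orbit x v :
    orbit_Gamma (@torus R r) (pi (at_place i0 X)) (pi (z x v)) ->
  exists y : K, (expR v)%:RC = sigma i0 y \/ (expR v)%:RC = - sigma i0 y.
Proof.
rewrite orbit_pi => -[t tT /pi_GammaP[A AOK /(congr1 (fun g => (t * at_place i0 X) * g)%g)]].
rewrite !mulgA mulgV mul1g => E.
have E1 : (t i1 * SL2_map (sigma i1) A)%g = 1%g.
  have := congr1 (fun g : GS R r => g i1) E.
  rewrite [LHS](_ : _ = (t i1 * at_place i0 X i1 * SL2_map (sigma i1) A)%g)//.
  by rewrite /z !at_place_neq// mulg1.
have E0 : (t i0 * X * SL2_map (sigma i0) A)%g = (d x * X * d v)%g.
  have := congr1 (fun g : GS R r => g i0) E.
  rewrite [LHS](_ : _ = (t i0 * at_place i0 X i0 * SL2_map (sigma i0) A)%g)//.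
  by rewrite /z !at_place_eq.
have off i : t i 0 1 = 0 /\ t i 1 0 = 0.
  by have /is_diag_mxP H := tT i; split; apply: H.
have nz i : t i 0 0 != 0 /\ t i 1 1 != 0.
  have := SL2_det2 (t i); rewrite (off i).1 mul0r subr0 => D.
  by split; apply/eqP => H; move/eqP: D; rewrite H ?(mul0r, mulr0) eq_sym oner_eq0.
have A01 : A 0 1 = 0.
  have := congr1 (fun g : SL2 R[i] => g 0 1) E1.
  rewrite SL2_mulE (off i1).1 mul0r addr0 SL2_oneE mxE => /eqP.
  by rewrite mulf_eq0 (negPf (nz i1).1) fmorph_eq0 => /eqP.
have A10 : A 1 0 = 0.
  have := congr1 (fun g : SL2 R[i] => g 1 0) E1.
  rewrite SL2_mulE (off i1).2 mul0r add0r SL2_oneE mxE => /eqP.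
  by rewrite mulf_eq0 (negPf (nz i1).2) fmorph_eq0 => /eqP.
have AD : A 0 0 * A 1 1 = 1 by have := SL2_det2 A; rewrite A01 mul0r subr0.
have [h1 h2 h3 h4] := d_entries x; have [k1 k2 k3 k4] := d_entries v.
have X00 : X 0 0 = 1 by rewrite SL2_mulE !lowerE !upperE; ring.
have X01 : X 0 1 = a%:RC by rewrite SL2_mulE !lowerE !upperE; ring.
have m01 : SL2_map (sigma i0) A 0 1 = 0 by rewrite mxE A01 rmorph0.
have m10 : SL2_map (sigma i0) A 1 0 = 0 by rewrite mxE A10 rmorph0.
have m00 : SL2_map (sigma i0) A 0 0 = sigma i0 (A 0 0) by rewrite mxE.
have m11 : SL2_map (sigma i0) A 1 1 = sigma i0 (A 1 1) by rewrite mxE.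
have yy' : sigma i0 (A 0 0) * sigma i0 (A 1 1) = 1 by rewrite -rmorphM AD rmorph1.
have vv : (expR v)%:RC * (expR (- v))%:RC = 1.
  by rewrite -(rmorphM (@RtoC R)) -expRD subrr expR0 rmorph1.
have xn : (expR x)%:RC != 0 by rewrite -normc_gt0 normc_RtoC normr_gt0 gt_eqF// expR_gt0.
have an : a%:RC != 0 by rewrite -normc_gt0 normc_RtoC normr_gt0.
exists (A 0 0).
exact: (diag_conj_ratio (off i0).1 X00 X01 (And4 m00 m01 m10 m11) h1 h2
  (And4 k1 k2 k3 k4) xn an vv yy' E0).
Qed.

Lemma z_mul x v (w : GS R r) :
  (z x v * w = at_place i0 (d x) * (at_place i0 (X * d v)%g * w))%g.
Proof. by rewrite [RHS]mulgA -at_placeM [in RHS]mulgA. Qed.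

Lemma closed_proper_orbitP (Y : set (GmodGamma sigma)) : closed_proper_orbit Y ->
  exists Lh : set (GS R r) * GS R r, [/\ closed_subgroup Lh.1, Lh.1 <> setT,
    Y = orbit_Gamma Lh.1 (pi Lh.2) & closed Y].
Proof. by move=> [L [y [h1 h2 h3 h4]]]; exists (L, repr_Gamma y); rewrite repr_GammaK. Qed.

(** Uncountably many parameters v give points off the orbit.  Two rounds of the
    pigeonhole principle, first in x and then in v, put the diagonal group at
    the given place and its conjugate by X in one of the subgroups. *)
Lemma not_covered (M : set (GS R r)) :
    @real_torus R r `<=` M -> M `<=` @torus R r ->
  let O := orbit_Gamma M (pi (at_place i0 X)) in
  ~ in_countable_union_of_closed_proper_orbits (closure O `\` O).
Proof.
move=> RM MT O [C [cC Cprop cover]].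
have clZ x v : closure O (pi (z x v)).
  have := @z_in_closure x v; apply: closureS.
  by move=> y [t tR <-]; exists t => //; exact: RM.
(* the exceptional v are logarithms of numbers coming from the countable field K *)
pose bad : set R := [set v | O (pi (z 0 v)) \/ exists x, O (pi (z x v))].
have cbad : countable bad.
  pose B1 := [set ln (complex.Re (sigma i0 y)) | y in [set: K]].
  pose B2 := [set ln (- complex.Re (sigma i0 y)) | y in [set: K]].
  have cB : countable (B1 `|` B2).
    by apply: countable_setU; apply: (sub_countable (card_image_le _ _));
      exact: countable_field.
  apply: subset_countable cB => v badv.
  have [x Ox] : exists x, O (pi (z x v)) by case: badv => // ?; exists 0.
  have OT : orbit_Gamma (@torus R r) (pi (at_place i0 X)) (pi (z x v)).
    by move: Ox => [t Mt tz]; exists t => //; exact: MT.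
  have [y [E|E]] := z_in_torus_orbit OT; [left|right]; exists y => //.
    by rewrite -E /= expRK.
  by rewrite -[sigma i0 y]opprK -E /= opprK expRK.
pose good := ~` bad.
have ugood : ~ countable good.
  move=> cg; apply: (@uncountable_real R).
  have : countable (good `|` bad) by exact: countable_setU.
  by apply: subset_countable => v _; case: (pselect (bad v)); [right|left].
have [LH LHP] : {LH : set (GmodGamma sigma) -> set (GS R r) * GS R r |
    forall Y, C Y -> [/\ closed_subgroup (LH Y).1, (LH Y).1 <> setT,
      Y = orbit_Gamma (LH Y).1 (pi (LH Y).2) & closed Y]}.
  have H Y : exists Lh : set (GS R r) * GS R r, C Y ->
      [/\ closed_subgroup Lh.1, Lh.1 <> setT, Y = orbit_Gamma Lh.1 (pi Lh.2) & closed Y].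
    have [CY|nCY] := pselect (C Y); last by exists (set0, 1%g).
    by have [Lh LhP] := closed_proper_orbitP (Cprop _ CY); exists Lh.
  by exists (fun Y => sval (cid (H Y))) => Y; exact: (svalP (cid (H Y))).
pose D := C `*` Gamma sigma.
have cD : countable D by apply: countableX => //; exact: countable_Gamma.
pose w (k : set (GmodGamma sigma) * GS R r) := (k.2 * (LH k.1).2^-1)%g.
have in_L x v : good v -> exists2 k, D k & (LH k.1).1 (z x v * w k)%g.
  move=> gv; have [Y CY Yz] : (\bigcup_(Y in C) Y) (pi (z x v)).
    by apply: cover; split=> // Oz; apply: gv; right; exists x.
  have [cL _ YE _] := LHP Y CY.
  move: Yz; rewrite YE orbit_pi => -[l Ll lz].
  exists (Y, ((z x v)^-1 * (l * (LH Y).2))%g).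
    by split=> //=; apply/pi_GammaP.
  by rewrite /w /= !mulgA mulgV mul1g mulgK.
pose A0 (L : set (GS R r)) := forall x, L (at_place i0 (d x)).
pose D' := D `&` [set k | A0 (LH k.1).1].
have cD' : countable D' by apply: subset_countable cD => k [].
have cover_v : good `<=` \bigcup_(k in D') [set v | (LH k.1).1 (at_place i0 (X * d v)%g * w k)%g].
  move=> v gv.
  have cover_x : [set: R] `<=` \bigcup_(k in D) [set x |
      (LH k.1).1 (at_place i0 (d x) * (at_place i0 (X * d v)%g * w k))%g].
    by move=> x _; have [k Dk Lk] := in_L x v gv; exists k => //=; rewrite -z_mul.
  have [k Dk uk] := uncountable_piece cD cover_x (@uncountable_real R).
  rewrite setTI in uk; have [cL _ _ _] := LHP _ Dk.1.
  have Ak := one_parameter_in cL (@one_parameter_diag R) uk.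
  exists k; first by split.
  have [[x0 /= Lx0]|F0] := pselect (exists x,
      (LH k.1).1 (at_place i0 (d x) * (at_place i0 (X * d v)%g * w k))%g).
    by have := csubM cL (csubV cL (Ak x0)) Lx0; rewrite mulgA mulVg mul1g.
  exfalso; apply: uk; rewrite (_ : mkset _ = set0)//.
  by apply/seteqP; split=> // x Fx; apply: F0; exists x.
have [k [Dk Ak] uk] := uncountable_piece cD' cover_v ugood.
have [cL LnT YE cY] := LHP _ Dk.1; set L := (LH k.1).1 in cL LnT YE Ak uk.
rewrite YE in cY.
have XA x : L (at_place i0 (X * d x * X^-1)%g).
  apply: (one_parameter_in cL (one_parameter_conj X (@one_parameter_diag R))
     (w := (at_place i0 X * w k)%g)).
  move=> cS; apply: uk; apply: subset_countable cS => v [_ /=].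
  have -> : (at_place i0 (X * d v * X^-1)%g * (at_place i0 X * w k) =
      at_place i0 (X * d v)%g * w k)%g by rewrite mulgA -at_placeM mulgVK.
  by [].
have L0 g : L (at_place i0 g).
  apply: (two_tori_generate (S := [set g | L (at_place i0 g)]) _ _ _ _ a0 b_nonreal).
  - by move=> g1 g2 /= L1 L2; rewrite at_placeM; exact: csubM.
  - by move=> g1 /= L1; rewrite at_placeV; exact: csubV.
  - move=> g1 H; apply: closed_boxP; first by case: cL.
    move=> e e0; have [g2 L2 g12] := H e e0; exists (at_place i0 g2) => //.
    exact: box_at_place.
  - by move=> s s0 /=; rewrite -(lnK s0); exact: Ak.
  - by move=> s s0 /=; rewrite -(lnK s0); exact: XA.
have Lw : L (w k).
  have [[v [_ /= Lv]]|F0] := pselect (exists v, (good `&`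
      [set v | L (at_place i0 (X * d v)%g * w k)%g]) v).
    by have := csubM cL (csubV cL (L0 (X * d v)%g)) Lv; rewrite mulgA mulVg mul1g.
  exfalso; apply: uk; rewrite (_ : _ `&` _ = set0)//.
  by apply/seteqP; split=> // x Fx; apply: F0; exists x.
apply: LnT; apply: (spread_everywhere integers_dense cL cY L0).
rewrite orbit_pi; exists (w k) => //.
by rewrite /w mulgVK -[k.2]mul1g pi_Gamma_eq//; exact: Dk.2.
Qed.

End NotCovered.

(** * An integral primitive element *)

Section PrimitiveElement.
Variable K : fieldExtType rat.
Definition ofrat : {rmorphism rat -> K} := GRing.in_alg K.
Local Notation evQ q x := ((map_poly ofrat q).[x]).
Local Notation evZ f x := ((map_poly (intr : int -> K) f).[x]).

Lemma ofrat_int (n : int) : ofrat n%:~R = n%:~R.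
Proof. exact: rmorph_int. Qed.

Lemma map_ofrat_int (f : {poly int}) :
  map_poly (ofrat) (map_poly intr f) = map_poly intr f.
Proof. rewrite -map_poly_comp; apply: eq_map_poly => n; exact: ofrat_int. Qed.

(** A generator of the field becomes an algebraic integer when multiplied by the
    leading coefficient of an integral equation that it satisfies. *)
Lemma integral_primitive_element : exists (th : K) (p : {poly int}),
  [/\ p \is monic, size p = (\dim {:K}).+1,
      separable_poly (map_poly intr p : {poly rat}) &
      (forall q : {poly rat}, evQ q th = 0 <-> map_poly intr p %| q) /\
      (forall x : K, exists q : {poly rat}, x = evQ q th)].
Proof.
have ch0 : [pchar K] =i pred0.
  by move=> q; rewrite (fmorph_pchar (ofrat)) Num.Theory.pchar_num.
have sep : separable 1%VS {:K} by apply/separableP => y _; exact: pcharf0_separable.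
have := eq_adjoin_separable_generator sep (subvf _).
set z := separable_generator _ _ => genz.
have [m mE] : exists m, minPoly 1 z = map_poly ofrat m by have /polyOver1P := minPolyOver 1%AS z.
have mon_m : m \is monic by rewrite -(map_monic (ofrat)) -mE monic_minPoly.
have deg (y : K) : fullv = <<1; y>>%VS -> size (minPoly 1 y) = (\dim {:K}).+1.
  move=> gy; rewrite size_minPoly; congr _.+1.
  by have := dim_Fadjoin 1%AS y; rewrite -gy dimv1 muln1 => ->.
have [q [a a0 mq]] := rat_poly_scale m.
set n := \dim {:K} in deg *.
have n0 : (0 < n)%N by rewrite adim_gt0.
have aQ0 : a%:~R != 0 :> rat by rewrite intr_eq0.
have aK0 : a%:~R != 0 :> K by rewrite -ofrat_int fmorph_eq0.
have size_m : size m = n.+1 by rewrite -(deg _ genz) mE size_map_poly.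
have size_q : size q = n.+1.
  by rewrite -size_m mq size_scale ?invr_eq0// size_map_inj_poly//; exact: intr_inj.
have qn : q`_n = a.
  have : m`_n = 1 by have /eqP := mon_m; rewrite lead_coefE size_m.
  rewrite mq coefZ coef_map /= => /(congr1 (fun t => a%:~R * t)).
  by rewrite mulVKf// mulr1 => /intr_inj.
have qz0 : evZ q z = 0.
  have : evQ m z = 0 by apply/eqP; have := root_minPoly 1%AS z; rewrite mE.
  rewrite mq map_polyZ map_ofrat_int hornerZ => /eqP.
  by rewrite mulf_eq0 fmorph_eq0 invr_eq0 (negPf aQ0) => /eqP.
pose th : K := a%:~R * z.
pose p : {poly int} := 'X^n + \poly_(i < n) (q`_i * a ^+ (n.-1 - i)).
have size_p : size p = n.+1.
  by rewrite size_polyDl size_polyXn// ltnS size_poly.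
have mon_p : p \is monic.
  by rewrite monicE /p lead_coefDl ?lead_coefXn// size_polyXn ltnS size_poly.
have pth : evZ p th = 0.
  rewrite rmorphD /= map_polyXn hornerD hornerXn.
  have -> : map_poly intr (\poly_(i < n) (q`_i * a ^+ (n.-1 - i))) =
     \poly_(i < n) (q`_i * a ^+ (n.-1 - i))%:~R :> {poly K}.
    by apply/polyP => i; rewrite coef_map !coef_poly /=; case: ifP.
  rewrite horner_poly.
  have E : evZ q z = \sum_(i < n) (q`_i)%:~R * z ^+ i + a%:~R * z ^+ n.
    rewrite (@horner_coef_wide _ n.+1); last first.
      by apply: leq_trans (size_poly _ _) _; rewrite size_q.
    by rewrite big_ord_recr /= coef_map qn; congr (_ + _); apply: eq_bigr => i _; rewrite coef_map.
  rewrite qz0 in E.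
  have -> : th ^+ n = a%:~R ^+ n.-1 * (a%:~R * z ^+ n).
    by rewrite mulrA -exprSr prednK// -exprMn.
  have -> : \sum_(i < n) (q`_i * a ^+ (n.-1 - i))%:~R * th ^+ i =
      a%:~R ^+ n.-1 * \sum_(i < n) (q`_i)%:~R * z ^+ i.
    rewrite mulr_sumr; apply: eq_bigr => i _; rewrite exprMn rmorphM rmorphXn /=.
    have -> : a%:~R ^+ n.-1 = a%:~R ^+ (n.-1 - i) * a%:~R ^+ i :> K.
      by rewrite -exprD subnK// -ltnS prednK.
    by rewrite [X in X * _]mulrC mulrACA.
  by rewrite -mulrDr addrC -E mulr0.
have genth : fullv = <<1; th>>%VS.
  apply/eqP; rewrite eqEsubv subvf andbT genz; apply/FadjoinP; split=> //=.
    exact: sub1v.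
  have -> : z = (a%:~R^-1 : rat) *: th.
    by rewrite -[_ *: th]mulr_algl -[_%:A]/(ofrat _) fmorphV ofrat_int mulKf.
  by rewrite memvZ// memv_adjoin.
have [m2 m2E] : exists m2, minPoly 1 th = map_poly ofrat m2 by have /polyOver1P := minPolyOver 1%AS th.
have mon_m2 : m2 \is monic by rewrite -(map_monic (ofrat)) -m2E monic_minPoly.
have pm2 : map_poly intr p = m2.
  have dvd : m2 %| map_poly intr p.
    rewrite -(dvdp_map (ofrat)) -m2E; apply: minPoly_dvdp.
      by apply/polyOver1P; eexists.
    by rewrite map_ofrat_int; apply/eqP.
  have mon_p' : map_poly intr p \is @monic rat.
    by rewrite monic_map.
  apply/eqP; rewrite -eqp_monic// eqp_sym -dvdp_size_eqp//.
  rewrite size_map_inj_poly//; last exact: intr_inj.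
  by rewrite size_p -(size_map_poly (ofrat)) -m2E deg.
exists th, p; split=> //.
  rewrite pm2 -(separable_map (ofrat)) -m2E.
  exact: pcharf0_separable.
split=> [g|x].
  rewrite pm2; split=> [g0|/(dvdp_mulr 1)].
    rewrite -(dvdp_map (ofrat)) -m2E; apply: minPoly_dvdp.
      by apply/polyOver1P; exists g.
    by apply/eqP.
  rewrite mulr1 -(dvdp_map (ofrat)) -m2E => /root_dvdp H.
  by apply/eqP; apply: H; exact: root_minPoly.
have /Fadjoin_polyP[g /polyOver1P[g' ->] ->] : x \in <<1; th>>%VS by rewrite -genth memvf.
by exists g'.
Qed.

Lemma clear_denominators (th x : K) : (exists q : {poly rat}, x = evQ q th) ->
  exists (f : {poly int}) (D : int), D != 0 /\ evZ f th = D%:~R * x.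
Proof.
move=> [q xq]; have [f [D D0 qf]] := rat_poly_scale q; exists f, D; split=> //.
rewrite xq qf map_polyZ map_ofrat_int hornerZ fmorphV ofrat_int mulVKf//.
by rewrite -ofrat_int fmorph_eq0 intr_eq0.
Qed.

End PrimitiveElement.

(** * Factorization over the complex numbers *)

Section Embeddings.
Variables (R : realType) (K : fieldExtType rat) (th : K) (p : {poly int}).
Local Notation evQ q x := ((map_poly (ofrat K) q).[x]).
Local Notation evC q x := ((map_poly (ratr : rat -> R[i]) q).[x]).
Hypothesis min_p : forall q : {poly rat}, evQ q th = 0 <-> map_poly intr p %| q.
Hypothesis gen_th : forall x : K, exists q : {poly rat}, x = evQ q th.

Lemma map_ratr_int (f : {poly int}) :
  map_poly (ratr : rat -> R[i]) (map_poly intr f) = map_poly intr f.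
Proof. by rewrite -map_poly_comp; apply: eq_map_poly => n; exact: ratr_int. Qed.

Lemma embedding_of_root (w : R[i]) : root (map_poly intr p) w ->
  exists tau : {rmorphism K -> R[i]}, tau th = w.
Proof.
move=> pw.
have ev0 q : evQ q th = 0 -> evC q w = 0.
  move=> /min_p pq; apply/eqP; move: pq.
  rewrite -(dvdp_map (ratr : {rmorphism rat -> R[i]})) /= map_ratr_int.
  by move=> /root_dvdp; apply.
have evE q q' : evQ q th = evQ q' th -> evC q w = evC q' w.
  move=> qq'; apply/eqP; rewrite -subr_eq0 -hornerN -hornerD -rmorphB.
  by apply/eqP/ev0; rewrite [map_poly _ _]raddfB hornerD hornerN qq' subrr.
pose f x := evC (sval (cid (gen_th x))) w.
have fE x q : x = evQ q th -> f x = evC q w.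
  by move=> xq; apply: evE; rewrite -xq -(svalP (cid (gen_th x))).
have fB : zmod_morphism f.
  move=> x y; have [q xq] := gen_th x; have [q' yq] := gen_th y.
  rewrite (fE x q)// (fE y q')// (fE _ (q - q')) ?rmorphB ?hornerD ?hornerN//.
  by rewrite xq yq.
have fM : monoid_morphism f.
  split=> [|x y].
    by rewrite (fE 1 1) ?rmorph1 ?hornerC.
  have [q xq] := gen_th x; have [q' yq] := gen_th y.
  rewrite (fE x q)// (fE y q')// (fE _ (q * q')) ?rmorphM ?hornerM//.
  by rewrite xq yq.
pose F : {rmorphism K -> R[i]} := HB.pack f (GRing.isZmodMorphism.Build _ _ f fB)
   (GRing.isMonoidMorphism.Build _ _ f fM).
exists F; rewrite [LHS](fE th 'X) ?map_polyX ?hornerX//.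
Qed.

Lemma embedding_evQ (tau : {rmorphism K -> R[i]}) (q : {poly rat}) :
  tau (evQ q th) = evC q (tau th).
Proof.
rewrite -horner_map -map_poly_comp; congr (_.[_]); apply: eq_map_poly => c.
exact: (fmorph_eq_rat (tau \o ofrat K : {rmorphism rat -> R[i]})).
Qed.

Lemma embedding_eq (tau tau' : {rmorphism K -> R[i]}) : tau th = tau' th -> tau =1 tau'.
Proof. by move=> e x; have [q ->] := gen_th x; rewrite !embedding_evQ e. Qed.

Lemma embedding_root (tau : {rmorphism K -> R[i]}) : root (map_poly intr p) (tau th).
Proof.
have /min_p p0 : map_poly intr p %| (map_poly intr p : {poly rat}) by [].
by rewrite /root -map_ratr_int -embedding_evQ p0 rmorph0.
Qed.

Variables (r : nat) (sigma : 'I_r -> {rmorphism K -> R[i]}).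
Hypothesis places : archimedean_places sigma.
Hypothesis complex_place : forall i, exists x, sigma i x != (sigma i x)^*.
Hypothesis mon_p : p \is monic.
Hypothesis sep_p : separable_poly (map_poly intr p : {poly rat}).

(** Both sides are separable with the same roots: a root is the image of th under
    some embedding, which is sigma i or its conjugate for exactly one i, and the
    two differ because no place is real. *)
Lemma min_poly_factors : map_poly intr p =
  \prod_i (('X - (sigma i th)%:P) * ('X - ((sigma i th)^*)%:P)) :> {poly R[i]}.
Proof.
have [rs prs] := closed_field_poly_normal (map_poly intr p : {poly R[i]}).
have /monicP lp : map_poly intr p \is @monic R[i] by rewrite monic_map.
rewrite lp scale1r in prs.
have u_rs : uniq rs.
  rewrite -separable_prod_XsubC -prs -map_ratr_int.
  by rewrite (separable_map (ratr : {rmorphism rat -> R[i]})).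
pose s1 := [seq sigma i th | i <- enum 'I_r].
pose s2 := [seq (sigma i th)^* | i <- enum 'I_r].
have same i j : same_place (sigma i) (sigma j) -> i = j.
  move=> ij; have [k [_ uk]] := places (sigma i).
  rewrite -(uk _ ij); symmetry; apply: uk; by left.
have conj_morph i : exists tau : {rmorphism K -> R[i]}, forall x, tau x = (sigma i x)^*.
  by exists (conjc \o sigma i : {rmorphism K -> R[i]}).
have u_s : uniq (s1 ++ s2).
  rewrite cat_uniq; apply/and3P; split.
  - by rewrite map_inj_uniq ?enum_uniq// => i j /embedding_eq ij; apply: same; left.
  - apply/hasPn => _ /mapP[j _ ->]; apply/negP => /mapP[i _ ij].
    have [tau tauE] := conj_morph j.
    have ji : forall x, (sigma j x)^* = sigma i x.
      by move=> x; rewrite -tauE; apply: embedding_eq; rewrite tauE.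
    have e : j = i by apply: same; right => x; rewrite -ji; exact: esym (conjcK _).
    by have [x /eqP] := complex_place i; apply; rewrite -{1}ji e.
  - rewrite map_inj_uniq ?enum_uniq// => i j /(can_inj (@conjcK R)) /embedding_eq ij.
    by apply: same; left.
have rsE : perm_eq rs (s1 ++ s2).
  apply: uniq_perm => // w; rewrite -root_prod_XsubC -prs mem_cat.
  apply/idP/orP => [/embedding_of_root[tau <-]|[/mapP[i _ ->]|/mapP[i _ ->]]].
  - have [i [[ti|ti] _]] := places tau; [left|right]; apply/mapP; exists i => //;
      by rewrite ?mem_enum.
  - exact: embedding_root.
  - by have [tau <-] := conj_morph i; exact: embedding_root.
have e (F : 'I_r -> {poly R[i]}) (G : 'I_r -> R[i]) : (forall i, F i = 'X - (G i)%:P) ->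
    \prod_(w <- [seq G i | i <- enum 'I_r]) ('X - w%:P) = \prod_i F i.
  by move=> FG; rewrite big_map big_enum; apply: eq_bigr => i _; rewrite FG.
by rewrite prs (perm_big _ rsE) big_cat (e _ _ (fun=> erefl)) (e _ _ (fun=> erefl)) big_split.
Qed.

End Embeddings.

(** * The norm as a determinant *)

Section DetHorner.

Lemma horner_char_poly (A : comNzRingType) n (M : 'M[A]_n) (c : A) :
  (char_poly M).[c] = \det (c%:M - M).
Proof.
rewrite /char_poly -[LHS]/(horner_eval c _) -det_map_mx; congr (\det _).
apply/matrixP => i j; rewrite !mxE rmorphB rmorphMn /=; congr (_ *+ _ - _); first exact: hornerX.
exact: hornerC.
Qed.

(** A resultant computation: both sides are multiplicative in f, which splits
    into linear factors. *)
Lemma det_horner_mx (C : closedFieldType) n (M : 'M[C]_n.+1) (rs : seq C) (f : {poly C}) :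
  char_poly M = \prod_(z <- rs) ('X - z%:P) ->
  \det (horner_mx M f) = \prod_(z <- rs) f.[z].
Proof.
move=> cM; have size_rs : size rs = n.+1.
  by have := size_char_poly M; rewrite cM size_prod_XsubC => -[].
have detX u : \det (horner_mx M ('X - u%:P)) = \prod_(z <- rs) (z - u).
  rewrite rmorphB /= horner_mx_X horner_mx_C -opprB -scaleN1r detZ.
  rewrite -horner_char_poly cM horner_prod -size_rs.
  elim: (rs) => [|z s IH] /=; first by rewrite expr0 !big_nil mulr1.
  by rewrite !big_cons -IH hornerXsubC exprS; ring.
have [us fus] := closed_field_poly_normal f; rewrite fus.
transitivity (lead_coef f ^+ n.+1 * \prod_(u <- us) \prod_(z <- rs) (z - u)).
  rewrite linearZ /= detZ; congr (_ * _).
  rewrite rmorph_prod /= (big_morph (@determinant C n.+1) (id1 := 1) (op1 := *%R)); last first.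
  - exact: det1.
  - by move=> X Y; exact: det_mulmx.
  by apply: eq_bigr => u _; exact: detX.
rewrite exchange_big /= -size_rs.
elim: (rs) => [|z s IH] /=; first by rewrite expr0 !big_nil mulr1.
rewrite !big_cons exprS -IH hornerZ horner_prod.
under [X in _ = _ * X * _]eq_bigr => u _ do rewrite hornerXsubC.
by ring.
Qed.

Lemma companion_ex (A : comNzRingType) (p : {poly A}) n : p \is monic -> size p = n.+2 ->
  exists M : 'M[A]_n.+1, char_poly M = p.
Proof.
move=> mp sp; have : exists M : 'M[A]_((size p).-1), char_poly M = p.
  by exists (companionmx p); exact: companionmxK.
by rewrite sp.
Qed.

End DetHorner.

Section Norm.
Variables (R : realType) (K : fieldExtType rat) (th : K) (p : {poly int}).
Local Notation evZ f x := ((map_poly (intr : int -> K) f).[x]).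
Variables (r : nat) (sigma : 'I_r -> {rmorphism K -> R[i]}).
Hypothesis r0 : (0 < r)%N.
Hypothesis mon_p : p \is monic.
Hypothesis p_factors : map_poly intr p =
  \prod_i (('X - (sigma i th)%:P) * ('X - ((sigma i th)^*)%:P)) :> {poly R[i]}.

Lemma sigma_evZ i f : sigma i (evZ f th) = (map_poly intr f).[sigma i th].
Proof.
rewrite -horner_map -map_poly_comp; congr (_.[_]); apply: eq_map_poly => n.
exact: rmorph_int.
Qed.

Lemma conj_evZ i f : (sigma i (evZ f th))^* = (map_poly intr f).[(sigma i th)^*].
Proof.
rewrite sigma_evZ -horner_map -map_poly_comp; congr (_.[_]); apply: eq_map_poly => n.
exact: (rmorph_int (@conjc R)).
Qed.

Lemma size_min_poly : size p = r.*2.+1.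
Proof.
have inj : injective (intr : int -> R[i]) by exact: intr_inj.
rewrite -(size_map_inj_poly inj (rmorph0 _)) p_factors big_split /=.
rewrite size_mul ?monic_neq0 ?monic_prod_XsubC//.
have e : size (index_enum 'I_r) = r by rewrite [index_enum _]unlock -enumT size_enum_ord.
by rewrite !size_prod_XsubC e addnS addSn /= addnn.
Qed.

Let norm_C (f : {poly R[i]}) :=
  \prod_i (f.[sigma i th] * f.[(sigma i th)^*]).

Lemma norm_matrix : exists n (M : 'M[int]_n.+1), forall f : {poly R[i]},
  \det (horner_mx (map_mx intr M) f) = norm_C f.
Proof.
have [r' rE] : exists r', r = r'.+1 by exists r.-1; rewrite prednK.
have sp := size_min_poly; rewrite rE doubleS in sp.
have [M cM] := companion_ex mon_p sp.
exists r'.*2.+1, M => f.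
pose s1 := [seq sigma i th | i <- enum 'I_r].
pose s2 := [seq (sigma i th)^* | i <- enum 'I_r].
have e (A : comNzRingType) (H : R[i] -> A) (G : 'I_r -> R[i]) :
    \prod_(w <- [seq G i | i <- enum 'I_r]) H w = \prod_i H (G i).
  by rewrite big_map big_enum.
rewrite (det_horner_mx (rs := s1 ++ s2)).
  by rewrite big_cat !e /norm_C big_split.
by rewrite -map_char_poly cM p_factors big_split big_cat !e.
Qed.

Lemma norm_CE (f : {poly int}) :
  norm_C (map_poly intr f) = (\prod_i normc (sigma i (evZ f th)) ^+ 2)%:RC.
Proof.
rewrite rmorph_prod; apply: eq_bigr => i _.
by rewrite -conj_evZ -sigma_evZ mul_conjc.
Qed.

(** The norm of an element of the order generated by th is the determinant of
    an integral matrix; it is divisible by the element because, up to sign, it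
    is the constant term of an integral polynomial vanishing there. *)
Lemma norm_evZ (f : {poly int}) : exists N : int,
  N%:~R = \prod_i normc (sigma i (evZ f th)) ^+ 2 /\
  exists g : {poly int}, N%:~R = evZ f th * evZ g th.
Proof.
have [n [M detM]] := norm_matrix.
pose M' := horner_mx M f; exists (\det M').
have M'C : map_mx intr M' = horner_mx (map_mx intr M) (map_poly intr f) :> 'M[R[i]]_n.+1.
  exact: map_horner_mx.
split.
  apply: (@complexI R); rewrite -[RHS]norm_CE -detM -M'C det_map_mx.
  exact: (rmorph_int (@RtoC R)).
pose chi := char_poly M'; pose x := evZ f th.
have chix : evZ chi x = 0.
  have i0 : 'I_r := Ordinal r0.
  apply: (fmorph_inj (sigma i0)); rewrite rmorph0 -horner_map -map_poly_comp.
  rewrite (eq_map_poly (g := intr)); last by move=> k; exact: rmorph_int.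
  rewrite map_char_poly horner_char_poly M'C -(horner_mx_C (map_mx intr M)) -rmorphB detM.
  rewrite /norm_C (bigD1 i0)//= hornerD hornerN hornerC sigma_evZ subrr.
  by rewrite !mul0r.
have /factor_theorem[q] : root (chi - (chi.[0])%:P) 0.
  by rewrite /root hornerD hornerN hornerC subrr.
rewrite subr0 => /eqP; rewrite subr_eq => /eqP chiE.
have chi0 : chi.[0] = (-1) ^+ n.+1 * \det M'.
  by rewrite horner_char_poly raddf0 sub0r -scaleN1r detZ.
have qf : evZ (q \Po f) th = evZ q x by rewrite map_comp_poly horner_comp.
exists ((-1) ^+ n *: (q \Po f)).
rewrite map_polyZ hornerZ qf /=.
have : evZ q x * x + (chi.[0])%:~R = 0.
  move: (chi.[0]) chiE => c chiE.
  by rewrite -chix chiE rmorphD rmorphM /= map_polyX map_polyC !hornerE.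
move/eqP; rewrite addrC addr_eq0 chi0 rmorphM /= => /eqP E.
have s1 : ((-1) ^+ n.+1)%:~R * ((-1) ^+ n.+1)%:~R = 1 :> K.
  by rewrite -rmorphM -exprMn mulrNN mulr1 expr1n.
have -> : (\det M')%:~R = ((-1) ^+ n.+1)%:~R * - (evZ q x * x).
  by rewrite -E mulrA s1 mul1r.
rewrite exprS mulN1r rmorphN /= mulNr mulrN opprK.
by rewrite [RHS]mulrCA [x * _]mulrC.
Qed.

End Norm.

(** * Norms of integral elements *)

Lemma integral_rmorph (E E' : fieldType) (f : {rmorphism E -> E'}) (x : E) :
  integralOver (intr : int -> E') (f x) <-> integralOver (intr : int -> E) x.
Proof.
have rootE P : root (map_poly intr P) (f x) = root (map_poly (intr : int -> E) P) x.
  have -> : map_poly intr P = map_poly f (map_poly intr P).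
    by rewrite -map_poly_comp; apply: eq_map_poly => m /=; rewrite rmorph_int.
  by rewrite fmorph_root.
by split=> -[P monP Px]; exists P => //; rewrite rootE in Px *.
Qed.

Lemma rational_integral (F : numFieldType) (q : rat) :
  integralOver (intr : int -> F) (ratr q) -> exists m : int, q = m%:~R.
Proof.
move=> [P monP Pq].
have mapr (E : numFieldType) : map_poly intr P = map_poly (ratr : rat -> E) (map_poly intr P).
  by rewrite -map_poly_comp; apply: eq_map_poly => m /=; rewrite ratr_int.
have Pq' : root (map_poly intr P) q.
  by move: Pq; rewrite mapr fmorph_root.
have int_q : (ratr q : algC) \is a Num.int.
  apply: Cint_rat_Aint; first exact: Crat_rat.
  apply: (@root_monic_Aint (map_poly intr P)).
  - by rewrite mapr fmorph_root.
  - by rewrite monic_map.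
  - by apply/polyOverP => i; rewrite coef_map /= rpred_int.
have /intrP[m qm] := int_q; exists m.
by apply: (fmorph_inj (ratr : {rmorphism rat -> algC})); rewrite /= qm ratr_int.
Qed.

Section NormIntegral.
Variables (R : realType) (K : fieldExtType rat) (th : K) (p : {poly int}).
Local Notation evQ q x := ((map_poly (ofrat K) q).[x]).
Local Notation integral x := (integralOver (intr : int -> K) x).
Variables (r : nat) (sigma : 'I_r -> {rmorphism K -> R[i]}).
Hypothesis r0 : (0 < r)%N.
Hypothesis mon_p : p \is monic.
Hypothesis p_factors : map_poly intr p =
  \prod_i (('X - (sigma i th)%:P) * ('X - ((sigma i th)^*)%:P)) :> {poly R[i]}.
Hypothesis gen_th : forall x : K, exists q : {poly rat}, x = evQ q th.

(** The square of the product is the norm of x, a positive number that is both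
    rational and an algebraic integer. *)
Lemma integral_norm_ge1 (x : K) : integral x -> x != 0 ->
  1 <= \prod_i normc (sigma i x).
Proof.
move=> ix x0; have [f [D [D0 Dx]]] := clear_denominators (gen_th x).
have [N [NE _]] := norm_evZ r0 mon_p p_factors f.
pose y : R := \prod_i normc (sigma i x) ^+ 2.
have DR : (D%:~R : R) ^+ 2 != 0 by rewrite expf_eq0 intr_eq0.
have NyE : N%:~R = ((D%:~R : R) ^+ 2) ^+ r * y.
  rewrite NE Dx /y -[r in _ ^+ r]card_ord -prodr_const -big_split /=.
  apply: eq_bigr => i _; rewrite rmorphM normcM exprMn rmorph_int; congr (_ * _).
  by rewrite -[D%:~R]/((D%:~R : R[i])) -(rmorph_int (@RtoC R)) normc_RtoC real_normK// num_real.
have yq : y = ratr (N%:~R / ((D ^+ 2) ^+ r)%:~R).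
  rewrite fmorph_div /= !ratr_int NyE !rmorphXn /=.
  by rewrite mulrAC divff ?mul1r// expf_neq0.
have iy : integralOver (intr : int -> R[i]) (ratr (N%:~R / ((D ^+ 2) ^+ r)%:~R)).
  rewrite -(fmorph_rat (@RtoC R)) -yq /y rmorph_prod.
  elim/big_ind: _ => [|u v iu iv|i _].
  - exact: integral1.
  - exact: integral_mul.
  rewrite [X in integralOver _ X](_ : _ = sigma i x * (sigma i x)^*); last first.
    exact/esym/mul_conjc.
  have isx : integralOver (intr : int -> R[i]) (sigma i x) by apply/integral_rmorph.
  by apply: integral_mul => //; apply/(integral_rmorph (conjc : {rmorphism R[i] -> R[i]})).
have [m mE] := rational_integral iy.
have ym : y = m%:~R by rewrite yq mE ratr_int.
have y0 : 0 < y.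
  by apply: prodr_gt0 => i _; rewrite exprn_gt0// normc_gt0 fmorph_eq0.
have y1 : 1 <= y by move: y0; rewrite ym ltr0z ler1z.
have P0 : 0 <= \prod_i normc (sigma i x) by apply: prodr_ge0 => i _; exact: normc_ge0.
rewrite leNgt; apply/negP => lt1; move: y1; apply/negP; rewrite -ltNge.
by rewrite /y prodrXl exprn_ilt1.
Qed.

End NormIntegral.

(** * Integral elements of small size *)

Section Pigeonhole.
Variable R : realType.

Lemma pigeonhole (A B : finType) (f : A -> B) : (#|B| < #|A|)%N ->
  exists x y, x != y /\ f x = f y.
Proof.
move=> BA; have /injectivePn[x [y xy fxy]] : ~~ injectiveb f.
  by apply/negP => /injectiveP /leq_card; rewrite leqNgt BA.
by exists x, y.
Qed.

(** Half-open cells of width 2 A / q cut the interval ]-A, A[; the bound is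
    written q.-1.+1 because inord needs a successor. *)
Definition cell (A : R) (q : nat) (x : R) : 'I_q.-1.+1 :=
  inord (Num.truncn ((x + A) / (2 * A) * q%:R)).

Lemma same_cell (A : R) (q : nat) (x y : R) : 0 < A -> (0 < q)%N ->
  `|x| < A -> `|y| < A -> cell A q x = cell A q y -> `|x - y| <= 2 * A / q%:R.
Proof.
move=> A0 q0 xA yA; have q0' : 0 < q%:R :> R by rewrite ltr0n.
have bd z : `|z| < A -> 0 <= (z + A) / (2 * A) * q%:R /\
    (Num.truncn ((z + A) / (2 * A) * q%:R) < q.-1.+1)%N.
  move=> zA; have := zA; rewrite ltr_norml => /andP[zA1 zA2].
  have h1 : 0 <= (z + A) / (2 * A).
    by apply: divr_ge0; [lra|rewrite mulr_ge0// ltW].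
  split; first by rewrite mulr_ge0// ltW.
  rewrite prednK// truncn_lt_nat; last by rewrite mulr_ge0// ltW.
  rewrite gtr_pMl// ltr_pdivrMr ?mulr_gt0//.
  by lra.
have [x0 xq] := bd x xA; have [y0 yq] := bd y yA.
move=> /(congr1 (@nat_of_ord _)); rewrite !inordK// => e.
have := truncn_itv x0; have := truncn_itv y0; rewrite -e -natr1.
set k := (Num.truncn _)%:R => /andP[y1 y2] /andP[x1 x2].
have xyE : x - y = ((x + A) / (2 * A) * q%:R - (y + A) / (2 * A) * q%:R) * (2 * A / q%:R).
  by field; rewrite !gt_eqF//.
have c0 : 0 < 2 * A / q%:R by rewrite divr_gt0// mulr_gt0.
rewrite xyE normrM (gtr0_norm c0) ler_piMl ?(ltW c0)//.
rewrite ler_norml; move: x1 x2 y1 y2.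
set X := (x + A) / _ * _; set Y := (y + A) / _ * _ => x1 x2 y1 y2.
by apply/andP; split; lra.
Qed.

Variables (K : fieldExtType rat) (th : K) (p : {poly int}).
Local Notation evQ q x := ((map_poly (ofrat K) q).[x]).
Local Notation evZ f x := ((map_poly (intr : int -> K) f).[x]).
Variables (r : nat) (sigma : 'I_r -> {rmorphism K -> R[i]}).
Hypothesis r0 : (0 < r)%N.
Hypothesis size_p : size p = r.*2.+1.
Hypothesis min_p : forall q : {poly rat}, evQ q th = 0 <-> map_poly intr p %| q.

Lemma evZ_eq0 (f : {poly int}) : (size f <= r.*2)%N -> evZ f th = 0 -> f = 0.
Proof.
move=> sf f0; have inj : injective (intr : int -> rat) by exact: intr_inj.
have : map_poly intr p %| (map_poly intr f : {poly rat}).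
  by apply/min_p; rewrite map_ofrat_int.
move=> pf; apply: (map_inj_poly inj (rmorph0 _)); rewrite rmorph0.
apply/eqP; apply/negPn/negP => fn0; have := dvdp_leq fn0 pf.
by rewrite !size_map_inj_poly// size_p leqNgt ltnS sf.
Qed.

(** Dirichlet's box principle for the order generated by th: a parallelepiped
    with prescribed side lengths contains a nonzero element as soon as its
    volume is large enough. *)
Lemma small_integers : exists2 C : R, 0 < C & forall (N : nat) (q : 'I_r -> nat),
  (0 < N)%N -> (forall i, 0 < q i)%N -> (\prod_i q i <= N ^ r)%N ->
  exists f : {poly int}, [/\ (size f <= r.*2)%N, evZ f th != 0 &
    forall i, normc (sigma i (evZ f th)) <= C * N%:R / (q i)%:R].
Proof.
pose A : R := 1 + \sum_i \sum_(j < r.*2) normc (sigma i th ^+ j).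
have S0 i : 0 <= \sum_(j < r.*2) normc (sigma i th ^+ j).
  by apply: sumr_ge0 => j _; exact: normc_ge0.
have A1 : 1 <= A by rewrite lerDl sumr_ge0.
have A0 : 0 < A by exact: lt_le_trans A1.
exists (4 * A); first by rewrite mulr_gt0.
move=> N q N0 q0 prodq; have NR0 : 0 < N%:R :> R by rewrite ltr0n.
pose v (c : {ffun 'I_r.*2 -> 'I_N.+1}) i : R[i] := \sum_j (c j)%:R * sigma i th ^+ j.
have v_bound c i : normc (v c i) < N%:R * A.
  apply: (@le_lt_trans _ _ (N%:R * \sum_(j < r.*2) normc (sigma i th ^+ j))).
    apply: le_trans (normc_sum _ _ _) _; rewrite mulr_sumr; apply: ler_sum => j _.
    rewrite normcM ler_wpM2r ?normc_ge0//.
    rewrite -(rmorph_nat (@RtoC R)) normc_RtoC ger0_norm ?ler0n//.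
    by rewrite ler_nat -ltnS.
  rewrite ltr_pM2l// /A (bigD1 i)//= addrCA ltrDl.
  by rewrite ltr_wpDr// sumr_ge0.
pose T i := ('I_(q i).-1.+1 * 'I_(q i).-1.+1)%type.
pose F (c : {ffun 'I_r.*2 -> 'I_N.+1}) : {dffun forall i : 'I_r, T i} :=
  [ffun i => (cell (N%:R * A) (q i) (complex.Re (v c i)),
              cell (N%:R * A) (q i) (complex.Im (v c i)))].
have cardT : (#|{dffun forall i : 'I_r, T i}| < #|{: {ffun 'I_r.*2 -> 'I_N.+1}}|)%N.
  rewrite card_ffun !card_ord card_dep_ffun foldrE big_image /=.
  under eq_bigr => i _ do rewrite card_prod !card_ord prednK//.
  rewrite big_split /=; apply: leq_ltn_trans (leq_mul prodq prodq) _.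
  by rewrite -expnD addnn ltn_exp2r// double_gt0.
have [c [c' [cc' Fcc']]] := pigeonhole F cardT.
pose f : {poly int} := \poly_(j < r.*2)
  (if insub j is Some j' then (c j' : nat)%:Z - (c' j' : nat)%:Z else 0).
have fE (j : 'I_r.*2) : f`_j = (c j : nat)%:Z - (c' j : nat)%:Z.
  by rewrite coef_poly ltn_ord valK.
have sf : (size f <= r.*2)%N by exact: size_poly.
have evE i : sigma i (evZ f th) = v c i - v c' i.
  have -> : sigma i (evZ f th) = (map_poly intr f).[sigma i th].
    rewrite -horner_map -map_poly_comp; congr (_.[_]); apply: eq_map_poly => n.
    exact: rmorph_int.
  rewrite (@horner_coef_wide _ r.*2); last by apply: leq_trans (size_poly _ _) _.
  rewrite /v -sumrB; apply: eq_bigr => j _.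
  by rewrite coef_map /= fE rmorphB /= mulrBl.
exists f; split=> //.
  apply: contra_neq cc' => f0; have f00 := evZ_eq0 sf f0.
  apply/ffunP => j; apply: val_inj; have := fE j; rewrite f00 coef0.
  by move=> /esym/eqP; rewrite subr_eq0 => /eqP[].
move=> i; rewrite evE; have := congr1 (fun g : {dffun forall i : 'I_r, T i} => g i) Fcc'.
rewrite !ffunE => -[eRe eIm].
have NA0 : 0 < N%:R * A by exact: mulr_gt0.
have hRe c0 : `|complex.Re (v c0 i)| < N%:R * A by exact: le_lt_trans (normc_Re _) (v_bound _ _).
have hIm c0 : `|complex.Im (v c0 i)| < N%:R * A by exact: le_lt_trans (normc_Im _) (v_bound _ _).
have h1 := same_cell NA0 (q0 i) (hRe c) (hRe c') eRe.
have h2 := same_cell NA0 (q0 i) (hIm c) (hIm c') eIm.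
apply: le_trans (normc_le_ReIm _) _.
have -> : 4 * A * N%:R / (q i)%:R = 2 * (N%:R * A) / (q i)%:R + 2 * (N%:R * A) / (q i)%:R.
  by rewrite -mulrDl; congr (_ / _); ring.
apply: lerD; [move: h1|move: h2]; by case: (v c i) => x y; case: (v c' i).
Qed.

End Pigeonhole.

(** * A unit close to the unit circle at one place *)

Lemma infinite_pigeonhole (T : finType) (kappa : nat -> T) :
  exists c, forall n0, exists2 n, (n0 <= n)%N & kappa n = c.
Proof.
apply: contrapT => /forallNP H.
have B c : exists n0, forall n, (n0 <= n)%N -> kappa n <> c.
  by have /existsNP[n0 Hn0] := H c; exists n0 => n n0n nc; apply: Hn0; exists n.
pose b c := sval (cid (B c)).
have bP c n : (b c <= n)%N -> kappa n <> c by exact: (svalP (cid (B c))).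
pose n := (\sum_c b c)%N.
have bn c : (b c <= n)%N by rewrite /n (bigD1 c)//= leq_addr.
exact: bP (bn (kappa n)) erefl.
Qed.

Section Units.
Variable R : realType.
Variables (K : fieldExtType rat) (th : K) (p : {poly int}).
Local Notation evQ q x := ((map_poly (ofrat K) q).[x]).
Local Notation evZ f x := ((map_poly (intr : int -> K) f).[x]).
Local Notation integral x := (integralOver (intr : int -> K) x).
Variables (r : nat) (sigma : 'I_r -> {rmorphism K -> R[i]}).
Hypothesis r0 : (0 < r)%N.
Hypothesis mon_p : p \is monic.
Hypothesis p_factors : map_poly intr p =
  \prod_i (('X - (sigma i th)%:P) * ('X - ((sigma i th)^*)%:P)) :> {poly R[i]}.
Hypothesis gen_th : forall x : K, exists q : {poly rat}, x = evQ q th.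
Hypothesis min_p : forall q : {poly rat}, evQ q th = 0 <-> map_poly intr p %| q.

Lemma integral_evZ (f : {poly int}) : integral (evZ f th).
Proof.
apply: integral_horner.
  by move=> c /(nthP 0)[j _ <-]; rewrite coef_map; exact: integral_id.
exists p => //; rewrite /root -map_ofrat_int; apply/eqP; apply/min_p; exact: dvdpp.
Qed.

(** If a1 = a2 + m h and m = a2 g2 then a1 / a2 = 1 + g2 h; by symmetry the
    quotient will be a unit. *)
Lemma unit_quotient (f1 f2 : {poly int}) (m : int) : m != 0 ->
    (exists g, m%:~R = evZ f1 th * evZ g th) ->
    (exists g, m%:~R = evZ f2 th * evZ g th) ->
    (forall j, (f1`_j %% m)%Z = (f2`_j %% m)%Z) ->
  integral (evZ f1 th / evZ f2 th).
Proof.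
move=> m0 [g1 E1] [g2 E2] H.
have mK : m%:~R != 0 :> K by rewrite -ofrat_int fmorph_eq0 intr_eq0.
have a20 : evZ f2 th != 0 by apply: contra_neq mK => e; rewrite E2 e mul0r.
pose n := maxn (size f1) (size f2).
pose h := \poly_(j < n) ((f1`_j %/ m)%Z - (f2`_j %/ m)%Z).
have fh : f1 - f2 = m *: h.
  apply/polyP => j; rewrite coefB coefZ coef_poly; case: ltnP => jn.
    by rewrite {1}(divz_eq f1`_j m) {1}(divz_eq f2`_j m) H; ring.
  by rewrite !nth_default ?subrr ?mulr0// (leq_trans _ jn)// leq_max leqnn ?orbT.
have -> : evZ f1 th / evZ f2 th = evZ (1 + g2 * h) th.
  have -> : evZ f1 th = evZ f2 th + m%:~R * evZ h th.
    have e : f1 = f2 + m *: h by rewrite -fh addrC subrK.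
    by rewrite {1}e rmorphD hornerD /= map_polyZ hornerZ.
  rewrite E2 rmorphD rmorphM rmorph1 hornerD hornerC hornerM.
  by rewrite -mulrA mulrDl divff// [_ / _]mulrC mulKf.
exact: integral_evZ.
Qed.

Variables (i0 i1 i2 : 'I_r).
Hypotheses (i01 : i0 != i1) (i02 : i0 != i2) (i12 : i1 != i2).

(** Boxes stretched in the direction of one place and compressed in another,
    with bounded sides elsewhere, produce infinitely many elements of bounded
    norm.  Two of them agreeing in all relevant finite data have a unit as
    quotient, which is almost of modulus one at the chosen place. *)
Lemma unit_near_one (delta : R) : 0 < delta -> exists x : K,
  [/\ integral x, integral x^-1, x != 0,
      `|normc (sigma i0 x) ^+ 2 - 1| < delta & normc (sigma i2 x) != 1].
Proof.
move=> delta0.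
have size_p := size_min_poly p_factors.
have [C C0 CP] := small_integers sigma r0 size_p min_p.
pose q (N : nat) (i : 'I_r) := if i == i1 then 1%N else if i == i2 then (N ^ 2)%N else N.
have qpos N i : (0 < N)%N -> (0 < q N i)%N.
  by move=> N0; rewrite /q; do 2!case: ifP => // _; rewrite expn_gt0 N0.
have prodq N : (\prod_i q N i = N ^ r)%N.
  rewrite -[r in RHS]card_ord -prod_nat_const (bigD1 i1)//= (bigD1 i2) /=; last by rewrite eq_sym.
  rewrite [RHS](bigD1 i1)//= [in RHS](bigD1 i2) /=; last by rewrite eq_sym.
  rewrite {1 2}/q !eqxx eq_sym (negPf i12) mul1n mulnA; congr (_ * _)%N.
  by apply: eq_bigr => i /andP[/negPf h1 /negPf h2]; rewrite /q h1 h2.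
pose B (N : nat) i : R := C * N%:R / (q N i)%:R.
have Bpos N i : (0 < N)%N -> 0 < B N i.
  by move=> N0; rewrite divr_gt0 ?mulr_gt0 ?ltr0n ?qpos.
have prodB N : (0 < N)%N -> \prod_i B N i = C ^+ r.
  move=> N0; rewrite /B big_split /= prodr_const card_ord exprMn.
  have -> : \prod_i (q N i)%:R^-1 = (N%:R ^+ r)^-1 :> R.
    by rewrite prodfV -natr_prod prodq natrX.
  by rewrite mulfK// expf_neq0// pnatr_eq0 -lt0n.
have Bi0 N : (0 < N)%N -> B N i0 = C.
  by move=> N0; rewrite /B /q (negPf i01) (negPf i02) mulfK// pnatr_eq0 -lt0n.
have Bi2 N : (0 < N)%N -> B N i2 = C / N%:R.
  move=> N0; rewrite /B /q eq_sym (negPf i12) eqxx natrX expr2 invfM mulrA mulfK//.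
  by rewrite pnatr_eq0 -lt0n.
have Cr0 : 0 < C ^+ r by exact: exprn_gt0.
pose c1 := C / C ^+ r; have c10 : 0 < c1 by exact: divr_gt0.
have f_ex n : exists f : {poly int}, [/\ (size f <= r.*2)%N, evZ f th != 0 &
    forall i, normc (sigma i (evZ f th)) <= B n.+1 i].
  by apply: CP => // [i|]; [exact: qpos|rewrite prodq].
pose f n := sval (cid (f_ex n)); pose a n := evZ (f n) th.
have size_f n : (size (f n) <= r.*2)%N by have [] := svalP (cid (f_ex n)).
have a_neq0 n : a n != 0 by have [] := svalP (cid (f_ex n)).
have aB n i : normc (sigma i (a n)) <= B n.+1 i by have [_ _] := svalP (cid (f_ex n)); apply.
have a_pos n i : 0 < normc (sigma i (a n)) by rewrite normc_gt0 fmorph_eq0.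
have a_ge n : c1 <= normc (sigma i0 (a n)).
  have n1 := integral_norm_ge1 r0 mon_p p_factors gen_th (integral_evZ (f n)) (a_neq0 n).
  have pB := prodB n.+1 isT; move: n1 pB; rewrite (bigD1 i0)//= [in X in _ -> X -> _](bigD1 i0)//= Bi0//.
  set P1 := \prod_(i | _) normc _; set P2 := \prod_(i | _) _ => n1 pB.
  have P12 : P1 <= P2.
    by apply: ler_prod => i _; rewrite normc_ge0 aB.
  rewrite /c1 -pB ler_pdivrMr; last by rewrite pB.
  rewrite -[X in X <= _]mulr1 mulrCA ler_wpM2l ?(ltW C0)//.
  by apply: le_trans n1 _; rewrite ler_wpM2l ?normc_ge0.
pose N n := sval (cid (norm_evZ r0 mon_p p_factors (f n))).
have NE n : (N n)%:~R = \prod_i normc (sigma i (a n)) ^+ 2 :> R.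
  by have [] := svalP (cid (norm_evZ r0 mon_p p_factors (f n))).
have Ndvd n : exists g, (N n)%:~R = a n * evZ g th.
  by have [] := svalP (cid (norm_evZ r0 mon_p p_factors (f n))).
have Npos n : 0 < N n.
  by rewrite -(ltr0z R) NE; apply: prodr_gt0 => i _; rewrite exprn_gt0.
pose M := (Num.truncn ((C ^+ r) ^+ 2)).+1.
have N_lt n : (`|N n| < M.+1)%N.
  rewrite ltnS /M ltnW// ltnS truncn_ge_nat ?sqr_ge0//.
  rewrite natr_absz ger0_norm ?(ltW (Npos n))// NE -(prodB n.+1)// -prodrXl.
  by apply: ler_prod => i _; rewrite sqr_ge0 lerXn2r ?nnegrE ?normc_ge0 ?(ltW (Bpos _ _ _)).
pose D := (Num.truncn ((delta * c1 ^+ 2)^-1)).+1.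
have D_gt : (delta * c1 ^+ 2)^-1 < D%:R by rewrite /D truncnS_gt.
pose t n : R := normc (sigma i0 (a n)) ^+ 2.
have t_ge n : c1 ^+ 2 <= t n.
  by rewrite lerXn2r ?nnegrE ?normc_ge0 ?(ltW c10)// a_ge.
have t_le n : t n <= C ^+ 2.
  by rewrite lerXn2r ?nnegrE ?normc_ge0 ?(ltW C0)// -(Bi0 n.+1)// aB.
have t0 n : 0 < t n by rewrite exprn_gt0.
have D0 : 0 < D%:R :> R by rewrite ltr0n.
pose L := (Num.truncn (C ^+ 2 * D%:R)).+1.
have L_lt n : (Num.truncn (t n * D%:R) < L)%N.
  by rewrite ltnS le_truncn// ler_wpM2r// ltW.
pose res n (j : nat) := `|((f n)`_j %% N n)%Z|%N.
have Nn0 n : N n != 0 by rewrite gt_eqF.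
have mod_ge0 n (c : int) : 0 <= (c %% N n)%Z by rewrite modz_ge0.
have res_lt n j : (res n j < M.+1)%N.
  apply: ltn_trans (N_lt n); rewrite -ltz_nat !abszE !ger0_norm ?(ltW (Npos n))//.
  exact: ltz_pmod.
pose kappa n : 'I_M.+1 * {ffun 'I_r.*2 -> 'I_M.+1} * 'I_L.-1.+1 :=
  (inord `|N n|%N, [ffun j : 'I_r.*2 => inord (res n j)], inord (Num.truncn (t n * D%:R))).
have [c Hc] := infinite_pigeonhole kappa.
have [n1 _ k1] := Hc 0%N.
have [n2 n21 k2] := Hc (Num.truncn (C / normc (sigma i2 (a n1)))).
have [eN eres et] : [/\ N n1 = N n2, (forall j, res n1 j = res n2 j) &
    Num.truncn (t n1 * D%:R) = Num.truncn (t n2 * D%:R)].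
  move: k1; rewrite -k2 => -[/(congr1 (@nat_of_ord _)) e1 /ffunP e2 /(congr1 (@nat_of_ord _)) e3].
  rewrite !inordK// in e1; rewrite !inordK// in e3; split=> //.
    have := congr1 Posz e1; rewrite !abszE !ger0_norm ?(ltW (Npos _))//.
  move=> j; have [jr|jr] := ltnP j r.*2.
    have /(congr1 (@nat_of_ord _)) := e2 (Ordinal jr); rewrite !ffunE !inordK//.
  by rewrite /res !nth_default ?mod0z// (leq_trans (size_f _)).
have eqmod j : ((f n1)`_j %% N n1)%Z = ((f n2)`_j %% N n1)%Z.
  have := congr1 Posz (eres j); rewrite /res !abszE !ger0_norm ?mod_ge0//.
  by rewrite eN.
have d1 : exists g, (N n1)%:~R = a n1 * evZ g th by exact: Ndvd.
have d2 : exists g, (N n1)%:~R = a n2 * evZ g th by rewrite eN; exact: Ndvd.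
exists (a n1 / a n2); split.
- exact: unit_quotient (Nn0 n1) d1 d2 eqmod.
- rewrite invf_div; apply: unit_quotient (Nn0 n1) d2 d1 _ => j.
  by rewrite eqmod.
- by rewrite mulf_neq0 ?invr_eq0.
- rewrite fmorph_div normcM normcV exprMn exprVn -/(t n1) -/(t n2).
  have -> : t n1 / t n2 - 1 = (t n1 * D%:R - t n2 * D%:R) / (t n2 * D%:R).
    by field; rewrite !gt_eqF.
  have tD n : 0 <= t n * D%:R by rewrite mulr_ge0// ltW.
  have := truncn_itv (tD n1); have := truncn_itv (tD n2); rewrite et -natr1.
  set k := (Num.truncn _)%:R => /andP[y1 y2] /andP[x1 x2].
  have tD0 : 0 < t n2 * D%:R by rewrite mulr_gt0.
  rewrite normrM normfV (gtr0_norm tD0) ltr_pdivrMr//.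
  apply: (@lt_trans _ _ 1).
    move: x1 x2 y1 y2; set x := _ * _; set y := t n2 * _ => x1 x2 y1 y2.
    by rewrite ltr_norml; apply/andP; split; lra.
  have dc0 : 0 < delta * c1 ^+ 2 by rewrite mulr_gt0// exprn_gt0.
  have lt1 : 1 < delta * c1 ^+ 2 * D%:R by rewrite mulrC -ltr_pdivrMr// div1r.
  apply: lt_le_trans lt1 _; rewrite [X in _ <= X]mulrA.
  by apply: ler_wpM2r; [exact: ltW|apply: ler_wpM2l; [exact: ltW|exact: t_ge]].
- rewrite fmorph_div normcM normcV; apply/negP => /eqP e.
  have : normc (sigma i2 (a n1)) = normc (sigma i2 (a n2)).
    have a2 := a_pos n2 i2; apply: (mulIf (x := (normc (sigma i2 (a n2)))^-1)).
      by rewrite invr_eq0 gt_eqF.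
    by rewrite e divff// gt_eqF.
  apply/eqP; rewrite gt_eqF//; apply: le_lt_trans (aB n2 i2) _; rewrite Bi2//.
  rewrite ltr_pdivrMr ?ltr0n// mulrC -ltr_pdivrMr//.
  by apply: lt_le_trans (truncnS_gt _) _; rewrite ler_nat.
Qed.

End Units.

(** * Density of the real units *)

Section RealUnits.
Variables (R : realType) (K : fieldExtType rat).
Local Notation integral x := (integralOver (intr : int -> K) x).
Variables (r : nat) (sigma : 'I_r -> {rmorphism K -> R[i]}).
Variables (i0 i2 : 'I_r).
Hypothesis near_one : forall delta : R, 0 < delta -> exists x : K,
  [/\ integral x, integral x^-1, x != 0,
      `|normc (sigma i0 x) ^+ 2 - 1| < delta & normc (sigma i2 x) != 1].
Hypothesis bar : forall x : K, exists y : K,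
  (forall i, sigma i y = (sigma i x)^*) /\ (integral x -> integral y).

(** The product of a unit with its conjugate is a totally positive unit. *)
Lemma real_unit_near_one (delta : R) : 0 < delta -> exists (u : K) (H : R),
  [/\ integral u, integral u^-1, u != 0, sigma i0 u = H%:RC &
      (forall i, sigma i u \is Num.real) /\ 1 < H < 1 + delta].
Proof.
move=> delta0; pose d := Num.min (delta / 2) (1 / 2).
have d0 : 0 < d by rewrite lt_min !divr_gt0.
have d1 : d <= delta / 2 by rewrite ge_min lexx.
have d2 : d <= 1 / 2 by rewrite ge_min lexx orbT.
have [x [ix ixV x0 hd x2]] := near_one d0.
have [y [yE iy]] := bar x; have [y' [yE' iy']] := bar x^-1.
have yy' : y * y' = 1.
  apply: (fmorph_inj (sigma i0)); rewrite rmorphM yE yE' -rmorphM -rmorphM.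
  by rewrite divff// !rmorph1.
have y0 : y != 0 by apply: contra_eq_neq yy' => ->; rewrite mul0r eq_sym oner_eq0.
have yV : y^-1 = y' by apply: (mulfI y0); rewrite divff// yy'.
pose u := x * y.
have uE i : sigma i u = (normc (sigma i x) ^+ 2)%:RC by rewrite rmorphM yE mul_conjc.
have u0 : u != 0 by rewrite mulf_neq0.
have iu : integral u by apply: integral_mul => //; exact: iy.
have iuV : integral u^-1 by rewrite invfM yV; apply: integral_mul => //; exact: iy'.
set h := normc (sigma i0 x) ^+ 2 in hd.
have h1 : h != 1.
  apply: contra_neq x2 => h1.
  have u1 : u = 1 by apply: (fmorph_inj (sigma i0)); rewrite uE -/h h1 !rmorph1.
  have := uE i2; rewrite u1 rmorph1 -[1 in LHS](rmorph1 (@RtoC R)) => /(@complexI R) /esym/eqP.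
  by rewrite sqrf_eq1 => /orP[/eqP//|/eqP e]; have := normc_ge0 (sigma i2 x); rewrite e ler0N1.
move: hd; rewrite ltr_norml => /andP[hd1 hd2].
have h0 : 0 < h by lra.
have ur i : sigma i u \is Num.real by rewrite uE; apply/complex_realP; eexists.
have [hlt|hgt|heq] := ltgtP h 1; last by rewrite heq eqxx in h1.
- exists u^-1, h^-1; rewrite invrK invr_eq0; split=> //.
    by rewrite fmorphV uE -/h (fmorphV (@RtoC R)).
  split; first by move=> i; rewrite fmorphV rpredV.
  rewrite invf_gt1// hlt /= invf_plt ?posrE//; last by lra.
  rewrite -div1r ltr_pdivrMr; last by lra.
  by nra.
- by exists u, h; split=> //; split=> //; rewrite hgt /=; lra.
Qed.

(** Powers of a unit that is close to 1 at the first place form a geometric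
    progression of ratio close to 1. *)
Lemma real_units_dense (x e : R) : 0 < x -> 0 < e ->
  exists u : K, [/\ integral u, integral u^-1, u != 0,
    forall i, sigma i u \is Num.real & exists2 y : R, sigma i0 u = y%:RC & `|y - x| < e].
Proof.
move=> x0 e0.
have [u [H [iu iuV u0 uH [ur /andP[H1 H2]]]]] := real_unit_near_one (divr_gt0 e0 x0).
have H0 : 0 < H by apply: lt_trans H1.
have lH : 0 < ln H by exact: ln_gt0.
pose k := Num.floor (ln x / ln H).
have [w [iw iwV w0 wr wE]] : exists w : K, [/\ integral w, integral w^-1, w != 0,
    forall i, sigma i w \is Num.real & sigma i0 w = (expR (k%:~R * ln H))%:RC].
  have iX z n : integral z -> integral (z ^+ n).
    move=> iz; elim: n => [|n IH]; first exact: integral1.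
    by rewrite exprS; exact: integral_mul.
  case: k => n.
  - exists (u ^+ n); rewrite -exprVn; split; [exact: iX|exact: iX|exact: expf_neq0| |].
      by move=> i; rewrite rmorphXn rpredX.
    by rewrite rmorphXn uH -(rmorphXn (@RtoC R)) -pmulrn expRM_natl lnK.
  - exists (u^-1 ^+ n.+1); rewrite -exprVn invrK; split;
      [exact: iX|exact: iX|by rewrite expf_neq0// invr_eq0| |].
      by move=> i; rewrite rmorphXn fmorphV rpredX// rpredV.
    rewrite rmorphXn fmorphV uH -(fmorphV (@RtoC R)) -(rmorphXn (@RtoC R)).
    rewrite NegzE mulrNz mulNr -pmulrn expRN expRM_natl lnK//.
    by rewrite exprVn.
exists w; split=> //; exists (expR (k%:~R * ln H)) => //.
have k1 : expR (k%:~R * ln H) <= x.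
  by rewrite -[X in _ <= X]lnK// ler_expR -ler_pdivlMr// Num.Theory.floor_le.
have k2 : x < expR (k%:~R * ln H) * H.
  rewrite -[X in _ * X]lnK// -expRD -[X in X < _]lnK// ltr_expR.
  rewrite -[X in _ + X]mul1r -mulrDl -ltr_pdivrMr//.
  by have := Num.Theory.floorD1_gt (ln x / ln H); rewrite intrD.
rewrite distrC ger0_norm ?subr_ge0//.
set E := expR _ in k1 k2 *; have E0 : 0 < E by exact: expR_gt0.
have : E * (H - 1) <= x * (H - 1) by rewrite ler_wpM2r// subr_ge0 ltW.
have : x * (H - 1) < e by rewrite mulrC -ltr_pdivlMr//; lra.
by nra.
Qed.

End RealUnits.

(** * Density of the integers away from one place *)

Section Density.
Variable R : realType.
Variables (K : fieldExtType rat) (th : K) (p : {poly int}).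
Local Notation evQ q x := ((map_poly (ofrat K) q).[x]).
Local Notation evZ f x := ((map_poly (intr : int -> K) f).[x]).
Local Notation integral x := (integralOver (intr : int -> K) x).
Variables (r : nat) (sigma : 'I_r -> {rmorphism K -> R[i]}).
Hypothesis r0 : (0 < r)%N.
Hypothesis mon_p : p \is monic.
Hypothesis p_factors : map_poly intr p =
  \prod_i (('X - (sigma i th)%:P) * ('X - ((sigma i th)^*)%:P)) :> {poly R[i]}.
Hypothesis sep_p : separable_poly (map_poly intr p : {poly rat}).
Hypothesis min_p : forall q : {poly rat}, evQ q th = 0 <-> map_poly intr p %| q.

Let w i : R[i] := sigma i th.
Let ell i : {poly R[i]} := ('X - ((w i)^*)%:P) *
  \prod_(j | j != i) (('X - (w j)%:P) * ('X - ((w j)^*)%:P)).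

Let ellE i : map_poly intr p = ('X - (w i)%:P) * ell i.
Proof. by rewrite p_factors (bigD1 i)//= mulrA. Qed.

Let ell_neq0 i : (ell i).[w i] != 0.
Proof.
have sep_C : separable_poly (map_poly intr p : {poly R[i]}).
  by rewrite -map_ratr_int (separable_map (ratr : {rmorphism rat -> R[i]})).
have rw : root (map_poly intr p) (w i) by rewrite (ellE i) rootM root_XsubC eqxx.
rewrite unlock in sep_C.
have := coprimep_root sep_C rw.
by rewrite (ellE i) derivM derivXsubC mul1r hornerD [(_ * _).[_]]hornerM hornerXsubC subrr mul0r addr0.
Qed.

Let pairE (x y z : R[i]) : (('X - x%:P) * ('X - y%:P)).[z] = (z - x) * (z - y).
Proof. by rewrite hornerM !hornerXsubC. Qed.

Let ell_node i j : j != i -> (ell i).[w j] = 0.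
Proof.
move=> ji; rewrite hornerM horner_prod (bigD1 j)//= pairE.
by rewrite [w j - w j]subrr !mul0r mulr0.
Qed.

Let ell_conj i j : (ell i).[(w j)^*] = 0.
Proof.
rewrite hornerM horner_prod; have [->|ji] := eqVneq j i.
  by rewrite hornerXsubC subrr mul0r.
by rewrite (bigD1 j)//= pairE [(w j)^* - (w j)^*]subrr mulr0 mul0r mulr0.
Qed.

Let size_ell i : (size (ell i) <= r.*2)%N.
Proof.
have inj : injective (intr : int -> R[i]) by exact: intr_inj.
have ell0 : ell i != 0 by apply: contra_neq (ell_neq0 i) => ->; rewrite horner0.
have := size_min_poly p_factors; rewrite -(size_map_inj_poly inj (rmorph0 _)) (ellE i).
by rewrite size_monicM ?monicXsubC// size_XsubC addSn add1n /= => -[->].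
Qed.

Let floor_dist (x : R) : normc ((Num.floor x)%:~R - x%:RC) <= 1.
Proof.
rewrite -(rmorph_int (@RtoC R)) -(rmorphB (@RtoC R)) normc_RtoC distrC.
have h1 := Num.Theory.floor_le x; have := Num.Theory.floorD1_gt x.
by rewrite intrD => h2; rewrite ger0_norm ?subr_ge0// lerBlDl; exact: ltW.
Qed.

(** Interpolation at the conjugates of th by a real polynomial, whose
    coefficients are then rounded to integers. *)
Lemma integers_cocompact : exists2 C : R, 0 < C & forall v : 'I_r -> R[i],
  exists g : {poly int}, forall i, normc (sigma i (evZ g th) - v i) <= C.
Proof.
pose C : R := 1 + \sum_i \sum_(k < r.*2) normc (w i ^+ k).
have S0 i : 0 <= \sum_(k < r.*2) normc (w i ^+ k).
  by apply: sumr_ge0 => j _; exact: normc_ge0.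
exists C; first by rewrite ltr_wpDr// sumr_ge0.
move=> v; pose h := \sum_i (v i / (ell i).[w i]) *: ell i.
have h_node j : h.[w j] = v j.
  rewrite horner_sum (bigD1 j)//= big1 ?addr0 => [|i ij].
    by rewrite hornerZ divfK// ell_neq0.
  by rewrite hornerZ [X in _ * X]ell_node ?mulr0//; rewrite eq_sym in ij.
have h_conj j : h.[(w j)^*] = 0.
  by rewrite horner_sum big1// => i _; rewrite hornerZ ell_conj mulr0.
have size_h : (size h <= r.*2)%N.
  apply: leq_trans (size_sum _ _ _) _; apply/bigmax_leqP => i _.
  exact: leq_trans (size_scale_leq _ _) (size_ell i).
pose c k : R := 2 * complex.Re h`_k.
pose f := h + map_poly (@conjc R) h.
have f_node j : f.[w j] = v j.
  rewrite hornerD h_node -[X in _ + _.[X]]conjcK horner_map h_conj rmorph0.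
  exact: addr0.
have f_coef k : f`_k = (c k)%:RC.
  rewrite coefD coef_map /c; case: (h`_k) => x y /=.
  by apply/eqP; rewrite eq_complex /= subrr eqxx andbT; apply/eqP; ring.
have size_f : (size f <= r.*2)%N.
  apply: leq_trans (size_polyD _ _) _; rewrite geq_max size_h.
  exact: leq_trans (size_poly _ _) size_h.
pose g : {poly int} := \poly_(k < r.*2) Num.floor (c k).
exists g => i; rewrite sigma_evZ -/(w i) -f_node.
rewrite (@horner_coef_wide _ r.*2); last first.
  by apply: leq_trans (size_poly _ _) _; exact: size_poly.
rewrite (@horner_coef_wide _ r.*2 f)// -sumrB; apply: le_trans (normc_sum _ _ _) _.
apply: (@le_trans _ _ (\sum_(k < r.*2) normc (w i ^+ k))).
  apply: ler_sum => k _; rewrite coef_map coef_poly ltn_ord f_coef -mulrBl normcM.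
  by rewrite ler_piMl ?normc_ge0// floor_dist.
by rewrite /C (bigD1 i)//= addrCA lerDl addr_ge0// sumr_ge0.
Qed.

Variable i0 : 'I_r.

(** Multiplying by an element that is small at all places but one turns the
    cocompactness of the order into density of its projection. *)
Lemma integers_dense (v : 'I_r -> R[i]) (e : R) : 0 < e ->
  exists2 y : K, integral y & forall i, i != i0 -> normc (sigma i y - v i) < e.
Proof.
move=> e0; have [C C0 CP] := integers_cocompact.
have [B B0 BP] := small_integers sigma r0 (size_min_poly p_factors) min_p.
pose M := (Num.truncn (B * C / e)).+1.
have M_gt : B * C / e < M%:R by rewrite /M truncnS_gt.
pose N := (M ^ r.-1)%N.
have N0 : (0 < N)%N by rewrite expn_gt0.
pose q (i : 'I_r) := if i == i0 then 1%N else (M * N)%N.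
have [||f [_ f0 fB]] := BP N q N0.
- by move=> i; rewrite /q; case: ifP => // _; rewrite muln_gt0.
- rewrite (bigD1 i0)//= {1}/q eqxx mul1n.
  rewrite (eq_bigr (fun=> (M * N)%N)) => [|i /negPf ii0]; last by rewrite /q ii0.
  rewrite prod_nat_const cardC1 card_ord expnMn -/N -[X in (_ <= _ ^ X)%N](prednK r0).
  by rewrite expnS.
have a0 i : sigma i (evZ f th) != 0 by rewrite fmorph_eq0.
have [g gP] := CP (fun i => v i / sigma i (evZ f th)).
exists (evZ f th * evZ g th).
  by apply: integral_mul; exact: (integral_evZ mon_p min_p).
move=> i ii0; have -> : sigma i (evZ f th * evZ g th) - v i =
    sigma i (evZ f th) * (sigma i (evZ g th) - v i / sigma i (evZ f th)).
  by rewrite rmorphM mulrBr [X in _ = _ - X]mulrC divfK.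
have fBi := fB i.
have qE : B * N%:R / (q i)%:R = B / M%:R.
  rewrite /q (negPf ii0) natrM; field.
  by rewrite !pnatr_eq0 -!lt0n N0.
rewrite qE in fBi; rewrite normcM.
apply: le_lt_trans (ler_pM (normc_ge0 _) (normc_ge0 _) fBi (gP i)) _.
by rewrite mulrAC ltr_pdivrMr ?ltr0n// [e * _]mulrC -ltr_pdivrMr.
Qed.

End Density.

(** * Conjugation in a CM field *)

Section CM.
Variables (R : realType) (K : fieldExtType rat) (F : {subfield K}).
Hypothesis hCM : CM_extension R F.
Local Notation integral x := (integralOver (intr : int -> K) x).
Implicit Types (tau : {rmorphism K -> R[i]}) (x : K).

Lemma real_on_subfield tau x : x \in F -> tau x \is Num.real.
Proof.
move=> xF; have [/(_ (tau \o vsval)) h _] := hCM.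
by have := h (Subvs xF).
Qed.

(** As -d is a negative number at every place, its square root delta is purely
    imaginary there; and K = F + F delta. *)
Lemma CM_basis : exists delta : K,
  (forall tau, (tau delta)^* = - tau delta /\ tau delta != 0) /\
  forall x, exists u v, [/\ u \in F, v \in F & x = u + v * delta].
Proof.
have [_ [d [delta [d0 dd full]]]] := hCM; exists delta; split=> [tau|x].
  have := d0 (tau \o vsval); have : tau delta ^+ 2 = - tau (vsval d).
    by rewrite -rmorphXn dd rmorphN.
  rewrite /=; move: (tau delta) (tau (vsval d)) => [x y] [u v].
  move=> /eqP; rewrite eq_complex /= => /andP[/eqP h1 /eqP h2].
  rewrite ltcE /= => /andP[/eqP v0 u0].
  have y0 : y != 0.
    apply/negP => /eqP y0; move: h1; rewrite y0 mulr0 subr0 => h1.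
    by have := sqr_ge0 x; rewrite expr2 h1 oppr_ge0 leNgt u0.
  have x0 : x = 0.
    apply: (mulIf y0); rewrite mul0r; move: h2; rewrite v0 oppr0 [y * x]mulrC -mulr2n.
    by move/eqP; rewrite mulrn_eq0 => /eqP.
  by rewrite x0; split; [apply/eqP; rewrite eq_complex /= oppr0 !eqxx|rewrite eq_complex negb_and y0 orbT].
have : x \in <<F; delta>>%VS by rewrite full memvf.
move=> /Fadjoin_polyP[p pF ->].
pose P : {poly K} := 'X^2 + (vsval d)%:P.
have sP : size P = 3 by rewrite size_polyDl size_polyXn// (leq_ltn_trans (size_polyC_leq1 _)).
have PF : P \is a polyOver F by rewrite rpredD ?polyOverC ?subvsP// rpredX// polyOverX.
have P0 : P.[delta] = 0 by rewrite hornerD hornerXn hornerC dd addNr.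
have rF := modp_polyOver pF PF.
exists (p %% P)`_0, (p %% P)`_1; split; rewrite ?(polyOverP rF)//.
have Pn0 : P != 0 by rewrite -size_poly_gt0 sP.
(* delta is a root of P, so only the remainder modulo P matters *)
have := ltn_modpN0 p Pn0; rewrite sP ltnS => sr.
rewrite {1}(divp_eq p P) hornerD hornerM P0 mulr0 add0r.
by rewrite (horner_coef_wide _ sr) !big_ord_recl big_ord0 addr0 expr0 expr1 mulr1.
Qed.

Lemma CM_nonreal tau x : x \notin F -> complex.Im (tau x) != 0.
Proof.
have [delta [/(_ tau)[dc d0] /(_ x)[u [v [uF vF ->]]]]] := CM_basis.
move=> xF; have v0 : v != 0 by apply: contraNneq xF => ->; rewrite mul0r addr0.
have := real_on_subfield tau uF; have := real_on_subfield tau vF.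
have tv : tau v != 0 by rewrite fmorph_eq0.
move: tv dc d0; rewrite rmorphD rmorphM.
move: (tau u) (tau v) (tau delta) => [a a'] [b b'] [c c'].
rewrite !complex_real /= => + + + /eqP b0 /eqP a0.
rewrite a0 b0 !eq_complex /= !eqxx !andbT => b1 /eqP; rewrite eq_complex /=.
move=> /andP[/eqP c1 _]; have {}c1 : c = 0 by lra.
by rewrite c1 eqxx /= add0r mul0r addr0 => c2; rewrite mulf_neq0.
Qed.

Lemma CM_complex_place tau : exists x, tau x != (tau x)^*.
Proof.
have [delta [/(_ tau)[dc d0] _]] := CM_basis.
by exists delta; rewrite dc -subr_eq0 opprK -mulr2n mulrn_eq0 negb_or.
Qed.

Lemma real_conj (z : R[i]) : z \is Num.real -> z^* = z.
Proof. by rewrite CrealE => /eqP. Qed.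

(** The conjugation of K over F, u + v delta |-> u - v delta, induces complex
    conjugation under every embedding.  It preserves integrality since an
    element and its image have the same integral equations. *)
Lemma CM_conjugation tau0 x :
  exists y : K, (forall tau, tau y = (tau x)^*) /\ (integral x -> integral y).
Proof.
have [delta [dc /(_ x)[u [v [uF vF ->]]]]] := CM_basis.
exists (u - v * delta).
have conj tau : tau (u - v * delta) = (tau (u + v * delta))^*.
  have [dc' _] := dc tau.
  rewrite rmorphB rmorphD !rmorphM /= rmorphD rmorphM /= dc'.
  by rewrite !(real_conj (real_on_subfield tau _))// mulrN.
split=> // ix; apply/(integral_rmorph tau0); rewrite conj.
by apply/(integral_rmorph (conjc : {rmorphism R[i] -> R[i]}))/integral_rmorph.
Qed.

End CM.

(** * A Hermitian form near a unipotent matrix *)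

Local Close Scope complex_scope.

Section Bounds.
Variable R : realType.
Implicit Types (x y : R[i]) (A B : R).

Lemma normcD_le x y A B : normc x <= A -> normc y <= B -> normc (x + y) <= A + B.
Proof. by move=> xA yB; apply: le_trans (normcD _ _) _; exact: lerD. Qed.

Lemma normcB_le x y A B : normc x <= A -> normc y <= B -> normc (x - y) <= A + B.
Proof. by move=> xA yB; apply: le_trans (normcB _ _) _; exact: lerD. Qed.

Lemma normcM_le x y A B : normc x <= A -> normc y <= B -> normc (x * y) <= A * B.
Proof. by move=> xA yB; rewrite normcM ler_pM// normc_ge0. Qed.

Lemma normc_conj_le x A : normc x <= A -> normc x^* <= A.
Proof. by rewrite normc_conj. Qed.

End Bounds.

(** Estimates at one place away from the first.  There the form is
    c1 h_0l h_1k^* - c2 h_1l h_0k^* with factors of modulus one, and h has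
    entries a, b, c, d close to 1, b0, 0, 1 with b0 = eps + i eps^2.  The
    argument of b0 is of order eps, its imaginary part of order eps^2: the
    first makes the factors agree up to O(eps), the second dominates the error
    eta of the approximation. *)

Section NearUpper.
Variables (R : realType) (eps : R).
Hypotheses (eps0 : 0 < eps) (eps1 : eps <= 1).
Let eta := eps ^+ 2 / 50.
Let b0 : R[i] := Complex eps (eps ^+ 2).
Variables (a b c d c1 c2 : R[i]).
Hypotheses (ha : normc (a - 1) < eta) (hb : normc (b - b0) < eta)
  (hc : normc c < eta) (hd : normc (d - 1) < eta).
Hypotheses (n1 : normc c1 = 1) (n2 : normc c2 = 1).

Let eta0 : 0 < eta. Proof. by rewrite divr_gt0// exprn_gt0. Qed.
Let etaE : eps ^+ 2 = 50 * eta. Proof. by rewrite /eta mulrC divfK. Qed.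
Let eta_eps : 50 * eta <= eps.
Proof. by rewrite -etaE expr2 ler_piMr// ltW. Qed.
Let eta_eps_le : eta * eps <= eta. Proof. by rewrite ler_piMr// ltW. Qed.

Let ne1 : normc (1 : R[i]) <= 1. Proof. by rewrite normc1. Qed.
Let na' : normc (a - 1) <= eta. Proof. exact: ltW. Qed.
Let nb' : normc (b - b0) <= eta. Proof. exact: ltW. Qed.
Let nc : normc c <= eta. Proof. exact: ltW. Qed.
Let nd' : normc (d - 1) <= eta. Proof. exact: ltW. Qed.
Let n1' : normc c1 <= 1. Proof. by rewrite n1. Qed.
Let n2' : normc c2 <= 1. Proof. by rewrite n2. Qed.
Let nb0 : normc b0 <= 2 * eps.
Proof.
apply: le_trans (normc_le_ReIm _) _; rewrite /= !ger0_norm ?exprn_ge0 ?(ltW eps0)//.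
by have := etaE; have := eta_eps; lra.
Qed.
Let na : normc a <= 2.
Proof.
rewrite -[a](subrK 1); apply: le_trans (normcD_le na' ne1) _.
by have := eta_eps; have := eps1; lra.
Qed.
Let nd : normc d <= 2.
Proof.
rewrite -[d](subrK 1); apply: le_trans (normcD_le nd' ne1) _.
by have := eta_eps; have := eps1; lra.
Qed.
Let nb : normc b <= 3 * eps.
Proof.
rewrite -[b](subrK b0); apply: le_trans (normcD_le nb' nb0) _.
by have := eta_eps; have := eta0; lra.
Qed.

Lemma near_upper_diagonal : normc (c1 * b * d^* - c2 * d * b^*) <= 12 * eps.
Proof.
have h1 := normcM_le (normcM_le n1' nb) (normc_conj_le nd).
have h2 := normcM_le (normcM_le n2' nd) (normc_conj_le nb).
apply: le_trans (normcB_le h1 h2) _; lra.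
Qed.

Hypothesis diag_eq : c1 * b * d^* = c2 * d * b^*.

(** Solving the equation for c1 / c2 gives almost b0^* / b0. *)
Let c12 : normc (c1 - c2) <= 12 * eps.
Proof.
pose u := (d - 1) * b^* + (b^* - b0^*).
have nu : normc u <= 4 * eta.
  have h : normc (b^* - b0^*) <= eta by rewrite -rmorphB; exact: normc_conj_le.
  apply: le_trans (normcD_le (normcM_le nd' (normc_conj_le nb)) h) _.
  have := eta_eps_le; lra.
have E : (c1 - c2) * (b * d^*) = c2 * ((b0^* - b0) + (u - u^*)).
  have -> : u^* = (d^* - 1) * b + (b - b0).
    by rewrite rmorphD rmorphM !rmorphB rmorph1 /= !conjCK.
  by rewrite mulrBl mulrA diag_eq /u; ring.
have n0 : normc (b0^* - b0) <= 2 * eps ^+ 2.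
  apply: le_trans (normc_le_ReIm _) _.
  rewrite /= subrr normr0 add0r -opprD normrN ger0_norm ?addr_ge0 ?exprn_ge0 ?(ltW eps0)//.
  by lra.
have nE := normcM_le n2' (normcD_le n0 (normcB_le nu (normc_conj_le nu))).
rewrite -E !normcM normc_conj mul1r in nE.
have lb : eps / 2 <= normc b.
  have := normcB_le (lexx (normc b)) nb'; rewrite opprB addrC subrK.
  have := normc_Re b0; rewrite /= (ger0_norm (ltW eps0)) => h1 h2.
  by have := le_trans h1 h2; have := eta_eps; have := eps0; lra.
have ld : 1 / 2 <= normc d.
  have := normcB_le (lexx (normc d)) nd'; rewrite opprB addrC subrK normc1.
  by have := eta_eps; have := eps1; lra.
have lbd : eps / 4 <= normc b * normc d.
  apply: le_trans (ler_pM _ _ lb ld); rewrite ?divr_ge0 ?(ltW eps0)//; lra.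
have n12 := normc_ge0 (c1 - c2).
have := le_trans (ler_wpM2l n12 lbd) nE; rewrite etaE => h.
rewrite -(ler_pM2r eps0) -[leRHS]mulrA -expr2 etaE; have := eta0; lra.
Qed.

Lemma near_upper_sum :
  normc (c1 * (b * c^* + a * d^*) - c2 * (d * a^* + c * b^*)) <= 24 * eps.
Proof.
have -> : c1 * (b * c^* + a * d^*) - c2 * (d * a^* + c * b^*) =
  (c1 * (b * c^* + ((a - 1) * d^* + (d - 1)^*)) -
   c2 * (d * (a - 1)^* + (d - 1) + c * b^*)) + (c1 - c2).
  by rewrite !rmorphB rmorph1; ring.
have h1 := normcM_le n1' (normcD_le (normcM_le nb (normc_conj_le nc))
   (normcD_le (normcM_le na' (normc_conj_le nd)) (normc_conj_le nd'))).
have h2 := normcM_le n2' (normcD_le (normcD_le (normcM_le nd (normc_conj_le na')) nd')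
   (normcM_le nc (normc_conj_le nb))).
apply: le_trans (normcD_le (normcB_le h1 h2) c12) _.
have := eta_eps; have := eta_eps_le; have := eta0; lra.
Qed.

(** Eliminating c1 and c2 from the two equations shows that z, which is close to
    b0^*, is real. *)
Lemma near_upper_contra : c1 * (b * c^* + a * d^*) = c2 * (d * a^* + c * b^*) -> False.
Proof.
move=> sum_eq; pose z := b * b^* * c^* * d + a * b^* * d * d^*.
have c1n0 : c1 != 0 by rewrite -normc_gt0 n1.
have zc : z = z^*.
  apply: (mulfI c1n0).
  have -> : z^* = b^* * b * c * d^* + a^* * b * d^* * d.
    by rewrite rmorphD !rmorphM /= !conjCK.
  have -> : c1 * z = (c1 * (b * c^* + a * d^*)) * d * b^* by rewrite /z; ring.
  have -> : c1 * (b^* * b * c * d^* + a^* * b * d^* * d) =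
     (c1 * b * d^*) * (d * a^* + c * b^*) by ring.
  by rewrite sum_eq diag_eq; ring.
have Imz : complex.Im z = 0 by move: zc; case: (z) => x y /= [] ; lra.
pose w := b * b^* * c^* * d + (a - 1) * b^* * d * d^* + b^* * (d - 1) * d^* +
  b^* * (d - 1)^* + (b - b0)^*.
have zw : z = w + b0^* by rewrite /z /w !rmorphB rmorph1; ring.
have nbb := normc_conj_le nb.
have nw : normc w <= 40 * eta.
  have h1 := normcM_le (normcM_le (normcM_le nb nbb) (normc_conj_le nc)) nd.
  have h2 := normcM_le (normcM_le (normcM_le na' nbb) nd) (normc_conj_le nd).
  have h3 := normcM_le (normcM_le nbb nd') (normc_conj_le nd).
  have h4 := normcM_le nbb (normc_conj_le nd').
  apply: le_trans (normcD_le (normcD_le (normcD_le (normcD_le h1 h2) h3) h4) (normc_conj_le nb')) _.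
  have h5 : eps * eps * eta <= eta.
    by rewrite -mulrA [_ * eta]mulrC; have := eta_eps_le; have := eps1; have := eps0; nra.
  have := eta_eps_le; lra.
have Imw : complex.Im w = eps ^+ 2.
  move: Imz; rewrite zw; case: (w) => x y /=; lra.
have := normc_Im w; rewrite Imw ger0_norm ?exprn_ge0 ?(ltW eps0)// etaE => h.
by have := le_trans h nw; have := eta0; lra.
Qed.

End NearUpper.

(** * The form at the first place *)

Section FirstPlace.
Variable R : realType.
Implicit Types (s m b p q x y : R[i]) (a : R).

(** The growth of one factor is compensated by the decay of the other. *)
Let product_bound s m m1 m2 b : 1 <= normc s -> normc m <= 2 -> normc m1 <= 2 ->
  normc m2 <= 2 -> normc (m / s) * normc (s * m1 - b * (m2 / s)) <= 4 + 4 * normc b.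
Proof.
move=> s1 hm hm1 hm2; have s0 : 0 < normc s by exact: lt_le_trans s1.
have sn0 : s != 0 by rewrite -normc_gt0.
rewrite -normcM.
have -> : m / s * (s * m1 - b * (m2 / s)) = m * m1 - b * (m * m2) / s ^+ 2 by field.
have h1 := normcM_le hm hm1.
have h2 : normc (b * (m * m2) / s ^+ 2) <= normc b * (2 * 2).
  rewrite normcM; apply: le_trans (normcM_le (lexx _) (normcM_le hm hm2)).
  rewrite ler_piMr ?normc_ge0// normcV normcX invf_le1 ?exprn_gt0//.
  exact: exprn_ege1.
by apply: le_trans (normcB_le h1 h2) _; lra.
Qed.

Variables (a : R) (b : R[i]).
Hypothesis ab0 : 1 + a%:RC * b != 0.

(** As a is real, p may be replaced by the row x = p + a q in the form; x is of
    size 1/s and q of size s. *)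
Lemma form_bound_large s p q p' q' m0 m1 m0' m1' : 1 <= normc s ->
    s * (p + a%:RC * q) = m0 -> s^-1 * (b * p + (1 + a%:RC * b) * q) = m1 ->
    s * (p' + a%:RC * q') = m0' -> s^-1 * (b * p' + (1 + a%:RC * b) * q') = m1' ->
    normc m0 <= 2 -> normc m1 <= 2 -> normc m0' <= 2 -> normc m1' <= 2 ->
  normc (p * q'^* - q * p'^*) <= 8 + 8 * normc b.
Proof.
move=> s1 e0 e1 e0' e1' h0 h1 h0' h1'.
have s0 : s != 0 by rewrite -normc_gt0; exact: lt_le_trans s1.
have ac : (a%:RC)^* = a%:RC by apply/eqP; rewrite -CrealE; apply/complex_realP; exists a.
have -> : p * q'^* - q * p'^* = (m0 / s) * (s * m1' - b * (m0' / s))^* -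
    (s * m1 - b * (m0 / s)) * (m0' / s)^*.
  have -> : m0 / s = p + a%:RC * q by rewrite -e0; field.
  have -> : m0' / s = p' + a%:RC * q' by rewrite -e0'; field.
  have -> : s * m1 - b * (p + a%:RC * q) = q by rewrite -e1; field.
  have -> : s * m1' - b * (p' + a%:RC * q') = q' by rewrite -e1'; field.
  by rewrite rmorphD rmorphM /= ac; ring.
have P1 : normc (m0 / s * (s * m1' - b * (m0' / s))^*) <= 4 + 4 * normc b.
  by rewrite normcM normc_conj; exact: product_bound.
have P2 : normc ((s * m1 - b * (m0 / s)) * (m0' / s)^*) <= 4 + 4 * normc b.
  by rewrite normcM normc_conj mulrC; exact: product_bound.
by apply: le_trans (normcB_le P1 P2) _; lra.
Qed.

(** The factor rho / rho^* is what allows q to be replaced by the row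
    y = rho p + q, which is of size s, while p is of size 1/s. *)
Lemma form_bound_small s p q p' q' m0 m1 m0' m1' : s != 0 -> normc s <= 1 -> b != 0 ->
    s * (p + a%:RC * q) = m0 -> s^-1 * (b * p + (1 + a%:RC * b) * q) = m1 ->
    s * (p' + a%:RC * q') = m0' -> s^-1 * (b * p' + (1 + a%:RC * b) * q') = m1' ->
    normc m0 <= 2 -> normc m1 <= 2 -> normc m0' <= 2 -> normc m1' <= 2 ->
  forall rho, rho = b / (1 + a%:RC * b) ->
  normc (rho / rho^* * p * q'^* - q * p'^*) <=
    8 + 8 * normc (a%:RC / (1 + a%:RC * b)).
Proof.
move: ab0; set D := 1 + a%:RC * b => Dn0 sn0 s1 bn0 e0 e1 e0' e1' h0 h1 h0' h1' rho rhoE.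
have s0 : 0 < normc s by rewrite normc_gt0.
have sV : 1 <= normc s^-1 by rewrite normcV invf_ge1.
have rn0 : rho != 0 by rewrite rhoE mulf_neq0// invr_eq0.
have rcn0 : rho^* != 0 by rewrite fmorph_eq0.
pose c := a%:RC / D.
have nrr : normc (rho / rho^*) = 1.
  by rewrite normcM normcV normc_conj divff// normc_eq0.
have -> : rho / rho^* * p * q'^* - q * p'^* =
    rho / rho^* * (D * (s^-1 * m0 - c * (m1 / s^-1))) * ((m1' / s^-1) / D)^* -
    ((m1 / s^-1) / D) * (D * (s^-1 * m0' - c * (m1' / s^-1)))^*.
  have -> : D * (s^-1 * m0 - c * (m1 / s^-1)) = p.
    by rewrite -e0 -e1 /c invrK /D; field; rewrite sn0.
  have -> : D * (s^-1 * m0' - c * (m1' / s^-1)) = p'.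
    by rewrite -e0' -e1' /c invrK /D; field; rewrite sn0.
  have -> : m1 / s^-1 / D = rho * p + q by rewrite -e1 rhoE invrK; field; rewrite Dn0 sn0.
  have -> : m1' / s^-1 / D = rho * p' + q' by rewrite -e1' rhoE invrK; field; rewrite Dn0 sn0.
  by rewrite rmorphD rmorphM /=; field.
have nD : normc D != 0 by rewrite normc_eq0.
have swap (u v w : R[i]) : normc u = 1 -> normc (u * (D * v) * (w / D)^*) = normc w * normc v.
  by move=> u1; rewrite !normcM normc_conj normcM normcV u1; field.
have P1 : normc (rho / rho^* * (D * (s^-1 * m0 - c * (m1 / s^-1))) * ((m1' / s^-1) / D)^*)
    <= 4 + 4 * normc c.
  by rewrite swap//; exact: product_bound.
have P2 : normc (((m1 / s^-1) / D) * (D * (s^-1 * m0' - c * (m1' / s^-1)))^*) <= 4 + 4 * normc c.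
  have -> : normc (m1 / s^-1 / D * (D * (s^-1 * m0' - c * (m1' / s^-1)))^*) =
      normc (m1 / s^-1) * normc (s^-1 * m0' - c * (m1' / s^-1)).
    by rewrite [LHS]normcM normc_conj normcM normcV [normc (D * _)]normcM mulrA divfK.
  exact: product_bound.
by apply: le_trans (normcB_le P1 P2) _; lra.
Qed.

End FirstPlace.

(** * The torus orbit is not dense *)

Section TorusNotDense.
Variables (R : realType) (K : fieldExtType rat) (r : nat).
Variable sigma : 'I_r -> {rmorphism K -> R[i]}.
Local Notation integral x := (integralOver (intr : int -> K) x).
Variables (i0 i1 : 'I_r).
Hypothesis i10 : i1 != i0.
Hypothesis norm_ge1 : forall x : K, integral x -> x != 0 -> 1 <= \prod_i normc (sigma i x).

Lemma small_integral_eq0 (x : K) (B e : R) : integral x ->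
  normc (sigma i0 x) <= B -> (forall i, i != i0 -> normc (sigma i x) <= e) ->
  0 <= e <= 1 -> B * e < 1 -> x = 0.
Proof.
move=> ix hB he /andP[e0 e1] Be; apply: contraTeq Be => x0; rewrite -leNgt.
apply: le_trans (norm_ge1 ix x0) _; rewrite (bigD1 i0)//= (bigD1 i1)//=.
apply: ler_pM => //; [exact: normc_ge0|by rewrite mulr_ge0 ?normc_ge0 ?prodr_ge0// => i _; exact: normc_ge0|].
apply: le_trans (_ : e * 1 <= e); last by rewrite mulr1.
apply: ler_pM => //; [exact: normc_ge0|by apply: prodr_ge0 => i _; exact: normc_ge0|exact: he|].
apply: prodr_ile1 => i /andP[ii0 _]; rewrite normc_ge0 /=.
exact: le_trans (he i ii0) e1.
Qed.

Variable bar : K -> K.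
Hypothesis barE : forall x i, sigma i (bar x) = (sigma i x)^*.
Hypothesis bar_int : forall x, integral x -> integral (bar x).

Let form (kap p q p' q' : K) := kap * p * bar q' - q * bar p'.

Let formE i kap p q p' q' : sigma i (form kap p q p' q') =
  sigma i kap * sigma i p * (sigma i q')^* - sigma i q * (sigma i p')^*.
Proof. by rewrite rmorphB !rmorphM !barE. Qed.

Let form_int (m : nat) kap p q p' q' : integral (m%:R * kap) ->
  integral p -> integral q -> integral p' -> integral q' ->
  integral (m%:R * form kap p q p' q').
Proof.
move=> ik ip iq ip' iq'; rewrite /form mulrBr !mulrA.
have inat : integral (m%:R : K) by rewrite -(rmorph_nat (intr : {rmorphism int -> K})); exact: integral_id.
apply: integral_sub; apply: integral_mul; [exact: integral_mul|exact: bar_int|exact: integral_mul|exact: bar_int].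
Qed.

(** The value of the form at the second column of A, and the sum of its two
    mixed values, have norm less than one: bounded at the first place and of
    order eps elsewhere.  So both vanish, against near_upper_contra. *)
Lemma no_small_form (kap : K) (m : nat) (C eps : R) (A : SL2 K) (h : GS R r)
    (s : 'I_r -> R[i]) :
  (forall i, normc (sigma i kap) = 1) -> (0 < m)%N -> integral (m%:R * kap) ->
  SL2_OK A ->
  (forall k l, normc (sigma i0 (form kap (A 0 k) (A 1 k) (A 0 l) (A 1 l))) <= C) ->
  0 < eps -> eps * (24 * m%:R * (m%:R * (2 * C) + 1)) <= 1 -> 
  (forall i, i != i0 -> [/\ s i != 0,
     forall k, h i 0 k = s i * sigma i (A 0 k) &
     forall k, h i 1 k = (s i)^-1 * sigma i (A 1 k)]) ->
  (forall i, i != i0 -> forall k l,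
     normc (h i k l - upper (Complex eps (eps ^+ 2)) k l) < eps ^+ 2 / 50) -> False.
Proof.
move=> kap1 m0 imk OA hC eps0 epsC hE near.
have C0 : 0 <= C by apply: le_trans (normc_ge0 _) (hC 0 0).
have mR : 1 <= m%:R :> R by rewrite ler1n.
have mC : 0 <= m%:R * (2 * C) by rewrite mulr_ge0 ?mulr_ge0// ler0n.
have eps24 : 24 * eps * m%:R * (m%:R * (2 * C) + 1) <= 1.
  by apply: le_trans epsC; rewrite le_eqVlt; apply/orP; left; apply/eqP; ring.
have me0 : 0 <= 24 * eps * m%:R by rewrite !mulr_ge0// ltW.
have me1 : 24 * eps * m%:R <= 1.
  by apply: le_trans eps24; rewrite ler_peMr// lerDr.
have eps1 : eps <= 1.
  apply: le_trans me1; rewrite mulrAC ler_peMl ?(ltW eps0)//; lra.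
pose c1 i := sigma i kap * ((s i)^* / s i).
pose c2 i := s i / (s i)^*.
have nq i : i != i0 -> normc ((s i)^* / s i) = 1.
  by move=> /hE[sn0 _ _]; rewrite normcM normcV normc_conj divff// normc_eq0.
have n1 i : i != i0 -> normc (c1 i) = 1 by move=> ii0; rewrite normcM kap1 nq// mulr1.
have n2 i : i != i0 -> normc (c2 i) = 1.
  by move=> /hE[sn0 _ _]; rewrite normcM normcV normc_conj divff// normc_eq0.
have fE i k l : i != i0 -> sigma i (form kap (A 0 k) (A 1 k) (A 0 l) (A 1 l)) =
   c1 i * h i 0 k * (h i 1 l)^* - c2 i * h i 1 k * (h i 0 l)^*.
  move=> /hE[sn0 h0 h1]; rewrite formE !h0 !h1 /c1 /c2 !rmorphM fmorphV /=.
  have scn0 : (s i)^* != 0 by rewrite fmorph_eq0.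
  by field; rewrite sn0 scn0.
have nearE i (ii0 : i != i0) : [/\ normc (h i 0 0 - 1) < eps ^+ 2 / 50,
    normc (h i 0 1 - Complex eps (eps ^+ 2)) < eps ^+ 2 / 50,
    normc (h i 1 0) < eps ^+ 2 / 50 & normc (h i 1 1 - 1) < eps ^+ 2 / 50].
  have := near i ii0; move=> nr; have := nr 0 0; have := nr 0 1; have := nr 1 0.
  by have := nr 1 1; rewrite !upperE subr0.
have iA k l : integral (A k l) by exact: OA.
have nm (x : K) i : normc (sigma i (m%:R * x)) = m%:R * normc (sigma i x).
  rewrite rmorphM rmorph_nat normcM -[m%:R in LHS](rmorph_nat (@RtoC R)) normc_RtoC.
  by rewrite ger0_norm// ler0n.
have mK : m%:R != 0 :> K.
  apply: contraTneq m0 => mK; have : sigma i0 m%:R = 0 by rewrite mK rmorph0.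
  by rewrite rmorph_nat => /eqP; rewrite pnatr_eq0 => /eqP ->.
have kill (x : K) : integral (m%:R * x) -> normc (sigma i0 x) <= 2 * C ->
    (forall i, i != i0 -> normc (sigma i x) <= 24 * eps) -> x = 0.
  move=> ix hx he; apply: (mulfI mK); rewrite mulr0.
  apply: (small_integral_eq0 (B := m%:R * (2 * C)) (e := 24 * eps * m%:R)) => //.
  - by rewrite nm ler_wpM2l// ler0n.
  - by move=> i ii0; rewrite nm mulrC ler_wpM2r ?ler0n//; exact: he.
  - by rewrite me0.
  rewrite mulrC; apply: lt_le_trans eps24.
  by rewrite mulrDr mulr1 ltrDl !mulr_gt0// (lt_le_trans _ mR).
have z1 : form kap (A 0 1) (A 1 1) (A 0 1) (A 1 1) = 0.
  apply: kill => [||i ii0]; first exact: form_int.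
    by apply: le_trans (hC 1 1) _; lra.
  have [ha hb hc hd] := nearE i ii0.
  rewrite fE//; apply: le_trans (near_upper_diagonal eps0 eps1 hb hd (n1 i ii0) (n2 i ii0)) _.
  lra.
have eq1 i : i != i0 -> c1 i * h i 0 1 * (h i 1 1)^* = c2 i * h i 1 1 * (h i 0 1)^*.
  by move=> ii0; apply/eqP; rewrite -subr_eq0 -fE// z1 rmorph0.
have sumE i : i != i0 -> sigma i (form kap (A 0 1) (A 1 1) (A 0 0) (A 1 0) +
    form kap (A 0 0) (A 1 0) (A 0 1) (A 1 1)) =
  c1 i * (h i 0 1 * (h i 1 0)^* + h i 0 0 * (h i 1 1)^*) -
  c2 i * (h i 1 1 * (h i 0 0)^* + h i 1 0 * (h i 0 1)^*).
  by move=> ii0; rewrite rmorphD !fE//; ring.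
have z2 : form kap (A 0 1) (A 1 1) (A 0 0) (A 1 0) +
    form kap (A 0 0) (A 1 0) (A 0 1) (A 1 1) = 0.
  apply: kill => [||i ii0].
  - by rewrite mulrDr; apply: integral_add; exact: form_int.
  - by rewrite rmorphD; apply: le_trans (normcD_le (hC 1 0) (hC 0 1)) _; lra.
  have [ha hb hc hd] := nearE i ii0.
  by rewrite sumE//; exact: (near_upper_sum eps0 eps1 ha hb hc hd (n1 i ii0) (n2 i ii0) (eq1 i ii0)).
have [ha hb hc hd] := nearE i1 i10.
apply: (near_upper_contra eps0 eps1 ha hb hc hd (n1 i1 i10) (eq1 i1 i10)).
by apply/eqP; rewrite -subr_eq0 -sumE// z2 rmorph0.
Qed.

Let is_diagE (t g : SL2 R[i]) : is_diag_mx t -> [/\ t 0 0 != 0,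
  forall k, (t * g)%g 0 k = t 0 0 * g 0 k &
  forall k, (t * g)%g 1 k = (t 0 0)^-1 * g 1 k].
Proof.
move=> /is_diag_mxP td; have t01 : t 0 1 = 0 by apply: td.
have t10 : t 1 0 = 0 by apply: td.
have := SL2_det2 t; rewrite t01 mul0r subr0 => tt.
have t0 : t 0 0 != 0 by apply: contra_eq_neq tt => ->; rewrite mul0r eq_sym oner_eq0.
split=> // k; rewrite SL2_mulE ?t01 ?t10 mul0r ?addr0 ?add0r//; congr (_ * _).
by apply: (mulfI t0); rewrite tt divff.
Qed.

Let crossE (a : R) (b : R[i]) (g : SL2 R[i]) :
  (forall k, (lower b * upper a%:RC * g)%g 0 k = g 0 k + a%:RC * g 1 k) /\
  (forall k, (lower b * upper a%:RC * g)%g 1 k = b * g 0 k + (1 + a%:RC * b) * g 1 k).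
Proof.
split=> k; rewrite SL2_mulE !(SL2_mulE (lower b)) !upperE !lowerE; ring.
Qed.

Hypothesis denominator : forall x : K, exists2 m : nat, (0 < m)%N & integral (m%:R * x).
Variables (alpha beta : K) (a : R) (b : R[i]).
Hypotheses (alphaE : sigma i0 alpha = a%:RC) (betaE : sigma i0 beta = b).
Hypotheses (b0 : b != 0) (ab0 : 1 + a%:RC * b != 0).

(** The target is a box around the matrix that is 1 at the first place and
    upper (eps + i eps^2) elsewhere; eps is fixed after the denominator m of the
    multiplier and the bound C, none of which depends on the orbit point. *)
Theorem torus_not_dense : ~ dense (orbit_Gamma (@torus R r)
  (pi_Gamma sigma (at_place i0 (lower b * upper a%:RC)%g))).
Proof.
move=> dO.
pose rho := beta / (1 + alpha * beta).
have rhoE : sigma i0 rho = b / (1 + a%:RC * b).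
  by rewrite fmorph_div rmorphD rmorphM rmorph1 /= alphaE betaE.
have rho0 : rho != 0.
  by rewrite -(fmorph_eq0 (sigma i0)) rhoE mulf_neq0// invr_eq0.
pose kap := rho / bar rho.
have kap1 i : normc (sigma i kap) = 1.
  by rewrite fmorph_div /= barE normcM normcV normc_conj divff// normc_eq0 fmorph_eq0.
have [m m0 imk] := denominator kap.
pose C : R := 8 + 8 * normc b + 8 * normc (a%:RC / (1 + a%:RC * b)).
have nb := normc_ge0 b; have nc := normc_ge0 (a%:RC / (1 + a%:RC * b)).
have mR : 1 <= m%:R :> R by rewrite ler1n.
have m2C : 0 <= m%:R * (2 * C) by rewrite mulr_ge0 ?ler0n// /C; lra.
pose M := 24 * m%:R * (m%:R * (2 * C) + 1).
have M1 : 1 <= M.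
  have h1 : 1 <= m%:R * (2 * C) + 1 by rewrite lerDr.
  apply: le_trans h1 _; rewrite /M ler_peMl ?addr_ge0//; lra.
have M0 : 0 < M by exact: lt_le_trans M1.
pose eps := M^-1; have eps0 : 0 < eps by rewrite invr_gt0.
have epsM : eps * M <= 1 by rewrite mulVf// gt_eqF.
have eps1 : eps <= 1 by rewrite invf_le1.
have eta0 : 0 < eps ^+ 2 / 50 by rewrite divr_gt0// exprn_gt0.
have eta1 : eps ^+ 2 / 50 <= 1.
  have : eps ^+ 2 <= 1 by rewrite exprn_ile1// ltW.
  lra.
pose h0 : GS R r := fun i => if i == i0 then 1%g else upper (Complex eps (eps ^+ 2)).
have [h hh []] := dense_pi h0 dO eta0.
move=> t Tt; rewrite act_Gamma_pi => /pi_GammaP[A OA AE].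
have hE i : h i = (t i * (at_place i0 (lower b * upper a%:RC) i * SL2_map (sigma i) A))%g.
  have -> : SL2_map (sigma i) A = ((t i * at_place i0 (lower b * upper a%:RC)%g i)^-1 * h i)%g.
    have := congr1 (fun f : GS R r => f i) AE. by [].

  by rewrite !mulgA mulgV mul1g.
have hother i : i != i0 -> [/\ t i 0 0 != 0,
     forall k, h i 0 k = t i 0 0 * sigma i (A 0 k) &
     forall k, h i 1 k = (t i 0 0)^-1 * sigma i (A 1 k)].
  move=> ii0; have [tn0 e0 e1] := is_diagE (SL2_map (sigma i) A) (Tt i).
  split=> // k; rewrite hE at_place_neq// mul1g.
    by rewrite e0 mxE.
  by rewrite e1 mxE.
have near i : i != i0 -> forall k l,
     normc (h i k l - upper (Complex eps (eps ^+ 2)) k l) < eps ^+ 2 / 50.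
  by move=> ii0 k l; have := hh i k l; rewrite /h0 (negPf ii0).
have h_first k l : normc (h i0 k l) <= 2.
  have := hh i0 k l; rewrite /h0 eqxx => hd.
  rewrite -[h i0 k l](subrK ((1%g : SL2 R[i]) k l)).
  have n1 : normc ((1%g : SL2 R[i]) k l) <= 1.
    by case: (ord2P k) => ->; case: (ord2P l) => ->; rewrite SL2_oneE ?normc0 ?normc1.
  apply: le_trans (normcD_le (ltW hd) n1) _; lra.
have [t0 e0 e1] := is_diagE (lower b * upper a%:RC * SL2_map (sigma i0) A)%g (Tt i0).
have [x0 x1] := crossE a b (SL2_map (sigma i0) A).
have hE0 : h i0 = (t i0 * (lower b * upper a%:RC * SL2_map (sigma i0) A))%g.
  by rewrite hE at_place_eq.
have r0 k : t i0 0 0 * (sigma i0 (A 0 k) + a%:RC * sigma i0 (A 1 k)) = h i0 0 k.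
  by rewrite hE0 e0 x0 !mxE.
have r1 k : (t i0 0 0)^-1 * (b * sigma i0 (A 0 k) + (1 + a%:RC * b) * sigma i0 (A 1 k)) = h i0 1 k.
  by rewrite hE0 e1 x1 !mxE.
(* the size of t at the first place decides which multiplier is bounded there *)
have [s1|s1] := lerP 1 (normc (t i0 0 0)).
  apply: (@no_small_form 1 m C eps A h (fun i => t i 0 0)) => //.
  - by move=> i; rewrite rmorph1 normc1.
  - by rewrite mulr1 -(rmorph_nat (intr : {rmorphism int -> K})); exact: integral_id.
  move=> k l; rewrite formE rmorph1 mul1r.
  apply: le_trans (form_bound_large s1 (r0 k) (r1 k) (r0 l) (r1 l) _ _ _ _) _ => //.
  by rewrite /C; lra.
apply: (@no_small_form kap m C eps A h (fun i => t i 0 0)) => //.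
move=> k l; rewrite formE fmorph_div /= barE rhoE.
apply: le_trans (form_bound_small ab0 t0 (ltW s1) b0 (r0 k) (r1 k) (r0 l) (r1 l) _ _ _ _ (erefl _)) _ => //.
by rewrite /C; lra.
Qed.

End TorusNotDense.

(** * The theorem *)

(** A homogeneous closure L x is itself a closed orbit.  It is everything when
    L is the whole group, because G acts transitively. *)
Lemma not_homogeneous (R : realType) (K : fieldExtType rat) (r : nat)
    (sigma : 'I_r -> {rmorphism K -> R[i]}) (M : set (GS R r)) (x : GmodGamma sigma) :
  ~ dense (orbit_Gamma M x) ->
  ~ in_countable_union_of_closed_proper_orbits
      (closure (orbit_Gamma M x) `\` orbit_Gamma M x) ->
  ~ homogeneous_closure M x.
Proof.
move=> ndense ncover [L [cL clE]].
have [LT|LT] := pselect (L = setT).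
  apply: ndense => U [y Uy] oU.
  have : closure (orbit_Gamma M x) y.
    rewrite clE LT -(repr_GammaK y) -(repr_GammaK x).
    by exists (repr_Gamma y * (repr_Gamma x)^-1)%g => //; rewrite act_Gamma_pi mulgVK.
  by move=> /(_ U (open_nbhs_nbhs (conj oU Uy))); rewrite setIC.
apply: ncover; exists [set closure (orbit_Gamma M x)]; split.
- exact: countable1.
- by move=> _ ->; exists L, x; split=> //; exact: closed_closure.
- by move=> y [yC _]; exists (closure (orbit_Gamma M x)).
Qed.

Lemma integral_denominator (K : fieldExtType rat) (th : K) (p : {poly int}) :
  p \is monic ->
  (forall q, (map_poly (ofrat K) q).[th] = 0 <-> map_poly intr p %| q) ->
  (forall x : K, exists q, x = (map_poly (ofrat K) q).[th]) ->
  forall x : K, exists2 m : nat, (0 < m)%N & integralOver (intr : int -> K) (m%:R * x).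
Proof.
move=> mon_p min_p gen_th x; have [f [D [D0 Dx]]] := clear_denominators (gen_th x).
have iD : integralOver (intr : int -> K) (D%:~R * x).
  by rewrite -Dx; exact: (integral_evZ mon_p min_p).
exists `|D|%N; first by rewrite absz_gt0.
have -> : `|D|%N%:R * x = (-1) ^+ (D < 0)%R * (D%:~R * x).
  rewrite mulrA; congr (_ * _); rewrite -[LHS]/((`|D|%N : int)%:~R) abszE normrEsign.
  by rewrite rmorphM rmorph_sign.
by case: (D < 0); rewrite ?expr0 ?expr1 ?mul1r// mulN1r; exact: integral_opp.
Qed.

Theorem theorem8p1 (R : realType) (K : fieldExtType rat) (F : {subfield K})
    (r : nat) (sigma : 'I_r -> {rmorphism K -> R[i]}) (alpha beta : K)
    (hCM : CM_extension R F) (hS : archimedean_places sigma) (hr : (2 < r)%N)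
    (halpha : alpha \in F) (halpha0 : alpha != 0) (hbeta : beta \notin F) :
  let T := @torus R r in
  let TR := @real_torus R r in
  let x := pi_Gamma sigma (g_elt sigma alpha beta) in
  [/\ ~ dense (orbit_Gamma T x) /\ ~ dense (orbit_Gamma TR x),
      ~ in_countable_union_of_closed_proper_orbits
          (closure (orbit_Gamma T x) `\` orbit_Gamma T x) /\
      ~ in_countable_union_of_closed_proper_orbits
          (closure (orbit_Gamma TR x) `\` orbit_Gamma TR x)
    & ~ homogeneous_closure T x /\ ~ homogeneous_closure TR x].
Proof.
move=> T TR x.
have r0 : (0 < r)%N by apply: leq_trans hr.
have r1 : (1 < r)%N by apply: leq_trans hr.
pose i0 := Ordinal r0; pose i1 := Ordinal r1; pose i2 := Ordinal hr.
have i10 : i1 != i0 by [].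
have [i01 i02 i12] : [/\ i0 != i1, i0 != i2 & i1 != i2] by [].
have [th [p [mon_p _ sep_p [min_p gen_th]]]] := integral_primitive_element K.
have p_factors := min_poly_factors min_p gen_th hS
  (fun i => CM_complex_place hCM (sigma i)) mon_p sep_p.
have near_one := unit_near_one r0 mon_p p_factors gen_th min_p i01 i02 i12.
have bar_ex y := CM_conjugation hCM (sigma i0) y.
have bar_sigma (y : K) : exists z : K, (forall i, sigma i z = (sigma i y)^*) /\
    (integralOver (intr : int -> K) y -> integralOver (intr : int -> K) z).
  by have [z [zE zi]] := bar_ex y; exists z.
have units_dense := real_units_dense near_one bar_sigma.
have int_dense := integers_dense r0 mon_p p_factors sep_p min_p.
pose bar y := sval (cid (bar_sigma y)).
have barE y i : sigma i (bar y) = (sigma i y)^*.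
  by have [] := svalP (cid (bar_sigma y)).
have bar_int y : integralOver (intr : int -> K) y -> integralOver (intr : int -> K) (bar y).
  by have [] := svalP (cid (bar_sigma y)).
have [a aE] : exists a : R, sigma i0 alpha = a%:RC.
  have := real_on_subfield hCM (sigma i0) halpha.
  by move=> /complex_realP[a ->]; exists a.
have a0 : a != 0.
  by apply: contra_neq halpha0 => a0; apply/eqP; rewrite -(fmorph_eq0 (sigma i0)) aE a0 rmorph0.
pose b := sigma i0 beta.
have bI : complex.Im b != 0 by exact: (CM_nonreal hCM).
have xE : x = pi_Gamma sigma (at_place i0 (lower b * upper a%:RC)%g).
  congr (pi_Gamma _ _); apply/funext => i; rewrite /g_elt /at_place.
  rewrite -[i == i0]/(i == 0%N :> nat); have [i0E|//] := eqVneq (i : nat) 0%N.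
  have -> : i = i0 by exact: val_inj.
  by rewrite SL2_mapM SL2_map_lower SL2_map_upper aE.
have b0 : b != 0 by apply: contra_neq bI => ->.
have ab0 : 1 + a%:RC * b != 0.
  apply: contra_neq bI => /(congr1 (@complex.Im R)); case: (b) => u v /=.
  rewrite !(mul0r, add0r, addr0) => /eqP; rewrite mulf_eq0 (negPf a0) => /eqP//.
have dT : ~ dense (orbit_Gamma T x).
  rewrite xE; apply: (torus_not_dense i10 _ barE bar_int _ aE (erefl b) b0 ab0).
    exact: (integral_norm_ge1 r0 mon_p p_factors gen_th).
  exact: (integral_denominator mon_p min_p gen_th).
have sub : orbit_Gamma TR x `<=` orbit_Gamma T x by move=> y [t [Tt _] <-]; exists t.
have dTR : ~ dense (orbit_Gamma TR x).
  move=> dd; apply: dT => U U0 oU; have [y [Uy Oy]] := dd U U0 oU.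
  by exists y; split=> //; exact: sub.
have cov M : TR `<=` M -> M `<=` T -> ~ in_countable_union_of_closed_proper_orbits
    (closure (orbit_Gamma M x) `\` orbit_Gamma M x).
  by move=> h1 h2; rewrite xE; exact: (not_covered i10 (int_dense i0) units_dense a0 bI h1 h2).
have TRT : TR `<=` T by move=> h [].
have cT := cov T TRT (@subset_refl _ T).
have cTR := cov TR (@subset_refl _ TR) TRT.
split; split => //; exact: not_homogeneous.
Qed.
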